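(* Let $t,\theta>0$ and $\lambda>1$, and set $q=\frac{t}{\theta(\lambda-1)}$. Then $$\mu_{t,\theta,\lambda}=D_{t(\lambda-1)}\Big(\pi_{1,q}\boxtimes\big(\pi_{1,1+t/\theta}\big)^{\langle-1\rangle}\Big)=\mu_{t,\theta,1}\boxtimes\pi_{q^{-1},q}.$$ In particular $\mu_{t,\theta,1+t/\theta}=\mu_{t,\theta,1}\boxtimes\pi_{1,1}$, so $\mu_{t,\theta,1+t/\theta}$ is a free compound Poisson distribution.
   Context: For $\theta>0,\lambda>0$ put $a^\pm=\theta(\sqrt\lambda\pm1)^2$, $k_{\theta,\lambda}(x)=\frac{\sqrt{(a^+-x)(x-a^-)}}{2\pi\theta x}\mathbf 1_{(a^-,a^+)}(x)$, and let $\pi_{\theta,\lambda}=\max\{0,1-\lambda\}\delta_0+k_{\theta,\lambda}(x)dx$ be the Marchenko–Pastur law. The R-transform of a probability measure $\mu$ on $\mathbb R$ is $R_\mu(w)=wF_\mu^{\langle-1\rangle}(1/w)-1$ with $F_\mu=1/G_\mu$, $G_\mu(z)=\int\frac{\mu(dx)}{z-x}$. For $t,\theta>0,\lambda\ge1$, $\mu_{t,\theta,\lambda}$ is the probability measure with $R_{\mu_{t,\theta,\lambda}}(z)=\int\big(\frac{1}{1-zx}-1\big)\frac{t\,k_{\theta,\lambda}(x)}{x}dx$, $z\in\mathbb C^-$. $D_c(\mu)(B)=\mu(\{x/c:x\in B\})$ for $c\ne0$; for $\mu$ on $[0,\infty)$ with $\mu(\{0\})=0$, $\mu^{\langle-1\rangle}(B)=\mu(\{x^{-1}:x\in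 B\})$. $\boxtimes$ denotes free multiplicative convolution of probability measures on $[0,\infty)$. *)

(* Defs.v *)
From mathcomp Require Import all_boot all_order all_algebra.
From mathcomp Require Import all_classical all_reals all_analysis.
From mathcomp Require Import complex.

Set Implicit Arguments.
Unset Strict Implicit.
Unset Printing Implicit Defensive.

Import Order.TTheory GRing.Theory Num.Theory.
Import numFieldNormedType.Exports.

Local Open Scope classical_set_scope.
Local Open Scope ring_scope.

Section Defs.
Variable R : realType.

(* Measures on R are handled as set functions  set R -> \bar R  (the type
   of mathcomp-analysis measures); they are compared on Borel sets. *)
Definition meq (mu nu : set R -> \bar R) : Prop :=
  forall B : set R, measurable B -> mu B = nu B.

Definition rint (mu : set R -> \bar R) (f : R -> R) : R :=
  fine (\int[mu]_(x in [set: R]) (f x)%:E)%E.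

Definition cint (mu : set R -> \bar R) (f : R -> R[i]) : R[i] :=
  Complex (rint mu (fun x => complex.Re (f x))) (rint mu (fun x => complex.Im (f x))).

Definition ap (th la : R) : R := th * (Num.sqrt la + 1) ^+ 2.
Definition am (th la : R) : R := th * (Num.sqrt la - 1) ^+ 2.

Definition kMP (th la : R) (x : R) : R :=
  if (am th la < x) && (x < ap th la) then
    Num.sqrt ((ap th la - x) * (x - am th la)) / (2 * pi * th * x)
  else 0.

Definition atom0 (la : R) : R := Num.max 0 (1 - la).

Definition MP (th la : R) : set R -> \bar R :=
  fun B => ((atom0 la)%:E * \d_(0%R : R) B +
            \int[lebesgue_measure]_(x in B) (kMP th la x)%:E)%E.

Definition Gtr (mu : set R -> \bar R) (z : R[i]) : R[i] :=
  cint mu (fun x => (z - Complex x 0)^-1).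

Definition upper (z : R[i]) := 0 < complex.Im z.
Definition lower (z : R[i]) := complex.Im z < 0.

(* "R_mu = Rf": R_mu(w) = w F_mu^{<-1>}(1/w) - 1 with F_mu = 1/G_mu, i.e.
   F_mu^{<-1>}(1/w) = (1 + Rf w)/w.  We require this (the point
   (1+Rf w)/w lies in C^+ and is mapped by F_mu to 1/w, equivalently by
   G_mu to w) for all w in C^- in a neighbourhood of 0, where the inverse
   F_mu^{<-1>} is defined. *)
Definition is_Rtransform (mu : set R -> \bar R) (Rf : R[i] -> R[i]) : Prop :=
  exists2 eps : R, 0 < eps &
    forall w : R[i], lower w -> complex.Re w ^+ 2 + complex.Im w ^+ 2 < eps ^+ 2 ->
      upper ((1 + Rf w) / w) /\ Gtr mu ((1 + Rf w) / w) = w.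

Definition Rmu (t th la : R) (z : R[i]) : R[i] :=
  cint lebesgue_measure
    (fun x => ((1 - z * Complex x 0)^-1 - 1) * Complex (t * kMP th la x / x) 0).

Definition is_mu (t th la : R) (mu : probability R R) : Prop :=
  is_Rtransform mu (Rmu t th la).

Definition dil (c : R) (mu : set R -> \bar R) : set R -> \bar R :=
  fun B => mu ((fun x => x / c) @` B).

Definition minv (mu : set R -> \bar R) : set R -> \bar R :=
  fun B => mu ((fun x => x^-1) @` B).

Definition psi (mu : set R -> \bar R) (z : R) : R :=
  rint mu (fun x => z * x / (1 - z * x)).

(* s = S_mu(y): S_mu(y) = chi_mu(y) (1+y)/y where chi_mu is the inverse of
   psi_mu on the negative half-line (where psi_mu is injective) *)
Definition S_at (mu : set R -> \bar R) (y s : R) : Prop :=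
  exists z : R, z < 0 /\ psi mu z = y /\ s = z * (1 + y) / y.

(* rho = mu [x] nu (free multiplicative convolution of probability measures
   on [0,oo)), characterized by S_rho = S_mu * S_nu on an interval (a,0). *)
Definition is_boxtimes (mu nu : set R -> \bar R) (rho : probability R R) : Prop :=
  rho [set x : R | x < 0] = 0%E /\
  exists2 a : R, a < 0 &
    forall y : R, a < y < 0 ->
      exists s1 s2 s3 : R,
        [/\ S_at mu y s1, S_at nu y s2, S_at rho y s3 & s3 = s1 * s2].

Definition free_compound_poisson (mu : set R -> \bar R) : Prop :=
  exists r : R, 0 < r /\ exists nu : probability R R,
    is_Rtransform mu
      (fun z => Complex r 0 * cint nu (fun x => (1 - z * Complex x 0)^-1 - 1)).

End Defs.

(* Main.v *)
Require Import Defs.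
From HB Require Import structures.
From mathcomp Require Import all_boot all_order all_algebra.
From mathcomp Require Import all_classical all_reals all_analysis.
From mathcomp Require Import measurable_realfun complex ring lra.
Import Order.TTheory GRing.Theory Num.Theory.
Import numFieldNormedType.Exports.
Local Open Scope classical_set_scope.
Local Open Scope ring_scope.
Local Open Scope complex_scope.
Set Implicit Arguments.
Unset Strict Implicit.
Unset Printing Implicit Defensive.

                                                          
                                                                     
                                                                              
                                                      

                                                                              
                                                                                
                                                                           
                                                                               
                   
                                                                      
                                                                          
                                                                               
                                                                                 
                                                                                
                                                                               
                                                                              
                                                                     
                                                

(** The identities are equalities of S-transforms on an interval (a,0). There the S-transform of
    [MP th la] is 1/(th (la + y)) ([S_at_MP]), that of its image under inversion is th (la - 1 - y)
    ([S_at_minv_MP]), and that of mu_{t,th,la} is (t - th y)/(t (t + th (la-1) y)) ([S_at_is_mu]).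
    Since q + y = (t + th (la-1) y)/(th (la-1)) and a dilation by c divides S by c, multiplying out
    gives both factorisations. For la = 1 + t/th one has q = 1.

    The definition of mu_{t,th,la} prescribes only its R-transform, so the law is first made
    explicit. At w = Y/(th (la+Y)(1+Y)) the R-transform is t Y/(th (la+Y)) ([Rmu_param]), so the
    Cauchy transform takes the value w at zeta = (th la + (th+t) Y)(1+Y)/Y. The measure
    [beta_prime], a semicircle function divided by x (x+p) plus an atom at 0, has the same Cauchy
    transform at these points. For Y = - d i with small d > 0 they fill a segment of a vertical line
    in the upper half-plane, which forces equality of the measures ([is_mu_beta_prime]).

    All integrals come from one: the Cauchy transform of sqrt (r^2 - (x-m)^2) at z = m + (r/2)(v +
    1/v), |v| < 1, equals pi r v ([cint_semicircle]). It is computed from the generating function of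
    the Chebyshev polynomials and their orthogonality. Marchenko-Pastur densities reduce to it by x
    k(x) = const s(x), [beta_prime_density] by partial fractions.

    Uniqueness uses no analytic continuation. The resolvent identity turns agreement of Cauchy
    transforms at points accumulating at z0 into agreement of the integrals of all powers of 1/(z0 -
    x) ([resolvent_powers_eq]). Polynomials in these, and in their conjugates when z0 is not real,
    approximate indicators of half-lines, so the measures agree ([Gtr_determines],
    [psi_determines]).

    As [is_boxtimes] only constrains S-transforms near 0, each factorisation has two halves: the
    expected law satisfies it, and every law satisfying it is that one ([is_boxtimes_exists],
    [is_boxtimes_unique]). Finally, for la > 1 the support of [kMP] stays away from 0, so t k(x)/x
    has finite mass; normalising it gives the jump law of a free compound Poisson distribution. *)

Local Notation Re := (@complex.Re _).
Local Notation Im := (@complex.Im _).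
Local Notation normc := Normc.normc.

                                      

(** * Measures with a density, and Lebesgue measure on [R] *)

Section density.
Context d (T : measurableType d) (R : realType).
Variables (mu : {measure set T -> \bar R}) (k : T -> R).
Local Open Scope ereal_scope.

(** The proofs [k0] and [mk] are arguments so that the measure structure can be inferred from the
    term itself. *)
Definition density (k0 : forall x, (0 <= k x)%R)
  (mk : measurable_fun [set: T] k) (A : set T) : \bar R :=
  \int[mu]_(x in A) (k x)%:E.

Hypotheses (k0 : forall x, (0 <= k x)%R) (mk : measurable_fun [set: T] k).

Let density0 : density k0 mk set0 = 0.
Proof. by rewrite /density integral_set0. Qed.

Let density_ge0 A : 0 <= density k0 mk A.
Proof. by apply: integral_ge0 => x _; rewrite lee_fin. Qed.

Let density_sigma_additive : semi_sigma_additive (density k0 mk).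
Proof.
move=> /= F mF tF mUF; rewrite /density; apply: cvg_toP.
  apply: ereal_nondecreasing_is_cvgn => m n mn.
  by apply: lee_sum_nneg_natr => // i _ _; exact: density_ge0.
rewrite ge0_integral_bigcup//=.
- by apply/measurable_funTS/measurableT_comp.
- by move=> x _; rewrite lee_fin.
Qed.

HB.instance Definition _ := isMeasure.Build _ _ _
  (density k0 mk) density0 density_ge0 density_sigma_additive.

Import HBNNSimple.

(** Approximation of [f] from below by simple functions, with monotone convergence on both sides; on
    indicators the identity is the definition of [density]. *)
Lemma ge0_integral_density (f : T -> \bar R) : (forall x, 0 <= f x) ->
  measurable_fun [set: T] f ->
  \int[density k0 mk]_x f x = \int[mu]_x (f x * (k x)%:E).
Proof.
move=> f0 mf; pose h := nnsfun_approx measurableT mf.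
have hf x : EFin (h n x) @[n --> \oo] --> f x by exact: cvg_nnsfun_approx.
have ndh x : {homo (fun n => EFin (h n x)) : a b / (a <= b)%N >-> a <= b}.
  by move=> a b ab; rewrite lee_fin; exact/lefP/nd_nnsfun_approx.
have mEk : measurable_fun [set: T] (EFin \o k) by exact/measurable_EFinP.
have mh n : measurable_fun [set: T] (EFin \o h n).
  exact/measurable_EFinP/measurable_funP.
transitivity (limn (fun n => \int[density k0 mk]_x (h n x)%:E)).
  under eq_integral => x _ do rewrite -(cvg_lim (@ereal_hausdorff R) (hf x)).
  by apply: monotone_convergence => // n x _; rewrite lee_fin.
transitivity (limn (fun n => \int[mu]_x ((h n x)%:E * (k x)%:E))); last first.
  under [RHS]eq_integral => x _.
    rewrite -(cvg_lim (@ereal_hausdorff R) (cvgeZr _ (hf x)))//; over.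
  apply/esym/monotone_convergence => //.
  - by move=> n; apply: emeasurable_funM => //; exact: mh.
  - by move=> n x _; rewrite mule_ge0// lee_fin.
  - by move=> x _ a b ab; rewrite lee_wpmul2r// ?lee_fin//; exact: ndh.
congr (limn _); apply/funext => n.
rewrite integralT_nnsfun sintegralE.
under [RHS]eq_integral => x _.
  rewrite fimfunE -fsumEFin// ge0_mule_fsuml => [|y]; last exact: nnfun_muleindic_ge0.
  over.
rewrite ge0_integral_fsum//; last 2 first.
- move=> y; apply: emeasurable_funM => //.
  by apply/measurable_EFinP/measurable_funM.
- move=> y x _; apply: mule_ge0; rewrite ?lee_fin//; exact: nnfun_muleindic_ge0.
apply: eq_fsbigr => y /[!inE] -[x _ <-].
under eq_integral do rewrite EFinM -muleA.
rewrite ge0_integralZl//.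
- congr (_ * _); rewrite /= /density [LHS]integral_mkcond.
  by apply: eq_integral => z _; rewrite epatch_indic muleC.
- apply: emeasurable_funM => //.
  by apply/measurable_EFinP/measurable_indic; exact: measurable_sfunP.
- by move=> z _; rewrite mule_ge0// lee_fin.
- by rewrite lee_fin.
Qed.

Lemma integrable_density (f : T -> R) : measurable_fun [set: T] f ->
  mu.-integrable [set: T] (EFin \o (fun x => f x * k x)%R) ->
  (density k0 mk).-integrable [set: T] (EFin \o f).
Proof.
move=> mf /integrableP[_ fk]; apply/integrableP; split.
  exact/measurable_EFinP.
rewrite ge0_integral_density//; last first.
  by apply: measurableT_comp => //; exact/measurable_EFinP.
apply: le_lt_trans fk; rewrite le_eqVlt; apply/orP; left; apply/eqP.
by apply: eq_integral => x _; rewrite /= normrM EFinM (ger0_norm (k0 x)).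
Qed.

Lemma integral_density (f : T -> R) : measurable_fun [set: T] f ->
  mu.-integrable [set: T] (EFin \o (fun x => f x * k x)%R) ->
  \int[density k0 mk]_x (f x)%:E = \int[mu]_x (f x * k x)%:E.
Proof.
move=> mf ifk; rewrite [LHS]integralE [RHS]integralE.
have mEf : measurable_fun [set: T] (EFin \o f) by exact/measurable_EFinP.
rewrite !ge0_integral_density//; last 2 first.
- exact: measurable_funeneg.
- exact: measurable_funepos.
congr (_ - _); apply: eq_integral => x _.
- rewrite /= !funeposE -!EFin_max -EFinM maxr_pMl// mul0r//.
- rewrite /= !funenegE -!EFinN -!EFin_max -EFinM maxr_pMl// mul0r// mulNr//.
Qed.

End density.

Section lebesgue_on_R.
Context (R : realType).
Local Open Scope ereal_scope.

                                                                      
                                                          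
(** [lebesgue_measure] is a measure on [measurableTypeR R]; [leb] is the same set function declared
    as a measure on [R], so that it can be combined with the other measures on [R]. *)
Definition leb (A : set R) : \bar R := @lebesgue_measure R A.

HB.instance Definition _ := isMeasure.Build _ R R leb
  (@measure0 _ _ _ (@lebesgue_measure R))
  (@measure_ge0 _ _ _ (@lebesgue_measure R))
  (@measure_semi_sigma_additive _ _ _ (@lebesgue_measure R)).

Let ge0_integral_lebE (D : set R) (f : R -> \bar R) : measurable D ->
  measurable_fun D f -> (forall x, D x -> 0 <= f x) ->
  \int[leb]_(x in D) f x = \int[@lebesgue_measure R]_(x in D) f x.
Proof.
move=> mD mf f0.
have mid : measurable_fun setT (id : measurableTypeR R -> R) by [].
have := @ge0_integral_pushforward _ _ (measurableTypeR R) R R id mid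
  (@lebesgue_measure R) D f mD mf _.
move=> <-; first exact: eq_measure_integral.
by move=> x /set_mem; exact: f0.
Qed.

Lemma integral_lebE (D : set R) (f : R -> \bar R) : measurable D ->
  measurable_fun D f ->
  \int[leb]_(x in D) f x = \int[@lebesgue_measure R]_(x in D) f x.
Proof.
move=> mD mf; rewrite [LHS]integralE [RHS]integralE !ge0_integral_lebE//.
- exact: measurable_funeneg.
- exact: measurable_funepos.
Qed.

End lebesgue_on_R.

                                 

(** * Measurability and integration of complex-valued functions *)

Section measurability.
Context d (T : measurableType d) (R : realType).
Implicit Types (f g : T -> R[i]) (h : T -> R).

Lemma measurable_funV h : measurable_fun [set: T] h ->
  measurable_fun [set: T] (fun x => (h x)^-1).
Proof.
move=> mh; rewrite (_ : (fun _ => _) = (fun x => h x * ((h x ^+ 2) `^ (-1)))).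
  apply: measurable_funM => //; apply: (measurableT_comp (measurable_powR _)).
  exact: measurable_funX.
apply/funext => x; have [->|h0] := eqVneq (h x) 0; first by rewrite invr0 mul0r.
by rewrite powR_inv1 ?sqr_ge0// expr2 invfM mulrA divff// mul1r.
Qed.

Definition cmeasurable f :=
  measurable_fun [set: T] (Re \o f) /\ measurable_fun [set: T] (Im \o f).

Lemma cmeasurable_real h : measurable_fun [set: T] h ->
  cmeasurable (fun x => (h x)%:C).
Proof. by move=> mh; split => //=; exact: measurable_cst. Qed.

Lemma cmeasurable_cst (c : R[i]) : cmeasurable (fun=> c).
Proof. by split; exact: measurable_cst. Qed.

Lemma ReD (x y : R[i]) : Re (x + y) = Re x + Re y.
Proof. by case: x y => [a b] [c e]. Qed.
Lemma ImD (x y : R[i]) : Im (x + y) = Im x + Im y.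
Proof. by case: x y => [a b] [c e]. Qed.
Lemma ImN (x : R[i]) : Im (- x) = - Im x. Proof. by case: x. Qed.
Lemma ReM (x y : R[i]) : Re (x * y) = Re x * Re y - Im x * Im y.
Proof. by case: x y => [a b] [c e]. Qed.
Lemma ImM (x y : R[i]) : Im (x * y) = Re x * Im y + Im x * Re y.
Proof. by case: x y => [a b] [c e]. Qed.
Lemma ReV (x : R[i]) : Re x^-1 = Re x / (Re x ^+ 2 + Im x ^+ 2).
Proof. by case: x. Qed.
Lemma ImV (x : R[i]) : Im x^-1 = - Im x / (Re x ^+ 2 + Im x ^+ 2).
Proof. by case: x => a b /=; rewrite mulNr. Qed.
Lemma complex_eqP (x y : R[i]) : Re x = Re y -> Im x = Im y -> x = y.
Proof. by case: x y => [a b] [c e] /= -> ->. Qed.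

Lemma cmeasurableD f g : cmeasurable f -> cmeasurable g ->
  cmeasurable (fun x => f x + g x).
Proof.
move=> [mf1 mf2] [mg1 mg2]; split.
  rewrite (_ : _ \o _ = (Re \o f) \+ (Re \o g)); first exact: measurable_funD.
  by apply/funext => x /=; rewrite ReD.
rewrite (_ : _ \o _ = (Im \o f) \+ (Im \o g)); first exact: measurable_funD.
by apply/funext => x /=; rewrite ImD.
Qed.

Lemma cmeasurableM f g : cmeasurable f -> cmeasurable g ->
  cmeasurable (fun x => f x * g x).
Proof.
move=> [mf1 mf2] [mg1 mg2]; split.
  rewrite (_ : _ \o _ = ((Re \o f) \* (Re \o g)) \- ((Im \o f) \* (Im \o g))).
    by apply: measurable_funB; exact: measurable_funM.
  by apply/funext => x /=; rewrite ReM.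
rewrite (_ : _ \o _ = ((Re \o f) \* (Im \o g)) \+ ((Im \o f) \* (Re \o g))).
  by apply: measurable_funD; exact: measurable_funM.
by apply/funext => x /=; rewrite ImM.
Qed.

Lemma cmeasurableB f g : cmeasurable f -> cmeasurable g ->
  cmeasurable (fun x => f x - g x).
Proof.
move=> mf mg; under eq_fun do rewrite -[- g _]mulN1r.
by apply: cmeasurableD => //; apply: cmeasurableM => //; exact: cmeasurable_cst.
Qed.

Lemma cmeasurableX f n : cmeasurable f -> cmeasurable (fun x => f x ^+ n).
Proof.
move=> mf; elim: n => [|n IH]; first exact: cmeasurable_cst.
by under eq_fun do rewrite exprS; exact: cmeasurableM.
Qed.

Lemma cmeasurableV f : cmeasurable f -> cmeasurable (fun x => (f x)^-1).
Proof.
move=> [mf1 mf2].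
have mn : measurable_fun [set: T] (fun x => (Re (f x) ^+ 2 + Im (f x) ^+ 2)^-1).
  by apply/measurable_funV/measurable_funD; exact: measurable_funX.
split.
  rewrite (_ : _ \o _ = (Re \o f) \* (fun x => (Re (f x) ^+ 2 + Im (f x) ^+ 2)^-1)).
    exact: measurable_funM.
  by apply/funext => x /=; rewrite ReV.
rewrite (_ : _ \o _ = (\- (Im \o f)) \* (fun x => (Re (f x) ^+ 2 + Im (f x) ^+ 2)^-1)).
  by apply: measurable_funM => //; exact: measurable_funN.
by apply/funext => x /=; rewrite ImV.
Qed.

Lemma Re_le_normc (z : R[i]) : `|Re z| <= normc z.
Proof. by case: z => a b /=; rewrite -sqrtr_sqr ler_wsqrtr// lerDl sqr_ge0. Qed.

Lemma Im_le_normc (z : R[i]) : `|Im z| <= normc z.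
Proof. by case: z => a b /=; rewrite -sqrtr_sqr ler_wsqrtr// lerDr sqr_ge0. Qed.


Lemma normc_real (x : R) : normc x%:C = `|x|.
Proof. by rewrite /= expr0n addr0 sqrtr_sqr. Qed.

Lemma normc_ge0 (x : R[i]) : 0 <= normc x.
Proof. by case: x => a b; exact: sqrtr_ge0. Qed.

Lemma normcX (x : R[i]) n : normc (x ^+ n) = normc x ^+ n.
Proof. by elim: n => [|n IH]; rewrite ?Normc.normc1// !exprS Normc.normcM IH. Qed.

Lemma normcB (x y : R[i]) : normc (x - y) <= normc x + normc y.
Proof. by rewrite -(normcN y); exact: le_normcD. Qed.

Lemma normc_gt0 (x : R[i]) : (0 < normc x) = (x != 0).
Proof.
rewrite lt0r normc_ge0 andbT; congr (~~ _).
by apply/eqP/eqP => [/Normc.eq0_normc//|->]; exact: Normc.normc0.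
Qed.

End measurability.

Section cint_theory.
Context (R : realType).
Variable mu : {measure set R -> \bar R}.
Implicit Types (f g : R -> R[i]) (h : R -> R).

Definition rintegrable h := mu.-integrable [set: R] (EFin \o h).
Definition cintegrable f := rintegrable (Re \o f) /\ rintegrable (Im \o f).

Lemma rintD h1 h2 : rintegrable h1 -> rintegrable h2 ->
  rint mu (fun x => h1 x + h2 x) = rint mu h1 + rint mu h2.
Proof. by move=> i1 i2; exact: RintegralD. Qed.

Lemma rintB h1 h2 : rintegrable h1 -> rintegrable h2 ->
  rint mu (fun x => h1 x - h2 x) = rint mu h1 - rint mu h2.
Proof. by move=> i1 i2; exact: RintegralB. Qed.

Lemma rintZ c h : rintegrable h -> rint mu (fun x => c * h x) = c * rint mu h.
Proof. by move=> ih; exact: RintegralZl. Qed.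

Lemma rintegrableD h1 h2 : rintegrable h1 -> rintegrable h2 ->
  rintegrable (fun x => h1 x + h2 x).
Proof. by move=> i1 i2; exact: (integrableD measurableT i1 i2). Qed.

Lemma rintegrableB h1 h2 : rintegrable h1 -> rintegrable h2 ->
  rintegrable (fun x => h1 x - h2 x).
Proof. by move=> i1 i2; exact: (integrableB measurableT i1 i2). Qed.

Lemma rintegrableZ c h : rintegrable h -> rintegrable (fun x => c * h x).
Proof. by move=> ih; exact: (integrableZl measurableT c ih). Qed.

Lemma cintegrable_real h : rintegrable h -> cintegrable (fun x => (h x)%:C).
Proof. by move=> ih; split => //; exact: integrable0. Qed.

Lemma cintegrableD f g : cintegrable f -> cintegrable g ->
  cintegrable (fun x => f x + g x).
Proof.
move=> [f1 f2] [g1 g2]; split.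
  rewrite (_ : _ \o _ = (fun x => Re (f x) + Re (g x))); first exact: rintegrableD.
  by apply/funext => x /=; rewrite ReD.
rewrite (_ : _ \o _ = (fun x => Im (f x) + Im (g x))); first exact: rintegrableD.
by apply/funext => x /=; rewrite ImD.
Qed.

Lemma cintegrableZ c f : cintegrable f -> cintegrable (fun x => c * f x).
Proof.
move=> [f1 f2]; split.
  rewrite (_ : _ \o _ = (fun x => Re c * Re (f x) - Im c * Im (f x))).
    by apply: rintegrableB; exact: rintegrableZ.
  by apply/funext => x /=; rewrite ReM.
rewrite (_ : _ \o _ = (fun x => Re c * Im (f x) + Im c * Re (f x))).
  by apply: rintegrableD; exact: rintegrableZ.
by apply/funext => x /=; rewrite ImM.
Qed.

Lemma cintegrableB f g : cintegrable f -> cintegrable g ->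
  cintegrable (fun x => f x - g x).
Proof.
move=> fi gi; under eq_fun do rewrite -[- g _]mulN1r.
by apply: cintegrableD => //; exact: cintegrableZ.
Qed.

Lemma cintD f g : cintegrable f -> cintegrable g ->
  cint mu (fun x => f x + g x) = cint mu f + cint mu g.
Proof.
move=> [f1 f2] [g1 g2]; apply: complex_eqP; rewrite ?ReD ?ImD /=.
  by rewrite -rintD//; congr rint; apply/funext => x /=; rewrite ReD.
by rewrite -rintD//; congr rint; apply/funext => x /=; rewrite ImD.
Qed.

Lemma cintZ c f : cintegrable f -> cint mu (fun x => c * f x) = c * cint mu f.
Proof.
move=> [f1 f2]; apply: complex_eqP; rewrite ?ReM ?ImM /=.
  rewrite -!rintZ// -rintB; last 2 first.
  - exact: rintegrableZ.
  - exact: rintegrableZ.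
  by congr rint; apply/funext => x /=; rewrite ReM.
rewrite -!rintZ// -rintD; last 2 first.
- exact: rintegrableZ.
- exact: rintegrableZ.
by congr rint; apply/funext => x /=; rewrite ImM.
Qed.

Lemma cintB f g : cintegrable f -> cintegrable g ->
  cint mu (fun x => f x - g x) = cint mu f - cint mu g.
Proof.
move=> fi gi; rewrite -[- cint mu g]mulN1r -cintZ// -cintD//; last exact: cintegrableZ.
by congr cint; apply/funext => x; rewrite mulN1r.
Qed.

Lemma cint_real h : cint mu (fun x => (h x)%:C) = (rint mu h)%:C.
Proof.
apply: complex_eqP => //=; rewrite /rint [X in fine X](_ : _ = 0)%E//.
by apply: integral0_eq.
Qed.

Lemma rint_le h1 h2 : rintegrable h1 -> rintegrable h2 ->
  (forall x, h1 x <= h2 x) -> rint mu h1 <= rint mu h2.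
Proof. by move=> i1 i2 h12; apply: le_Rintegral. Qed.

Lemma rint_abs_le h b : rintegrable h -> rintegrable b ->
  (forall x, `|h x| <= b x) -> `|rint mu h| <= rint mu b.
Proof.
move=> ih ib hb; apply: le_trans (le_normr_Rintegral measurableT ih) _.
by apply: rint_le => //; exact: integrable_norm.
Qed.

Lemma rintegrable_dom h b : measurable_fun [set: R] h -> rintegrable b ->
  (forall x, `|h x| <= b x) -> rintegrable h.
Proof.
move=> mh ib hb; apply: le_integrable ib => //; first exact/measurable_EFinP.
move=> x _ /=; rewrite lee_fin (le_trans (hb x))// ler_norm//.
Qed.

Lemma cintegrable_dom f b : cmeasurable f -> rintegrable b ->
  (forall x, normc (f x) <= b x) -> cintegrable f.
Proof.
move=> [m1 m2] ib fb; split; apply: (@rintegrable_dom _ b) => // x /=.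
  exact: le_trans (Re_le_normc _) _.
exact: le_trans (Im_le_normc _) _.
Qed.

Lemma normc_cint_le f b : cintegrable f -> rintegrable b ->
  (forall x, normc (f x) <= b x) -> normc (cint mu f) <= 2 * rint mu b.
Proof.
move=> [f1 f2] ib fb.
have B1 : `|rint mu (Re \o f)| <= rint mu b.
  by apply: rint_abs_le => // x; exact: le_trans (Re_le_normc _) _.
have B2 : `|rint mu (Im \o f)| <= rint mu b.
  by apply: rint_abs_le => // x; exact: le_trans (Im_le_normc _) _.
have -> : cint mu f = (rint mu (Re \o f))%:C + 'i * (rint mu (Im \o f))%:C.
  by rewrite [LHS]complexE.
apply: le_trans (le_normcD _ _) _.
rewrite Normc.normcM !normc_real /= expr0n add0r expr1n sqrtr1 mul1r.
by rewrite mulr_natl mulr2n lerD.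
Qed.

Hypothesis mu1 : (mu [set: R] = 1)%E.

Lemma rintegrable_cst c : rintegrable (fun=> c).
Proof.
apply: measurable_bounded_integrable => //; first by rewrite mu1 ltry.
exact: bounded_cst.
Qed.

Lemma rint_cst c : rint mu (fun=> c) = c.
Proof. by rewrite /rint integral_cst// mu1 mule1. Qed.

Lemma cint_cst c : cint mu (fun=> c) = c.
Proof. by apply: complex_eqP => /=; rewrite rint_cst. Qed.

Lemma cintegrable_bounded f (M : R) : cmeasurable f ->
  (forall x, normc (f x) <= M) -> cintegrable f.
Proof. by move=> mf fM; apply: cintegrable_dom fM => //; exact: rintegrable_cst. Qed.

Lemma normc_cint_bounded f (M : R) : cmeasurable f ->
  (forall x, normc (f x) <= M) -> normc (cint mu f) <= 2 * M.
Proof.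
move=> mf fM; rewrite -(rint_cst M); apply: normc_cint_le => //.
  exact: cintegrable_bounded fM.
exact: rintegrable_cst.
Qed.

End cint_theory.

Section cint_density.
Context (R : realType).
Variables (k : R -> R) (k0 : forall x, 0 <= k x) (mk : measurable_fun [set: R] k).
Implicit Types (h : R -> R) (f : R -> R[i]).
Local Notation leb := (@leb R).

Lemma rint_density h : measurable_fun [set: R] h ->
  rintegrable leb (fun x => h x * k x) ->
  rint (density leb k0 mk) h = rint leb (fun x => h x * k x).
Proof. by move=> mh ih; rewrite /rint integral_density. Qed.

Lemma rintegrable_density h : measurable_fun [set: R] h ->
  rintegrable leb (fun x => h x * k x) -> rintegrable (density leb k0 mk) h.
Proof. by move=> mh ih; exact: integrable_density. Qed.

Let mulR (f : R -> R[i]) x : Re (f x * (k x)%:C) = Re (f x) * k x.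
Proof. by rewrite ReM /= mulr0 subr0. Qed.

Let mulI (f : R -> R[i]) x : Im (f x * (k x)%:C) = Im (f x) * k x.
Proof. by rewrite ImM /= mulr0 add0r. Qed.

Lemma cint_density f : cmeasurable f ->
  cintegrable leb (fun x => f x * (k x)%:C) ->
  cint (density leb k0 mk) f = cint leb (fun x => f x * (k x)%:C).
Proof.
move=> [m1 m2] [i1 i2]; rewrite /cint !rint_density//.
- by congr (Complex (rint _ _) (rint _ _)); apply/funext => x; rewrite /= ?mulR ?mulI.
- by move: i2; congr (rintegrable leb _); apply/funext => x; rewrite /= mulI.
- by move: i1; congr (rintegrable leb _); apply/funext => x; rewrite /= mulR.
Qed.

End cint_density.

                                                                

(** * Polynomial approximation of indicators; determination by moments *)

Section threshold.
Context (R : realType).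
Implicit Types (s u q : R).

Lemma bernoulli_le u n : 0 <= u -> 1 + n%:R * u <= (1 + u) ^+ n.
Proof.
move=> u0; elim: n => [|n IH]; first by rewrite mul0r addr0 expr0.
rewrite exprS; apply: (@le_trans _ _ ((1 + u) * (1 + n%:R * u))).
  have : 0 <= n%:R * u * u by rewrite !mulr_ge0.
  by rewrite -natr1; lra.
by rewrite ler_wpM2l// addr_ge0.
Qed.

Lemma bernoulli_ge u n : 0 <= u <= 1 -> 1 - n%:R * u <= (1 - u) ^+ n.
Proof.
move=> /andP[u0 u1]; elim: n => [|n IH]; first by rewrite mul0r subr0 expr0.
rewrite exprS; apply: (@le_trans _ _ ((1 - u) * (1 - n%:R * u))).
  have : 0 <= n%:R * u * u by rewrite !mulr_ge0.
  by rewrite -natr1; lra.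
by rewrite ler_wpM2l// subr_ge0.
Qed.

(** With q = r^2, the product n r^n is bounded by Bernoulli's inequality, and the remaining factor
    r^n tends to 0. *)
Lemma cvg_nat_mul_expr q : 0 <= q < 1 -> n%:R * q ^+ n @[n --> \oo] --> (0 : R).
Proof.
move=> /andP[q0 q1].
have [->|qn0] := eqVneq q 0.
  apply: cvg_near_cst; near=> n; rewrite expr0n gtn_eqF ?mulr0//.
  by near: n; exists 1%N.
have qp : 0 < q by rewrite lt0r qn0.
pose r := Num.sqrt q.
have r0 : 0 < r by rewrite sqrtr_gt0.
have r1 : r < 1 by rewrite -sqrtr1 ltr_sqrt.
pose h := r^-1 - 1.
have h0 : 0 < h by rewrite subr_gt0 invf_gt1.
have nr n : n%:R * r ^+ n <= h^-1.
  rewrite -ler_pdivlMr ?exprn_gt0// -exprVn -ler_pdivrMl ?invr_gt0// invrK.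
  rewrite (_ : r^-1 = 1 + h); last by rewrite /h; ring.
  by apply: le_trans (bernoulli_le n (ltW h0)); rewrite mulrC lerDr.
apply: (@squeeze_cvgr _ _ _ _ (fun=> 0) (fun n => h^-1 * r ^+ n)).
- near=> n; rewrite mulr_ge0 ?exprn_ge0//=.
  rewrite -{1}(sqr_sqrtr q0) -/r expr2 exprMn mulrA ler_wpM2r//.
  by rewrite exprn_ge0// ltW.
- exact: cvg_cst.
- rewrite -(mulr0 h^-1); apply: cvgMr; apply: cvg_expr.
  by rewrite ger0_norm// ltW.
Unshelve. all: by end_near. Qed.

(** A polynomial in u that converges on [0,1] to the indicator of u < s. The exponent N is about
    (n+1) s^-(n+1), so N u^(n+1) is about (n+1) (u/s)^(n+1), which tends to 0 for u < s and is at
    least n+1 for u >= s. *)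
Definition threshold s n u : R :=
  (1 - u ^+ n.+1) ^+ (n.+1 * (Num.truncn (s^-1 ^+ n.+1)).+1).

Lemma threshold_itv s n u : 0 <= u <= 1 -> 0 <= threshold s n u <= 1.
Proof.
move=> /andP[u0 u1]; have v0 : 0 <= u ^+ n.+1 by rewrite exprn_ge0.
have v1 : u ^+ n.+1 <= 1 by rewrite exprn_ile1.
by rewrite exprn_ge0 ?subr_ge0//= exprn_ile1 ?subr_ge0// gerBl.
Qed.

(** Bernoulli gives the lower bound 1 - N u^(n+1). The factor 2 absorbs the rounding of the
    exponent: the integer part of x plus 1 is at most 2 x for x >= 1. *)
Lemma threshold_lt s u : 0 < s <= 1 -> 0 <= u < s ->
  threshold s n u @[n --> \oo] --> (1 : R).
Proof.
move=> /andP[s0 s1] /andP[u0 us]; have u1 : u <= 1 by rewrite (le_trans (ltW us)).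
pose q := u / s.
have q01 : 0 <= q < 1 by rewrite divr_ge0 ?(ltW s0)//= ltr_pdivrMr// mul1r.
apply: (@squeeze_cvgr _ _ _ _ (fun n => 1 - 2 * (n.+1%:R * q ^+ n.+1)) (fun=> 1)).
- near=> n; have /andP[_ ->] := @threshold_itv s n u (introT andP (conj u0 u1)).
  rewrite andbT; apply: le_trans (bernoulli_ge _ _); last first.
    by rewrite exprn_ge0//= exprn_ile1.
  rewrite lerD2l lerN2 natrM -mulrA [leRHS]mulrCA ler_wpM2l//.
  rewrite /q expr_div_n mulrA [leRHS]mulrAC ler_wpM2r ?exprn_ge0//.
  have sn1 : 1 <= s^-1 ^+ n.+1 by rewrite exprn_ege1// invf_ge1.
  rewrite -exprVn -natr1 mulr_natl mulr2n lerD// truncn_le.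
  exact: le_trans sn1.
- rewrite -[X in _ --> X]subr0 -[X in 1 - X](mulr0 2).
  apply: cvgB; first exact: cvg_cst.
  apply: cvgMr; have := cvg_nat_mul_expr q01.
  by rewrite -(cvg_shiftS (fun n => n%:R * q ^+ n)).
- exact: cvg_cst.
Unshelve. all: by end_near. Qed.

(** With v = u^(n+1) and exponent K one has (1-v)^K (1+v)^K <= 1, hence (1-v)^K <= 1/(1 + K v) <=
    1/(n+1). The case u = s is included, so the limit is the indicator of a strict inequality. *)
Lemma threshold_ge s u : 0 < s <= 1 -> s <= u <= 1 ->
  threshold s n u @[n --> \oo] --> (0 : R).
Proof.
move=> /andP[s0 s1] /andP[su u1]; have u0 : 0 < u by exact: lt_le_trans su.
apply: (@squeeze_cvgr _ _ _ _ (fun=> 0) (@harmonic R)).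
- near=> n; have /andP[-> _] := @threshold_itv s n u (introT andP (conj (ltW u0) u1)).
  rewrite /= /threshold; set v := u ^+ n.+1; set K := (_ * _)%N.
  have v0 : 0 < v by rewrite exprn_gt0.
  have v1 : v <= 1 by rewrite exprn_ile1// ltW.
  have nKv : n.+1%:R <= K%:R * v.
    rewrite natrM -mulrA ler_peMr// -(@ler_pdivrMr _ v)// mul1r.
    rewrite /v -exprVn (le_trans (y := s^-1 ^+ n.+1))//.
      by rewrite lerXn2r ?nnegrE ?invr_ge0 ?(ltW s0) ?(ltW u0)// lef_pV2.
    have sn0 : 0 <= s^-1 ^+ n.+1 by rewrite exprn_ge0// invr_ge0 ltW.
    by apply/ltW; have /andP[] := truncn_itv sn0.
  have Kp : 0 < (1 + v) ^+ K by rewrite exprn_gt0// addr_gt0.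
  have : (1 - v) ^+ K * (1 + v) ^+ K <= 1.
    rewrite -exprMn exprn_ile1//; first by nra.
    by nra.
  rewrite -ler_pdivlMr// mul1r => /le_trans; apply.
  rewrite /harmonic lef_pV2 ?posrE//.
  apply: le_trans nKv _; apply: le_trans (bernoulli_le _ (ltW v0)).
  by rewrite lerDr.
- exact: cvg_cst.
- exact: cvg_harmonic.
Unshelve. all: by end_near. Qed.

End threshold.

Section moments_determine.
Context (R : realType).
Variables (mu nu : {measure set R -> \bar R}) (g : R -> R).
Hypotheses (mu1 : mu [set: R] = 1%E) (nu1 : nu [set: R] = 1%E).
Hypotheses (mg : measurable_fun [set: R] g) (g01 : forall x, 0 <= g x <= 1).
Hypothesis gE : forall n, rint mu (fun x => g x ^+ n) = rint nu (fun x => g x ^+ n).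

Let poly01 n K j x : 0 <= (1 - g x ^+ n) ^+ K * g x ^+ j <= 1.
Proof.
have /andP[g0 g1] := g01 x.
have a0 : 0 <= g x ^+ n <= 1 by rewrite exprn_ge0//= exprn_ile1.
have b0 : 0 <= g x ^+ j <= 1 by rewrite exprn_ge0//= exprn_ile1.
have c0 : 0 <= (1 - g x ^+ n) ^+ K <= 1.
  by case/andP: a0 => ? ?; rewrite exprn_ge0 ?subr_ge0//= exprn_ile1 ?subr_ge0// gerBl.
case/andP: b0 c0 => ? ? /andP[? ?]; rewrite mulr_ge0//=.
by rewrite -[leRHS]mulr1 ler_pM.
Qed.

Let mpoly n K j : measurable_fun [set: R] (fun x => (1 - g x ^+ n) ^+ K * g x ^+ j).
Proof.
apply: measurable_funM; apply: measurable_funX => //.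
by apply: measurable_funB => //; exact: measurable_funX.
Qed.

Let ipoly (m : {measure set R -> \bar R}) n K j : m [set: R] = 1%E ->
  rintegrable m (fun x => (1 - g x ^+ n) ^+ K * g x ^+ j).
Proof.
move=> m1; apply: (rintegrable_dom (b := fun=> 1)) => //.
  exact: rintegrable_cst.
by move=> x; have /andP[? ?] := poly01 n K j x; rewrite ger0_norm.
Qed.

Let rint_poly n K j : rint mu (fun x => (1 - g x ^+ n) ^+ K * g x ^+ j) =
  rint nu (fun x => (1 - g x ^+ n) ^+ K * g x ^+ j).
Proof.
elim: K j => [|K IH] j.
  by under eq_fun do rewrite expr0 mul1r; rewrite gE; congr rint;
     apply/funext => x; rewrite expr0 mul1r.
have E x : (1 - g x ^+ n) ^+ K.+1 * g x ^+ j =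
    (1 - g x ^+ n) ^+ K * g x ^+ j - (1 - g x ^+ n) ^+ K * g x ^+ (n + j).
  by rewrite exprS exprD; ring.
under eq_fun do rewrite E.
rewrite rintB ?IH; [|exact: ipoly..].
rewrite -rintB; [|exact: ipoly..].
by congr rint; apply/funext => x; rewrite E.
Qed.

Let cvg_poly (m : {measure set R -> \bar R}) (s : R) : m [set: R] = 1%E ->
  0 < s <= 1 ->
  (\int[m]_x (threshold s n (g x))%:E)%E @[n --> \oo] --> m [set x | g x < s].
Proof.
move=> m1 s01.
have ms : measurable [set x | g x < s].
  rewrite -[X in measurable X]setTI.
  by apply: (measurable_fun_ltr mg (measurable_cst s) measurableT (Y := [set true])).
rewrite -[X in _ --> m X]setIT -integral_indic//.
apply: (@dominated_cvg _ _ _ m setT measurableT _ _ (cst 1%E)) => //.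
- move=> n; apply/measurable_EFinP.
  have := @mpoly n.+1 (n.+1 * (Num.truncn (s^-1 ^+ n.+1)).+1) 0.
  by congr measurable_fun; apply/funext => x; rewrite expr0 mulr1.
- move=> x _; rewrite indicE; apply: cvg_EFin; first exact: nearW.
  have /andP[g0 g1] := g01 x.
  have [gs|gs] := ltP (g x) s.
    by rewrite mem_set//; apply: threshold_lt => //; rewrite g0 gs.
  rewrite memNset/=; last by apply/negP; rewrite -leNgt.
  by apply: threshold_ge => //; rewrite gs.
- exact: rintegrable_cst.
- by move=> n x _; have /andP[t0 t1] := threshold_itv s n (g01 x);
     rewrite lee_fin ger0_norm.
Qed.

(** Equal moments of [g] give equal integrals of the polynomials [threshold s n] in [g], and by
    dominated convergence these tend to the measures of the sublevel set. *)
Lemma measure_sublevel_eq (s : R) : 0 < s <= 1 ->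
  mu [set x | g x < s] = nu [set x | g x < s].
Proof.
move=> s01; have mc := cvg_poly mu1 s01; have nc := cvg_poly nu1 s01.
rewrite -(cvg_lim (@ereal_hausdorff R) mc) -(cvg_lim (@ereal_hausdorff R) nc).
congr (limn _); apply/funext => n; set K := (n.+1 * (Num.truncn (s^-1 ^+ n.+1)).+1)%N.
have TE : (fun x => threshold s n (g x)) = (fun x => (1 - g x ^+ n.+1) ^+ K * g x ^+ 0).
  by apply/funext => x; rewrite expr0 mulr1.
have := rint_poly n.+1 K 0; rewrite -TE /rint => E.
have fin (m : {measure set R -> \bar R}) : m [set: R] = 1%E ->
    (\int[m]_x (threshold s n (g x))%:E)%E \is a fin_num.
  move=> m1; apply: integrable_fin_num => //.
  by have := ipoly n.+1 K 0 m1; rewrite -TE.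
by rewrite -(fineK (fin _ mu1)) -(fineK (fin _ nu1)) E.
Qed.

End moments_determine.

(** * Resolvents determine measures *)

Section determination.
Context (R : realType).
Variables (mu nu : {measure set R -> \bar R}).
Hypotheses (mu1 : mu [set: R] = 1%E) (nu1 : nu [set: R] = 1%E).

Lemma measure_rays_eq : (forall x, mu `]x, +oo[%classic = nu `]x, +oo[%classic) ->
  forall B, measurable B -> mu B = nu B.
Proof.
move=> H B mB.
apply: (@measure_unique _ R R (@RGenOInfty.G R)
  (fun k => `](- k%:R), +oo[%classic)) => //.
- exact: RGenOInfty.measurableE.
- move=> A C [x ->] [y ->]; exists (Num.max x y).
  rewrite -itv_setI//=; congr [set` _].
  by rewrite /Order.meet/= /Order.meet/= /Order.join/=; case: ltgtP.
- by move=> k; exists (- k%:R).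
- apply/seteqP; split => // x _; exists (Num.truncn `|x|).+1 => //=.
  rewrite in_itv/= andbT ltrNl; apply: le_lt_trans (ler_norm _) _.
  by rewrite normrN; have /andP[] := truncn_itv (normr_ge0 x).
- by move=> A [x ->]; exact: H.
- move=> k; apply: (@le_lt_trans _ _ (mu [set: R])); last by rewrite mu1 ltry.
  by apply: le_measure; rewrite ?inE.
Qed.

Local Notation "f =E g" := (cint mu f = cint nu g) (at level 70).

Section resolvent_powers.
Variables (xi : R -> R) (Z : set R[i]) (z0 : R[i]) (K : R).
Hypotheses (mxi : measurable_fun [set: R] xi) (K0 : 0 <= K).
Let c z x : R[i] := (z - (xi x)%:C)^-1.
Hypothesis Zxi : forall z x, Z z -> z != (xi x)%:C.
Hypothesis cK : forall z x, Z z -> normc (c z x) <= K.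
Hypothesis Zz0 : Z z0.
Hypothesis Zacc : forall e, 0 < e -> exists z, [/\ Z z, z != z0 & normc (z - z0) < e].
Hypothesis cE : forall z, Z z -> cint mu (c z) = cint nu (c z).

Let mc z : cmeasurable (c z).
Proof.
apply/cmeasurableV/cmeasurableB; first exact: cmeasurable_cst.
exact: cmeasurable_real.
Qed.

Let resolvent z x : Z z -> z != z0 ->
  c z0 x * c z x = (z - z0)^-1 * (c z0 x - c z x).
Proof.
move=> Zz zz0; have h1 := Zxi x Zz; have h2 := Zxi x Zz0.
by rewrite /c; field; rewrite !subr_eq0 h1 h2 zz0.
Qed.

Let mck k z : cmeasurable (fun x => c z0 x ^+ k * c z x).
Proof. by apply: cmeasurableM => //; exact: cmeasurableX. Qed.

Let bck k z x : Z z -> normc (c z0 x ^+ k * c z x) <= K ^+ k.+1.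
Proof.
move=> Zz; rewrite Normc.normcM normcX exprSr.
by apply: ler_pM; rewrite ?exprn_ge0 ?normc_ge0//;
  [rewrite lerXn2r ?nnegrE ?normc_ge0//; exact: cK|exact: cK].
Qed.

Let ick (m : {measure set R -> \bar R}) k z : m [set: R] = 1%E -> Z z ->
  cintegrable m (fun x => c z0 x ^+ k * c z x).
Proof. by move=> m1 Zz; apply: (cintegrable_bounded m1 (mck k z)) => x; exact: bck. Qed.

Let power_step k z : Z z -> z != z0 ->
  (fun x => c z0 x ^+ k.+1 * c z x) =
  (fun x => (z - z0)^-1 * (c z0 x ^+ k * c z0 x - c z0 x ^+ k * c z x)).
Proof.
move=> Zz zz0; apply/funext => x.
by rewrite exprSr -mulrA resolvent// -mulrBr mulrCA.
Qed.

                                                                              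
                                                                             
                    
(** This replaces analytic continuation. For z <> z0 the resolvent identity expresses c_{z0}^(k+1)
    c_z through c_{z0}^(k+1) and c_{z0}^k c_z; the case z = z0 follows by letting z tend to z0
    inside [Z]. The function [xi] will be the identity for Cauchy transforms and max(x,0) for
    psi. *)
Lemma resolvent_powers_eq k :
  cint mu (fun x => c z0 x ^+ k) = cint nu (fun x => c z0 x ^+ k).
Proof.
(* The induction carries the mixed integrals with one factor c_z as well. *)
suff : (forall z, Z z -> cint mu (fun x => c z0 x ^+ k * c z x) =
                         cint nu (fun x => c z0 x ^+ k * c z x)) /\
    cint mu (fun x => c z0 x ^+ k) = cint nu (fun x => c z0 x ^+ k) by case.
elim: k => [|k [IH1 IH0]].
  split=> [z Zz|]; last by under eq_fun do rewrite expr0; rewrite !cint_cst.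
  rewrite (_ : (fun _ => _) = c z); first exact: cE.
  by apply/funext => x; rewrite expr0 mul1r.
have IHS : cint mu (fun x => c z0 x ^+ k.+1) = cint nu (fun x => c z0 x ^+ k.+1).
  by under eq_fun do rewrite exprSr; rewrite IH1//; congr cint;
     apply/funext => x; rewrite exprSr.
split=> // z Zz.
have [->|zz0] := eqVneq z z0; last first.
  rewrite power_step// !cintZ ?cintB ?IH1//; try exact: ick.
  - by apply: cintegrableB; exact: ick.
  - by apply: cintegrableB; exact: ick.
apply/eqP; rewrite -subr_eq0; apply/eqP/Normc.eq0_normc/eqP.
rewrite eq_le normc_ge0 andbT; apply/ler_addgt0Pl => e e0; rewrite addr0.
(* Each of the two measures contributes an error of at most 2 K^(k+3) |w - z0|; the 1 makes C
   positive even if K = 0. *)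
pose C := 4 * K ^+ k.+3 + 1.
have C0 : 0 < C by rewrite ltr_wpDl// mulr_ge0// exprn_ge0.
have [w [Zw wz0 we]] := Zacc (divr_gt0 e0 C0).
have E (m : {measure set R -> \bar R}) : m [set: R] = 1%E ->
    cint m (fun x => c z0 x ^+ k.+1 * c z0 x) =
    cint m (fun x => c z0 x ^+ k.+1 * c w x) +
    (w - z0) * cint m (fun x => c z0 x ^+ k.+2 * c w x).
  move=> m1; have i1 := @ick m k.+1 w m1 Zw; have i2 := @ick m k.+2 w m1 Zw.
  rewrite -(cintZ _ i2) -(cintD i1 (cintegrableZ _ i2)).
  congr cint; apply/funext => x.
  rewrite (congr1 (@^~ x) (power_step k.+1 Zw wz0)) /= mulrA divff ?subr_eq0//.
  by rewrite mul1r addrC subrK.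
have EE : cint mu (fun x => c z0 x ^+ k.+1 * c w x) =
          cint nu (fun x => c z0 x ^+ k.+1 * c w x).
  rewrite power_step// !cintZ ?cintB ?IH1//; try exact: ick.
  - by apply: cintegrableB; exact: ick.
  - by apply: cintegrableB; exact: ick.
rewrite !E// EE opprD addrACA subrr add0r -mulrBr Normc.normcM.
have B (m : {measure set R -> \bar R}) : m [set: R] = 1%E ->
    normc (cint m (fun x => c z0 x ^+ k.+2 * c w x)) <= 2 * K ^+ k.+3.
  by move=> m1; apply: (normc_cint_bounded m1 (mck _ _)) => x; exact: bck.
apply: (@le_trans _ _ (e / C * C)); last by rewrite divfK ?gt_eqF.
apply: ler_pM; rewrite ?normc_ge0 ?(ltW we)//.
apply: le_trans (normcB _ _) _; rewrite /C; have := B _ mu1; have := B _ nu1.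
lra.
Qed.

End resolvent_powers.
End determination.

Section bounded_measurable.
Context (R : realType).
Implicit Types f g : R -> R[i].

Definition cbounded f := cmeasurable f /\ exists M : R, forall x, normc (f x) <= M.

Lemma cboundedM f g : cbounded f -> cbounded g -> cbounded (fun x => f x * g x).
Proof.
move=> [mf [M fM]] [mg [N gN]]; split; first exact: cmeasurableM.
by exists (M * N) => x; rewrite Normc.normcM ler_pM ?normc_ge0.
Qed.

Lemma cboundedD f g : cbounded f -> cbounded g -> cbounded (fun x => f x + g x).
Proof.
move=> [mf [M fM]] [mg [N gN]]; split; first exact: cmeasurableD.
by exists (M + N) => x; rewrite (le_trans (le_normcD _ _))// lerD.
Qed.

Lemma cbounded_cst c : cbounded (fun=> c).
Proof. by split; [exact: cmeasurable_cst|exists (normc c)]. Qed.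

Lemma cboundedX f n : cbounded f -> cbounded (fun x => f x ^+ n).
Proof.
move=> bf; elim: n => [|n IH]; first exact: cbounded_cst.
by under eq_fun do rewrite exprS; exact: cboundedM.
Qed.

Lemma cbounded_integrable (m : {measure set R -> \bar R}) f :
  m [set: R] = 1%E -> cbounded f -> cintegrable m f.
Proof. by move=> m1 [mf [M fM]]; exact: cintegrable_bounded fM. Qed.

Lemma cint_conj (m : {measure set R -> \bar R}) f : cintegrable m f ->
  cint m (fun x => (f x)^*%C) = (cint m f)^*%C.
Proof.
move=> [_ f2]; apply: complex_eqP => /=.
  by congr rint; apply/funext => x /=; case: (f x).
rewrite -mulN1r -rintZ//; congr rint; apply/funext => x /=.
by rewrite mulN1r; case: (f x).
Qed.

End bounded_measurable.

Section cauchy_transform.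
Context (R : realType).
Variables (mu nu : {measure set R -> \bar R}).
Hypotheses (mu1 : mu [set: R] = 1%E) (nu1 : nu [set: R] = 1%E).
Variables (a b : R).
Hypothesis (b0 : 0 < b).
Let z0 : R[i] := a +i* b.
Let c (x : R) := (z0 - x%:C)^-1.
Hypothesis cE : forall k, cint mu (fun x => c x ^+ k) = cint nu (fun x => c x ^+ k).

Let i_ : R[i] := 'i.
Let i2 : i_ ^+ 2 = -1. Proof. exact: sqr_i. Qed.
Let zE : z0 = a%:C + i_ * b%:C.
Proof. by rewrite /z0 [LHS]complexE. Qed.

Let z0x x : z0 - x%:C != 0.
Proof. by rewrite eq_complex /= subr0 (gt_eqF b0) andbF. Qed.

Let z0x' x : z0^*%C - x%:C != 0.
Proof. by rewrite eq_complex /= subr0 oppr_eq0 (gt_eqF b0) andbF. Qed.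

Let cK x : normc (c x) <= b^-1.
Proof.
rewrite Normc.normcV lef_pV2 ?posrE// ?normc_gt0 ?z0x//.
by apply: le_trans (Im_le_normc _); rewrite /= subr0 ler_norm.
Qed.

Let bc : cbounded c.
Proof.
split; last by exists b^-1.
by apply/cmeasurableV/cmeasurableB; [exact: cmeasurable_cst|exact: cmeasurable_real].
Qed.

Let w : R[i] := 2 * i_ * b%:C.
(** The Cayley transform (conj z0 - x)/(z0 - x). It maps the line to the unit circle, so its
    conjugate [C'] is also its inverse. *)
Let C x := 1 - w * c x.
Let C' x := (C x)^*%C.

Let bC : cbounded C.
Proof.
rewrite /C; under eq_fun do rewrite -mulNr.
apply: cboundedD; first exact: cbounded_cst.
by apply: cboundedM => //; exact: cbounded_cst.
Qed.

Let CE x : C x = (z0^*%C - x%:C) / (z0 - x%:C).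
Proof.
rewrite /C /c -[X in X - _](divff (z0x x)) -mulrBl; congr (_ / _).
by rewrite /w /z0; apply: complex_eqP; rewrite /=; ring.
Qed.

Let C'E x : C' x = (z0 - x%:C) / (z0^*%C - x%:C).
Proof.
rewrite /C' CE rmorphM fmorphV /=.
by congr (_ / _); apply: complex_eqP => /=; ring.
Qed.

Let CC' x : C x * C' x = 1.
Proof. by rewrite CE C'E; field; rewrite z0x z0x'. Qed.

Let bC' : cbounded C'.
Proof.
have [[m1 m2] [M CM]] := bC; split; last first.
  by exists M => x; have := CM x; rewrite /C'; case: (C x) => ? ? /=; rewrite sqrrN.
split.
  by move: m1; congr measurable_fun; apply/funext => x; rewrite /= /C'; case: (C x).
have := measurable_funN m2; congr measurable_fun.
Qed.

Let EC k j : cint mu (fun x => C x ^+ k * c x ^+ j) = cint nu (fun x => C x ^+ k * c x ^+ j).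
Proof.
elim: k j => [|k IH] j.
  by under eq_fun do rewrite expr0 mul1r; rewrite cE; congr cint;
    apply/funext => x; rewrite expr0 mul1r.
rewrite (_ : (fun _ => _) = (fun x => C x ^+ k * c x ^+ j - w * (C x ^+ k * c x ^+ j.+1))).
  have bk i : cbounded (fun x => C x ^+ k * c x ^+ i).
    by apply: cboundedM; exact: cboundedX.
  have ik (m : {measure set R -> \bar R}) i : m [set: R] = 1%E ->
    cintegrable m (fun x => C x ^+ k * c x ^+ i) by move=> ?; exact: cbounded_integrable.
  by rewrite !cintB ?cintZ ?IH//; try (by exact: ik); apply: cintegrableZ; exact: ik.
by apply/funext => x; rewrite !exprS {1}/C; ring.
Qed.

(** Powers of [C] are polynomials in c, powers of [C'] are their conjugates, and mixed products
    collapse to one of these because C C' = 1. *)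
Let ECC' j l : cint mu (fun x => C x ^+ j * C' x ^+ l) = cint nu (fun x => C x ^+ j * C' x ^+ l).
Proof.
have E1 k : cint mu (fun x => C x ^+ k) = cint nu (fun x => C x ^+ k).
  rewrite (_ : (fun _ => _) = fun x => C x ^+ k * c x ^+ 0); first exact: EC.
  by apply/funext => x; rewrite expr0 mulr1.
have E2 k : cint mu (fun x => C' x ^+ k) = cint nu (fun x => C' x ^+ k).
  rewrite (_ : (fun _ => _) = fun x => (C x ^+ k)^*%C); last first.
    by apply/funext => x; rewrite /C' rmorphXn.
  by rewrite !cint_conj ?E1//; apply: cbounded_integrable => //; exact: cboundedX.
have [lj|jl] := leqP l j.
  rewrite (_ : (fun _ => _) = fun x => C x ^+ (j - l)); first exact: E1.
  by apply/funext => x; rewrite -{1}(subnK lj) exprD -mulrA -exprMn CC' expr1n mulr1.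
rewrite (_ : (fun _ => _) = fun x => C' x ^+ (l - j)); first exact: E2.
apply/funext => x.
by rewrite -{1}(subnK (ltnW jl)) exprD mulrCA -exprMn CC' expr1n mulr1.
Qed.

Section half_line.
Variable e : R.
Let kappa := b ^+ 2 / (b ^+ 2 + e ^+ 2).
(** A trigonometric polynomial of degree one on the Cayley circle, scaled by [kappa] to have values
    in [0,1] (Cauchy-Schwarz). Its limit at infinity is [kappa], so {g < kappa} is an arc ending at
    infinity, that is, a half-line when e <> 0. *)
Let g (x : R) := kappa * ((x - a + e) ^+ 2 / ((x - a) ^+ 2 + b ^+ 2)).

Let be0 : 0 < b ^+ 2 + e ^+ 2.
Proof. by rewrite ltr_wpDr ?sqr_ge0// exprn_gt0. Qed.

Let xb0 x : 0 < (x - a) ^+ 2 + b ^+ 2.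
Proof. by rewrite ltr_wpDl ?sqr_ge0// exprn_gt0. Qed.

Let kappa01 : 0 < kappa <= 1.
Proof.
rewrite divr_gt0 ?exprn_gt0//= ler_pdivrMr// mul1r lerDl sqr_ge0//.
Qed.

Let alpha : R[i] := - ((e%:C + i_ * b%:C) ^+ 2 / (4 * (b ^+ 2 + e ^+ 2)%:C)).

Let alpha' : R[i] := - ((e%:C - i_ * b%:C) ^+ 2 / (4 * (b ^+ 2 + e ^+ 2)%:C)).

Let gE x : (g x)%:C = 2^-1 + alpha * C x + alpha' * C' x.
Proof.
have xx : (x - a)%:C ^+ 2 + b%:C ^+ 2 = (z0 - x%:C) * (z0^*%C - x%:C).
  by apply: complex_eqP => /=; ring.
have n0 : (b ^+ 2 + e ^+ 2)%:C != 0 by rewrite eq_complex /= gt_eqF.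
rewrite /alpha /alpha' CE C'E.
have -> : (g x)%:C = b%:C ^+ 2 / (b%:C ^+ 2 + e%:C ^+ 2) * ((x%:C - a%:C + e%:C) ^+ 2 /
   ((z0 - x%:C) * (z0^*%C - x%:C))).
  by rewrite -xx /g /kappa !(rmorphM, fmorphV, rmorphXn, rmorphD, rmorphB, rmorphN).
have be_ : (b ^+ 2 + e ^+ 2)%:C = b%:C ^+ 2 + e%:C ^+ 2.
  by rewrite -!rmorphXn -rmorphD.
have n1 : b%:C ^+ 2 + e%:C ^+ 2 != 0 by rewrite -!rmorphXn -rmorphD.
have zb : z0^*%C = a%:C - i_ * b%:C by apply: complex_eqP; rewrite /=; ring.
move: (z0x x) (z0x' x); rewrite zb zE be_.
move: i2 n1; move: i_ (x%:C) (a%:C) (b%:C) (e%:C) => I X A B E I2 n1 h1 h2.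
have BI : B ^+ 2 = - (I * B) ^+ 2 by rewrite exprMn I2 mulN1r opprK.
rewrite BI in n1 *; move: (I * B) n1 h1 h2 => P n1 h1 h2.
by field; apply/and3P.
Qed.

Let EgCC' n j l : cint mu (fun x => (g x)%:C ^+ n * (C x ^+ j * C' x ^+ l)) =
  cint nu (fun x => (g x)%:C ^+ n * (C x ^+ j * C' x ^+ l)).
Proof.
elim: n j l => [|n IH] j l.
  rewrite (_ : (fun _ => _) = fun x => C x ^+ j * C' x ^+ l); first exact: ECC'.
  by apply/funext => x; rewrite expr0 mul1r.
have bg : cbounded (fun x => (g x)%:C).
  rewrite (_ : (fun _ => _) = fun x => 2^-1 + alpha * C x + alpha' * C' x).
    by do ?apply: cboundedD; do ?apply: cboundedM => //; exact: cbounded_cst.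
  by apply/funext => x; exact: gE.
pose h j l x := (g x)%:C ^+ n * (C x ^+ j * C' x ^+ l).
have ih (m : {measure set R -> \bar R}) i k : m [set: R] = 1%E -> cintegrable m (h i k).
  move=> m1; apply: cbounded_integrable => //.
  by do ?apply: cboundedM; exact: cboundedX.
rewrite (_ : (fun _ => _) = fun x => 2^-1 * h j l x + alpha * h j.+1 l x + alpha' * h j l.+1 x).
  have iZ (m : {measure set R -> \bar R}) k i i' : m [set: R] = 1%E ->
    cintegrable m (fun x => k * h i i' x) by move=> m1; exact/cintegrableZ/ih.
  rewrite !cintD ?cintZ ?IH//; try (by exact: ih); try (by exact: iZ).
    by apply: cintegrableD; exact: iZ.
  by apply: cintegrableD; exact: iZ.
by apply/funext => x; rewrite exprS {1}gE /h !exprS; ring.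
Qed.

Let g01 x : 0 <= g x <= 1.
Proof.
have /andP[k0 _] := kappa01.
rewrite /g mulr_ge0 ?(ltW k0)//=; last by rewrite divr_ge0 ?sqr_ge0// ltW.
rewrite /kappa mulf_div ler_pdivrMr ?mulr_gt0// mul1r.
have : 0 <= (b ^+ 2 - (x - a) * e) ^+ 2 by exact: sqr_ge0.
lra.
Qed.

Let mg : measurable_fun [set: R] g.
Proof.
apply: measurable_funM => //; apply: measurable_funM.
  by apply/measurable_funX/measurable_funD => //; exact: measurable_funB.
by apply/measurable_funV/measurable_funD => //; exact/measurable_funX/measurable_funB.
Qed.

(** The inequality g x < kappa reads (x-a+e)^2 < (x-a)^2 + b^2, in which the quadratic terms cancel;
    the moments of g agree because g is affine in [C] and [C']. *)
Lemma half_line_eq : mu [set x | 2 * e * (x - a) < b ^+ 2 - e ^+ 2] =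
  nu [set x | 2 * e * (x - a) < b ^+ 2 - e ^+ 2].
Proof.
have -> : [set x | 2 * e * (x - a) < b ^+ 2 - e ^+ 2] = [set x | g x < kappa].
  have /andP[k0 _] := kappa01.
  apply/seteqP; split => x /=; rewrite /g gtr_pMr// ltr_pdivrMr// mul1r; lra.
apply: measure_sublevel_eq => // n.
have E (m : {measure set R -> \bar R}) :
  rint m (fun x => g x ^+ n) = Re (cint m (fun x => (g x)%:C ^+ n * (C x ^+ 0 * C' x ^+ 0))).
  by congr rint; apply/funext => x; rewrite /= !expr0 !mulr1 -rmorphXn.
by rewrite !E EgCC'.
Qed.

End half_line.

Lemma cauchy_powers_determine B : measurable B -> mu B = nu B.
Proof.
apply: measure_rays_eq => // tau.
(* e is the negative root of e^2 + 2 e (tau - a) = b^2; its sign turns the half-line of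
   [half_line_eq] into x > tau. *)
pose r := Num.sqrt ((tau - a) ^+ 2 + b ^+ 2); pose e := - (tau - a) - r.
have r2 : r ^+ 2 = (tau - a) ^+ 2 + b ^+ 2 by rewrite sqr_sqrtr// addr_ge0 ?sqr_ge0.
have e0 : e < 0.
  rewrite /e subr_lt0; apply: le_lt_trans (ler_norm _) _.
  by rewrite normrN -sqrtr_sqr ltr_sqrt ?ltrDl ?exprn_gt0// ltr_wpDl ?sqr_ge0 ?exprn_gt0.
have ee : b ^+ 2 - e ^+ 2 = 2 * e * (tau - a).
  by have := r2; rewrite /e; lra.
have -> : `]tau, +oo[%classic = [set x | 2 * e * (x - a) < b ^+ 2 - e ^+ 2].
  apply/seteqP; split => x /=; rewrite in_itv/= andbT ee ltr_nM2l ?nmulr_llt0//; lra.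
exact: half_line_eq.
Qed.

End cauchy_transform.

Section uniqueness.
Context (R : realType).
Variables (mu nu : {measure set R -> \bar R}).
Hypotheses (mu1 : mu [set: R] = 1%E) (nu1 : nu [set: R] = 1%E).

(** On Im z > eta all resolvents are bounded by 1/eta, which is the uniform bound required by
    [resolvent_powers_eq]. *)
Lemma Gtr_determines (eta : R) (z0 : R[i]) : 0 < eta ->
  eta < Im z0 -> Gtr mu z0 = Gtr nu z0 ->
  (forall e, 0 < e -> exists z, [/\ eta < Im z, z != z0, normc (z - z0) < e &
     Gtr mu z = Gtr nu z]) ->
  forall B, measurable B -> mu B = nu B.
Proof.
move=> eta0 etaz0 Gz0 acc B mB; case: z0 etaz0 Gz0 acc => a b /= etab Gz0 acc.
have b0 : 0 < b by exact: lt_trans etab.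
apply: (cauchy_powers_determine mu1 nu1 (a := a) b0) => // k.
pose Z := [set z : R[i] | eta < Im z /\ Gtr mu z = Gtr nu z].
have Zx z x : Z z -> z != x%:C.
  move=> [ez _]; rewrite eq_complex /= negb_and orbC gt_eqF//.
  exact: lt_trans ez.
apply: (@resolvent_powers_eq _ mu nu mu1 nu1 id Z _ eta^-1) => //.
- by rewrite invr_ge0 ltW.
- move=> z x Zz; rewrite Normc.normcV lef_pV2 ?posrE ?normc_gt0 ?subr_eq0 ?Zx//.
  apply: le_trans (Im_le_normc _); case: Zz => ez _.
  by rewrite ImD ImN /= oppr0 addr0 (le_trans (ltW ez))// ler_norm.
- by move=> e e0; have [z [? ? ? ?]] := acc e e0; exists z.
- by move=> z [].
Qed.

(** psi(1/zeta) + 1 is the integral of zeta/(zeta - x), so psi near 1/zeta0 carries the same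
    information as real resolvents near zeta0. *)
Lemma psi_determines (zeta0 : R) : zeta0 < 0 ->
  mu [set x | x < 0] = 0%E -> nu [set x | x < 0] = 0%E ->
  psi mu zeta0^-1 = psi nu zeta0^-1 ->
  (forall e, 0 < e -> exists zeta, [/\ zeta < 0, zeta != zeta0, `|zeta - zeta0| < e &
     psi mu zeta^-1 = psi nu zeta^-1]) ->
  forall B, measurable B -> mu B = nu B.
Proof.
move=> zeta0_lt0 mun nun psi0 acc.
(* Truncation changes x only on a null set and keeps zeta - xi x away from 0 for every real x. *)
pose xi (x : R) := Num.max x 0.
have mxi : measurable_fun [set: R] xi by exact: measurable_maxr.
have xi0 x : 0 <= xi x by rewrite le_max lexx orbT.
pose Z := [set z : R[i] | exists zeta : R, [/\ z = zeta%:C, zeta < zeta0 / 2 &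
  psi mu zeta^-1 = psi nu zeta^-1]].
have sgm zeta x : zeta < zeta0 / 2 -> zeta - xi x < 0.
  by move=> h; have := xi0 x; lra.
have Zx z x : Z z -> z != (xi x)%:C.
  move=> [zeta [-> h _]]; rewrite eq_complex /= eqxx andbT lt_eqF//.
  by have := sgm zeta x h; lra.
have mr zeta : measurable_fun [set: R] (fun x => zeta / (zeta - xi x)).
  by apply: measurable_funM => //; apply/measurable_funV/measurable_funB.
have r01 zeta x : zeta < zeta0 / 2 -> 0 <= zeta / (zeta - xi x) <= 1.
  move=> h; have h1 := sgm zeta x h; have z0 : zeta < 0 by lra.
  rewrite -[zeta / _]mulrNN -invrN divr_ge0 ?oppr_ge0 ?(ltW h1) ?(ltW z0)//=.
  by rewrite ler_pdivrMr ?oppr_gt0// mul1r; have := xi0 x; lra.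
have ir (m : {measure set R -> \bar R}) zeta : m [set: R] = 1%E -> zeta < zeta0 / 2 ->
    rintegrable m (fun x => zeta / (zeta - xi x)).
  move=> m1 h; apply: (rintegrable_dom (b := fun=> 1)) => //.
    exact: rintegrable_cst.
  by move=> x; have /andP[? ?] := r01 zeta x h; rewrite ger0_norm.
have E (m : {measure set R -> \bar R}) zeta : m [set: R] = 1%E ->
    m [set x | x < 0] = 0%E -> zeta < zeta0 / 2 ->
    psi m zeta^-1 = rint m (fun x => zeta / (zeta - xi x)) - 1.
  move=> m1 mn h; rewrite -(rint_cst m1 1) -rintB ?ir//; last exact: rintegrable_cst.
  have mneg : measurable [set x : R | x < 0].
    rewrite (_ : [set _ | _] = `]-oo, 0[%classic); first exact: measurable_itv.
    by apply/seteqP; split => x /=; rewrite in_itv.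
  rewrite /psi /rint; congr fine; apply: ae_eq_integral => //.
  - apply/measurable_EFinP/measurable_funM; first exact: measurable_funM.
    by apply/measurable_funV/measurable_funB => //; exact: measurable_funM.
  - by apply/measurable_EFinP/measurable_funB.
  - exists [set x | x < 0]; split => // x /= /not_implyP[_] H.
    rewrite ltNge; apply/negP => x0; apply: H; congr EFin.
    rewrite /xi max_l//; have z0 : zeta < 0 by lra.
    field; rewrite (lt_eqF z0) andbT/= lt_eqF//; lra.
have psiE zeta : zeta < zeta0 / 2 -> psi mu zeta^-1 = psi nu zeta^-1 ->
    cint mu (fun x => (zeta%:C - (xi x)%:C)^-1) = cint nu (fun x => (zeta%:C - (xi x)%:C)^-1).
  move=> h; rewrite !E// => /addIr H.
  have F : (fun x => (zeta%:C - (xi x)%:C)^-1) =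
           (fun x => (zeta^-1)%:C * (zeta / (zeta - xi x))%:C).
    apply/funext => x; rewrite -rmorphM /= mulrA mulVf ?mul1r; last by rewrite lt_eqF//; lra.
    by rewrite -rmorphB fmorphV.
  by rewrite F !cintZ ?cint_real ?H//; apply: cintegrable_real; exact: ir.
have pw k : cint mu (fun x => ((zeta0%:C : R[i]) - (xi x)%:C)^-1 ^+ k) =
            cint nu (fun x => ((zeta0%:C : R[i]) - (xi x)%:C)^-1 ^+ k).
  apply: (@resolvent_powers_eq _ mu nu mu1 nu1 xi Z _ (- zeta0 / 2)^-1) => //.
  - by rewrite invr_ge0; lra.
  - move=> z x Zz; have := Zz => -[zeta [zE h _]].
    rewrite Normc.normcV lef_pV2 ?posrE ?normc_gt0 ?subr_eq0 ?Zx//; last by lra.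
    rewrite zE -rmorphB normc_real ltr0_norm ?sgm//; have := xi0 x; lra.
  - by exists zeta0; split => //; lra.
  (* Staying within |zeta0|/2 of zeta0 keeps zeta below zeta0/2, as [Z] demands. *)
  - move=> e e0; have e1 : 0 < Num.min e (- zeta0 / 2) by rewrite lt_min e0/=; lra.
    have [zeta [z1 z2]] := acc _ e1; rewrite lt_min => /andP[z3 z4] z5.
    exists zeta%:C; split.
    + exists zeta; split => //.
      by move: z4; rewrite ltr_norml => /andP[]; lra.
    + by rewrite eq_complex /= eqxx andbT.
    + by rewrite -rmorphB normc_real.
  - by move=> z [zeta [-> h1 h2]]; exact: psiE.
(* g has values in [0,1] and decreases in x >= 0, so its sublevel sets are the rays beyond tau >= 0;
   rays starting at tau < 0 have full mass. *)
pose g x := zeta0 / (zeta0 - xi x).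
have zz : zeta0 < zeta0 / 2 by lra.
have gE n : rint mu (fun x => g x ^+ n) = rint nu (fun x => g x ^+ n).
  have F : (fun x => (zeta0%:C - (xi x)%:C)^-1 ^+ n) =
           (fun x => ((zeta0^-1) ^+ n)%:C * (g x ^+ n)%:C).
    apply/funext => x; rewrite -rmorphM /= -exprMn /g mulrA mulVf ?mul1r ?lt_eqF//.
    by rewrite -rmorphB -fmorphV rmorphXn.
  have := pw n; rewrite F.
  have ig (m : {measure set R -> \bar R}) : m [set: R] = 1%E -> rintegrable m (fun x => g x ^+ n).
    move=> m1; apply: (rintegrable_dom (b := fun=> 1)) => //.
    + by apply: measurable_funX; exact: mr.
    + exact: rintegrable_cst.
    + move=> x; have /andP[? ?] := r01 zeta0 x zz.
      by rewrite ger0_norm ?exprn_ge0// exprn_ile1.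
  rewrite !cintZ ?cint_real; [|exact/cintegrable_real/ig..].
  move/mulfI => /(_ _)/complexI; apply.
  by rewrite eq_complex /= eqxx andbT expf_neq0// invr_neq0// lt_eqF.
apply: measure_rays_eq => // tau.
have [tau0|tau0] := ltP tau 0.
  have full (m : {measure set R -> \bar R}) : m [set: R] = 1%E ->
      m [set x | x < 0] = 0%E -> m `]tau, +oo[%classic = 1%E.
    move=> m1 mn; apply/eqP; rewrite eq_le -{1}m1 le_measure ?inE//=.
    rewrite -m1 -[leRHS]adde0 -[X in (_ + X)%E]mn.
    rewrite (le_trans (y := m (`]tau, +oo[%classic `|` [set x | x < 0])))//.
      rewrite le_measure ?inE//.
        apply: measurableU => //.
        rewrite (_ : [set _ | _] = `]-oo, 0[%classic); first exact: measurable_itv.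
        by apply/seteqP; split => x /=; rewrite in_itv.
      move=> x _ /=; rewrite in_itv/= andbT; have [?|?] := ltP x 0; [right|left] => //.
      exact: lt_le_trans tau0 _.
    apply: measureU2 => //.
    rewrite (_ : [set _ | _] = `]-oo, 0[%classic); first exact: measurable_itv.
    by apply/seteqP; split => x /=; rewrite in_itv.
  by rewrite !full.
have -> : `]tau, +oo[%classic = [set x | g x < zeta0 / (zeta0 - tau)].
  apply/seteqP; split => x /=; rewrite in_itv/= andbT /g ltr_nM2l// ltf_nV2;
    rewrite ?negrE ?sgm//; try lra; by rewrite ltrD2l ltrN2 /xi lt_max (ltNge tau 0) tau0 orbF.
apply: measure_sublevel_eq => //.
- by apply: mr.
- by move=> x; exact: r01.
rewrite -[zeta0 / _]mulrNN -invrN divr_gt0 ?oppr_gt0//=; last by lra.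
by rewrite ler_pdivrMr ?oppr_gt0// ?mul1r; lra.
Qed.

End uniqueness.

                                

(** * Chebyshev polynomials and the Cauchy transform of the semicircle *)

Section trigonometric_integrals.
Context (R : realType).
Implicit Types (F f : R -> R) (a b x : R).

Lemma integral_derive F f a b : a < b -> (forall x, is_derive x 1 F (f x)) ->
  continuous f ->
  (\int[lebesgue_measure]_(x in `[a, b]) (f x)%:E = (F b - F a)%:E)%E.
Proof.
move=> ab dF cf.
have cF : continuous F.
  move=> x; apply/differentiable_continuous/derivable1_diffP.
  by have [] := dF x.
rewrite (@continuous_FTC2 _ f F)//.
- exact: continuous_subspaceT.
- split=> [x _||]; first by have [] := dF x.
  + by apply: cvg_at_right_filter; exact: cF.
  + by apply: cvg_at_left_filter; exact: cF.
- by move=> x _; rewrite derive1E; apply: derive_val.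
Qed.

Lemma sin_nat_mul_pi n : sin (n%:R * pi) = 0 :> R.
Proof.
elim: n => [|n IH]; first by rewrite mul0r sin0.
by rewrite -natr1 mulrDl mul1r sinDpi IH oppr0.
Qed.

Let is_derive_sinM (k : R) x :
  is_derive x 1 (sin \o (k \*o id)) (k * cos (k * x)).
Proof. by apply: is_derive_eq; rewrite /GRing.scale/= mulr1 mulrC. Qed.

Lemma integral_sin_sin n :
  (\int[lebesgue_measure]_(x in `[0%R, pi]) (sin x * sin (n%:R * x))%:E =
    ((n == 1%N)%:R * (pi / 2))%:E :> \bar R)%E.
Proof.
case: n => [|[|k]].
- under eq_integral do rewrite mul0r sin0 mulr0.
  by rewrite integral0 mul0r.
- under eq_integral do rewrite mul1r.
  pose F : R -> R := 2^-1 \*o (id \- sin \* cos).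
  have dF x : is_derive x 1 F (sin x * sin x).
    apply: is_derive_eq.
    by rewrite /GRing.scale /=; have := cos2Dsin2 x; rewrite !expr2; lra.
  rewrite (integral_derive (pi_gt0 R) dF); last first.
    by move=> x; apply: cvgM; exact: continuous_sin.
  by rewrite /F /= sinpi sin0 !mul0r !subr0 mulr0 subr0 mul1r mulrC.
(* Here n = k+2, p = n-1 and q = n+1; the integrand is (cos (p x) - cos (q x))/2. *)
- pose p : R := k.+1%:R; pose q : R := k.+3%:R.
  have p0 : p != 0 by rewrite pnatr_eq0.
  have q0 : q != 0 by rewrite pnatr_eq0.
  pose F : R -> R :=
    (2 * p)^-1 \*o (sin \o (p \*o id)) \- (2 * q)^-1 \*o (sin \o (q \*o id)).
  have dF x : is_derive x 1 F (sin x * sin (k.+2%:R * x)).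
    apply: is_derive_eq; rewrite /GRing.scale /=.
    have -> : p * x = k.+2%:R * x - x by rewrite /p -[k.+2%:R]natr1; ring.
    have -> : q * x = k.+2%:R * x + x by rewrite /q -[k.+3%:R]natr1; ring.
    by rewrite cosB cosD; field; apply/andP.
  rewrite (integral_derive (pi_gt0 R) dF); last first.
    move=> x; apply: cvgM; first exact: continuous_sin.
    apply: continuous_comp; last exact: continuous_sin.
    exact: mulrl_continuous.
  by rewrite /F /= !mulr0 sin0 !sin_nat_mul_pi !mulr0 !subrr mul0r.
Qed.

End trigonometric_integrals.

Section chebyshev.
Context (R : realType).
Implicit Types u x : R.

                                                                            
(** The Chebyshev polynomial of the second kind with shifted index: [cheb u n] is U_{n-1}(u), with
    U_{-1} = 0. *)
Fixpoint cheb u n : R :=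
  if n is n'.+1 then
    if n' is n''.+1 then 2 * u * cheb u n' - cheb u n'' else 1
  else 0.

Lemma chebSS u n : cheb u n.+2 = 2 * u * cheb u n.+1 - cheb u n.
Proof. by []. Qed.

Lemma sin_cheb x n : sin x * cheb (cos x) n = sin (n%:R * x).
Proof.
suff : sin x * cheb (cos x) n = sin (n%:R * x) /\
       sin x * cheb (cos x) n.+1 = sin (n.+1%:R * x) by case.
elim: n => [|n [IH1 IH2]]; first by rewrite /= mulr0 mul0r sin0 mulr1 mul1r.
split=> //; rewrite chebSS mulrBr mulrCA IH2 IH1.
have -> : n%:R * x = n.+1%:R * x - x by rewrite -[n.+1%:R]natr1; ring.
have -> : n.+2%:R * x = n.+1%:R * x + x by rewrite -[n.+2%:R]natr1; ring.
by rewrite sinB sinD; ring.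
Qed.

(** The recurrence preserves this quadratic form. Completing the square in it yields [cheb_bound],
    with no trigonometric substitution. *)
Lemma cheb_invariant u n :
  cheb u n.+1 ^+ 2 - 2 * u * cheb u n.+1 * cheb u n + cheb u n ^+ 2 = 1.
Proof.
elim: n => [|n IH]; first by rewrite /=; ring.
by rewrite -[RHS]IH chebSS; ring.
Qed.

Lemma cheb_bound u n : (1 - u ^+ 2) * cheb u n ^+ 2 <= 1.
Proof.
have := cheb_invariant u n; have := sqr_ge0 (cheb u n.+1 - u * cheb u n).
by lra.
Qed.

Lemma continuous_cheb n : continuous (fun u => cheb u n).
Proof.
suff : continuous (fun u => cheb u n) /\ continuous (fun u => cheb u n.+1) by case.
elim: n => [|n [IH1 IH2]]; first by split; exact: cst_continuous.
split=> // u; apply: cvgB; last exact: IH1.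
by apply: cvgM; [exact: mulrl_continuous|exact: IH2].
Qed.

End chebyshev.

Section semicircle.
Context (R : realType).
Variables (m r : R).
Hypothesis r0 : 0 < r.
Local Notation leb := (@leb R).

Definition semicircle x : R := Num.sqrt (r ^+ 2 - (x - m) ^+ 2).

Lemma semicircle_ge0 x : 0 <= semicircle x.
Proof. exact: sqrtr_ge0. Qed.

Lemma semicircle_out x : x \notin `[m - r, m + r] -> semicircle x = 0.
Proof.
rewrite in_itv/= negb_and -!ltNge => h; apply/eqP; rewrite sqrtr_eq0.
rewrite subr_sqr; case/orP: h => h; [apply: mulr_ge0_le0|apply: mulr_le0_ge0]; move: r0 h; lra.
Qed.


Lemma continuous_semicircle : continuous semicircle.
Proof.
move=> x; apply: (@continuous_comp _ _ _ (fun x => r ^+ 2 - (x - m) ^+ 2) Num.sqrt).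
  apply: cvgB; first exact: cvg_cst.
  by apply: (@continuous_comp _ _ _ (fun x => x - m) (fun y => y ^+ 2));
    [apply: cvgB; [exact: cvg_id|exact: cvg_cst]|exact: exprn_continuous].
exact: sqrt_continuous.
Qed.

Lemma measurable_semicircle : measurable_fun [set: R] semicircle.
Proof. exact: continuous_measurable_fun continuous_semicircle. Qed.

Let u (x : R) : R := (x - m) / r.

Let continuous_u : continuous u.
Proof. by move=> x; apply: cvgMl; apply: cvgB; [exact: cvg_id|exact: cvg_cst]. Qed.

Lemma semicircleE x : `|u x| <= 1 -> semicircle x = r * Num.sqrt (1 - u x ^+ 2).
Proof.
move=> ux; rewrite /semicircle -{2}[r]ger0_norm ?ltW// -sqrtr_sqr -sqrtrM ?sqr_ge0//.
by congr Num.sqrt; rewrite /u; field; rewrite gt_eqF.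
Qed.

(** The substitution x = m + r cos phi turns the integral into that of r^2 sin phi sin (n phi) over
    [0, pi]. *)
Lemma rint_semicircle_cheb n :
  rint leb (fun x => semicircle x * cheb (u x) n) = (n == 1%N)%:R * (pi * r ^+ 2 / 2).
Proof.
pose G x := semicircle x * cheb (u x) n.
have cG : continuous G.
  move=> x; apply: cvgM; first exact: continuous_semicircle.
  by apply: (@continuous_comp _ _ _ u (fun y => cheb y n)); [exact: continuous_u|exact: continuous_cheb].
have mG : measurable_fun [set: R] G by exact: continuous_measurable_fun.
rewrite /rint.
have -> : (\int[leb]_x (G x)%:E = \int[leb]_(x in `[(m - r)%R, (m + r)%R]) (G x)%:E)%E.
  rewrite [RHS]integral_mkcond; apply: eq_integral => x _.
  rewrite patchE; case: ifPn => // /negP xI.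
  rewrite /G semicircle_out ?mul0r//; apply/negP => xI'; apply: xI.
  by rewrite inE.
rewrite integral_lebE//; last by apply/measurable_EFinP; exact: measurable_funTS.
pose F : R -> R := cst m \+ (r \*o cos).
have dF (x : R) : is_derive x (1 : R) F (- (r * sin x)).
  by apply: is_derive_eq; rewrite /GRing.scale /= add0r mulrN.
have dFE : F^`()%classic = (fun x => - (r * sin x)).
  by apply/funext => x; rewrite derive1E; exact: derive_val.
have cdF : continuous (fun x : R => - (r * sin x)).
  by move=> x; apply: cvgN; apply: cvgMr; exact: continuous_sin.
have cF : continuous F.
  by move=> x; apply: cvgD; [exact: cvg_cst|apply: cvgMr; exact: continuous_cos].
have Fpi : F pi = m - r by rewrite /F /= cospi mulrN1.
have F0 : F 0 = m + r by rewrite /F /= cos0 mulr1.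
have uF x : u (F x) = cos x by rewrite /u /F /=; field; rewrite gt_eqF.
have sF x : 0 <= x <= pi -> semicircle (F x) = r * sin x.
  move=> xpi; rewrite /semicircle (_ : r ^+ 2 - _ = (r * sin x) ^+ 2).
    by rewrite sqrtr_sqr ger0_norm// mulr_ge0 ?(ltW r0)// sin_ge0_pi.
  by rewrite exprMn sin2cos2 /F /=; ring.
rewrite -Fpi -F0 integration_by_substitution_decreasing.
- rewrite dFE.
  transitivity (fine (\int[lebesgue_measure]_(x in `[0%R, pi])
    ((r ^+ 2)%R%:E * (sin x * sin (n%:R * x))%:E)%E)).
    congr fine; apply: eq_integral => x; rewrite inE/= in_itv/= => xpi.
    rewrite -EFinM; congr EFin.
    transitivity (G (F x) * - - (r * sin x)); first by [].
    by rewrite /G uF sF// -sin_cheb opprK; ring.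
  rewrite integralZl//; last first.
    apply: continuous_compact_integrable; first exact: segment_compact.
    apply: continuous_subspaceT => x; apply: cvgM; first exact: continuous_sin.
    apply: continuous_comp; last exact: continuous_sin.
    exact: mulrl_continuous.
  by rewrite integral_sin_sin -EFinM /=; ring.
- exact: pi_ge0.
- by move=> x y xI yI xy; rewrite /F /= ltrD2l ltr_pM2l// ltr_cos.
- by move=> x _; rewrite dFE; exact: cdF.
- by apply/cvg_ex; eexists; rewrite dFE; apply: cvg_at_right_filter; exact: cdF.
- by apply/cvg_ex; eexists; rewrite dFE; apply: cvg_at_left_filter; exact: cdF.
- split; first by move=> x _; have [] := dF x.
  + by apply: cvg_at_right_filter; exact: cF.
  + by apply: cvg_at_left_filter; exact: cF.
- exact: continuous_subspaceT.
Qed.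

Let I : set R := `[m - r, m + r]%classic.

Lemma normalized_itv_le1 x : x \in I -> `|u x| <= 1.
Proof.
rewrite inE /I /= in_itv/= => /andP[h1 h2].
by rewrite /u normrM normfV (gtr0_norm r0) ler_pdivrMr// mul1r ler_norml; lra.
Qed.

Let rintegrable_I (M : R) : rintegrable leb (fun x => M * \1_I x).
Proof.
apply: rintegrableZ; apply/integrableP; split.
  by apply/measurable_EFinP/measurable_indic; exact: measurable_itv.
under eq_integral do rewrite /= ger0_norm//.
rewrite integral_indic//; last exact: measurable_itv.
rewrite setIT; suff : (@lebesgue_measure R `[(m - r)%R, (m + r)%R]%classic < +oo)%E by [].
by rewrite lebesgue_measure_itv/=; case: ifP => _; rewrite ltry.
Qed.

Lemma semicircle_dominated f (M : R) : cmeasurable f -> 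
  (forall x, `|u x| <= 1 -> semicircle x * normc (f x) <= M) ->
  cintegrable leb (fun x => (semicircle x)%:C * f x) /\
  normc (cint leb (fun x => (semicircle x)%:C * f x)) <=
    2 * (rint leb (fun x => M * \1_I x)).
Proof.
move=> mf fM.
have ms : cmeasurable (fun x => (semicircle x)%:C * f x).
  apply: cmeasurableM => //; apply: cmeasurable_real; exact: measurable_semicircle.
have b x : normc ((semicircle x)%:C * f x) <= M * \1_I x.
  rewrite Normc.normcM normc_real ger0_norm ?semicircle_ge0// indicE.
  have [xI|xI] := boolP (x \in I); first by rewrite mulr1; apply: fM; exact: normalized_itv_le1.
  by rewrite mulr0 semicircle_out ?mul0r//; move: xI; rewrite notin_setE /I /= => /negP.
have ic := cintegrable_dom ms (rintegrable_I M) b.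
by split=> //; exact: normc_cint_le ic (rintegrable_I M) b.
Qed.

Section transform.
Variables (v : R[i]) (kappa : R).
Hypotheses (v1 : normc v < 1) (kappa0 : 0 < kappa).
Hypothesis vk : forall w : R, `|w| <= 1 -> kappa <= normc (1 + v ^+ 2 - 2 * w%:C * v).

Let den x : R[i] := 1 + v ^+ 2 - 2 * (u x)%:C * v.
(** The tail of the generating function 1/(1 + v^2 - 2 u v): h n is the sum over j of U_{n+j}(u) v^j
    in closed form, so h n = U_n(u) + v h (n+1). *)
Let h n x : R[i] := ((cheb (u x) n.+1)%:C - v * (cheb (u x) n)%:C) / den x.
Let B n := cint leb (fun x => (semicircle x)%:C * h n x).

Let mu_ : measurable_fun [set: R] u.
Proof. exact: continuous_measurable_fun continuous_u. Qed.

Let mcheb n : cmeasurable (fun x => (cheb (u x) n)%:C).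
Proof.
apply: cmeasurable_real.
have c : continuous (fun x => cheb (u x) n).
  move=> x; apply: (@continuous_comp _ _ _ u (fun y => cheb y n)).
    exact: continuous_u.
  exact: continuous_cheb.
exact: continuous_measurable_fun.
Qed.

Let mden : cmeasurable den.
Proof.
apply: cmeasurableB; first exact: cmeasurable_cst.
apply: cmeasurableM; last exact: cmeasurable_cst.
by apply: cmeasurableM; [exact: cmeasurable_cst|exact: cmeasurable_real].
Qed.

Let mh n : cmeasurable (h n).
Proof.
apply: cmeasurableM; last exact: cmeasurableV.
by apply: cmeasurableB => //; apply: cmeasurableM => //; exact: cmeasurable_cst.
Qed.

Let scheb n x : `|u x| <= 1 -> semicircle x * normc (cheb (u x) n)%:C <= r.
Proof.
move=> ux; have u2 : 0 <= 1 - u x ^+ 2.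
  by move: ux; rewrite ler_norml => /andP[]; nra.
rewrite normc_real semicircleE// -mulrA ger_pMr//.
rewrite -sqrtr_sqr -sqrtrM// -[leRHS]sqrtr1 ler_wsqrtr//; exact: cheb_bound.
Qed.

Let hM n x : `|u x| <= 1 -> semicircle x * normc (h n x) <= 2 * r / kappa.
Proof.
move=> ux; have s1 := scheb n.+1 ux; have s0 := scheb n ux.
rewrite /h Normc.normcM Normc.normcV mulrA.
have D0 : 0 < normc (den x) by apply: lt_le_trans (vk ux).
apply: ler_pM; rewrite ?mulr_ge0 ?semicircle_ge0 ?normc_ge0 ?invr_ge0 ?normc_ge0//.
  apply: (@le_trans _ _ (semicircle x * (normc (cheb (u x) n.+1)%:C + normc (cheb (u x) n)%:C))).
    rewrite ler_wpM2l ?semicircle_ge0// (le_trans (normcB _ _))// lerD2l.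
    by rewrite Normc.normcM ler_piMl ?normc_ge0// ltW.
  by rewrite mulrDr; lra.
by rewrite lef_pV2 ?posrE//; exact: vk.
Qed.

Let ih n := (semicircle_dominated (mh n) (@hM n)).1.
Let bB n : normc (B n) <= 2 * rint leb (fun x => 2 * r / kappa * \1_I x) :=
  (semicircle_dominated (mh n) (@hM n)).2.

Let BS n : B n = ((n == 0%N)%:R * (pi * r ^+ 2 / 2))%:C + v * B n.+1.
Proof.
have := rint_semicircle_cheb n.+1; rewrite eqSS => <-; rewrite -cint_real.
rewrite -cintZ; last exact: ih.
rewrite -cintD; last 2 first.
- have [+ _] := semicircle_dominated (mcheb n.+1) (@scheb n.+1).
  by congr cintegrable; apply/funext => x; rewrite -rmorphM.
- exact/cintegrableZ/ih.
congr cint; apply/funext => x.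
have [ux|ux] := leP `|u x| 1; last first.
  rewrite semicircle_out ?mul0r ?mulr0 ?addr0//.
  by apply/negP => xI; move: ux; rewrite ltNge normalized_itv_le1// inE.
have D0 : den x != 0 by rewrite -normc_gt0; apply: lt_le_trans (vk ux).
have -> : h n x = (cheb (u x) n.+1)%:C + v * h n.+1 x.
  rewrite /h chebSS rmorphB rmorphM (rmorphM _ 2) (rmorph_nat _ 2) /=.
  by move: D0; rewrite /den => D0; field.
by rewrite rmorphM; ring.
Qed.

(** By orthogonality B 1 = v^n B (n+1) for all n. The B n are uniformly bounded and |v| < 1, so B 1
    vanishes without summing the series. *)
Let B1_0 : B 1 = 0.
Proof.
have Bn n : B 1 = v ^+ n * B n.+1.
  elim: n => [|n IH]; first by rewrite expr0 mul1r.
  by rewrite IH BS/= mul0r add0r mulrA exprSr.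
pose M := 2 * rint leb (fun x => 2 * r / kappa * \1_I x).
have M0 : 0 <= M by apply: le_trans (bB 0); exact: normc_ge0.
apply/Normc.eq0_normc/eqP; rewrite eq_le normc_ge0 andbT.
have c : (fun n => normc v ^+ n * M) @ \oo --> (0 : R).
  rewrite -(mul0r M); apply: cvgMl; apply: cvg_expr.
  by rewrite ger0_norm ?normc_ge0.
apply: (ler_cvg_to (cvg_cst (normc (B 1))) c); apply: nearW => n.
by rewrite {1}(Bn n) Normc.normcM normcX ler_wpM2l ?exprn_ge0 ?normc_ge0//; exact: bB.
Qed.

Lemma cint_semicircle_den :
  cintegrable leb (fun x => (semicircle x)%:C / den x) /\
  cint leb (fun x => (semicircle x)%:C / den x) = (pi * r ^+ 2 / 2)%:C.
Proof.
have E : (fun x => (semicircle x)%:C / den x) = (fun x => (semicircle x)%:C * h 0 x).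
  by apply/funext => x; rewrite /h /= mulr0 subr0 mul1r.
rewrite E; split; first exact: ih.
by rewrite -/(B 0) BS B1_0 mulr0 addr0 mul1r.
Qed.

                                                                            
(** In the Joukowski parametrisation z - x equals (r/(2 v)) [den] x, so the preceding integral only
    has to be rescaled. *)
Lemma cint_semicircle (z : R[i]) : v != 0 ->
  z = m%:C + (r / 2)%:C * (v + v^-1) ->
  [/\ forall x, `|u x| <= 1 -> z - x%:C != 0,
      cintegrable leb (fun x => (semicircle x)%:C / (z - x%:C)) &
      cint leb (fun x => (semicircle x)%:C / (z - x%:C)) = (pi * r)%:C * v].
Proof.
move=> v0 zE.
have rn : r%:C != 0 :> R[i] by rewrite eq_complex /= gt_eqF.
have zx x : z - x%:C = (r%:C / (2 * v)) * den x.
  rewrite zE /den /u !(rmorphM, fmorphV, rmorphB) (rmorph_nat _ 2) /=.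
  by field; rewrite v0 rn.
have E : (fun x => (semicircle x)%:C / (z - x%:C)) =
         (fun x => (2 * v / r%:C) * ((semicircle x)%:C / den x)).
  apply/funext => x; rewrite zx invfM invf_div; ring.
have [i c] := cint_semicircle_den.
split.
- move=> x ux; rewrite zx mulf_neq0//.
    by rewrite mulf_neq0 ?rn// invr_neq0// mulf_neq0// pnatr_eq0.
  by rewrite -normc_gt0; apply: lt_le_trans (vk ux).
- by rewrite E; exact: cintegrableZ.
- rewrite E cintZ// c !(rmorphM, fmorphV, rmorphXn) (rmorph_nat _ 2) /=.
  by field.
Qed.

End transform.
End semicircle.

                                                     

Section semicircle_special.
Context (R : realType).
Variables (m r : R).
Hypothesis r0 : 0 < r.
Local Notation leb := (@leb R).
Local Notation s := (semicircle m r).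

Lemma semicircle_neq0 x : s x != 0 -> m - r <= x <= m + r.
Proof. by apply: contraNT => h; apply/eqP/semicircle_out => //; rewrite in_itv. Qed.

Lemma semicircle_supp x : x \in `[m - r, m + r] -> `|(x - m) / r| <= 1.
Proof. by move=> xI; apply: normalized_itv_le1 => //; rewrite inE. Qed.

Lemma rint_semicircle (v z : R) : -1 < v < 0 -> z = m + r / 2 * (v + v^-1) ->
  [/\ forall x, s x != 0 -> z - x != 0,
      rintegrable leb (fun x => s x / (z - x)) &
      rint leb (fun x => s x / (z - x)) = pi * r * v].
Proof.
move=> /andP[v1 v0] zE.
(* For real v < 0 the denominator 1 + v^2 - 2 w v is smallest at w = -1. *)
have vk (w : R) : `|w| <= 1 ->
    (1 + v) ^+ 2 <= normc (1 + v%:C ^+ 2 - 2 * w%:C * v%:C).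
  rewrite ler_norml => /andP[w1 w2].
  have -> : 1 + v%:C ^+ 2 - 2 * w%:C * v%:C = (1 + v ^+ 2 - 2 * w * v)%:C :> R[i].
    by apply: complex_eqP; rewrite /=; ring.
  rewrite normc_real (le_trans _ (ler_norm _))//.
  have : 0 <= (1 + w) * - v by apply: mulr_ge0; lra.
  by rewrite sqrrD expr1n mul1r mulr2n; lra.
have v1' : normc v%:C < 1 by rewrite normc_real ltr0_norm; lra.
have k0 : 0 < (1 + v) ^+ 2 by rewrite exprn_gt0; lra.
have vn0 : v%:C != 0 :> R[i] by rewrite eq_complex /= lt_eqF.
have zE' : z%:C = m%:C + (r / 2)%:C * (v%:C + v%:C^-1).
  by rewrite zE -fmorphV -rmorphD -rmorphM -rmorphD.
have [h1 h2 h3] := cint_semicircle r0 v1' k0 vk vn0 zE'.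
have E : (fun x => (s x)%:C / (z%:C - x%:C)) = (fun x => (s x / (z - x))%:C).
  by apply/funext => x; rewrite rmorphM fmorphV rmorphB.
rewrite E in h2 h3; split.
- move=> x /semicircle_neq0 xI; have /h1 : `|(x - m) / r| <= 1.
    by apply: semicircle_supp; rewrite in_itv.
  by rewrite -rmorphB eq_complex /= eqxx andbT.
- by case: h2.
- by have := h3; rewrite cint_real -rmorphM => /complexI.
Qed.

Lemma cint_semicircle_imag (v z : R[i]) (d : R) : 0 < d < 1 -> v = - d *i ->
  z = m%:C + (r / 2)%:C * (v + v^-1) ->
  [/\ forall x, s x != 0 -> z - x%:C != 0,
      cintegrable leb (fun x => (s x)%:C / (z - x%:C)) &
      cint leb (fun x => (s x)%:C / (z - x%:C)) = (pi * r)%:C * v].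
Proof.
move=> /andP[d0 d1] vE zE.
(* For v = - d i the term 2 w v is imaginary, so the real part of the denominator is 1 - d^2 for
   every w. *)
have vk (w : R) : `|w| <= 1 ->
    1 - d ^+ 2 <= normc (1 + v ^+ 2 - 2 * w%:C * v).
  move=> _; apply: le_trans (ler_norm _) _.
  rewrite (_ : 1 - d ^+ 2 = Re (1 + v ^+ 2 - 2 * w%:C * v)) ?Re_le_normc//.
  by rewrite vE /=; ring.
have v1' : normc v < 1.
  by rewrite vE /= !sqrrN expr0n add0r sqrtr_sqr gtr0_norm.
have k0 : 0 < 1 - d ^+ 2 by rewrite subr_gt0 expr_lt1// ltW.
have vn0 : v != 0 by rewrite vE oppr_eq0 eq_complex /= (gt_eqF d0) andbF.
have [h1 h2 h3] := cint_semicircle r0 v1' k0 vk vn0 zE.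
split=> // x /semicircle_neq0 xI; apply: h1.
by apply: semicircle_supp; rewrite in_itv.
Qed.

End semicircle_special.

(** * Set functions, atoms at 0, and total mass *)

Section set_functions.
Context (R : realType).
Implicit Types (f : R -> R).

(** Agreement with a measure on Borel sets makes [mu] sigma-additive, so it can be packed as a
    measure; that structure also asks for nonnegativity on every set. *)
Lemma rint_meq (mu : set R -> \bar R) (nu : {measure set R -> \bar R}) f :
  (forall B, (0 <= mu B)%E) -> meq mu nu -> rint mu f = rint nu f.
Proof.
move=> mu0 munu.
have mu00 : mu set0 = 0%E by rewrite munu.
have mus : semi_sigma_additive mu.
  move=> F mF tF mUF; rewrite munu//.
  rewrite (_ : (fun n => _) = (fun n => \sum_(0 <= i < n) nu (F i))%E).
    exact: measure_semi_sigma_additive.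
  by apply/funext => n; apply: eq_bigr => i _; exact: munu.
pose M : {measure set R -> \bar R} := HB.pack mu (isMeasure.Build _ R R mu mu00 mu0 mus).
rewrite /rint; congr fine; apply: (@eq_measure_integral _ _ _ _ nu M) => A mA _.
exact: munu.
Qed.

Lemma psi_inv (mu : set R -> \bar R) (zeta : R) : zeta != 0 ->
  psi mu zeta^-1 = rint mu (fun x => x / (zeta - x)).
Proof.
move=> z0; congr rint; apply/funext => x.
rewrite (_ : 1 - zeta^-1 * x = zeta^-1 * (zeta - x)); last by field.
by rewrite invfM invrK mulrA (mulrAC zeta^-1) mulVf ?mul1r.
Qed.

Section atom_density.
Variables (c : R) (k : R -> R).
Hypotheses (c0 : 0 <= c) (k0 : forall x, 0 <= k x).
Hypothesis (mk : measurable_fun [set: R] k).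
Local Notation leb := (@leb R).

(** The common shape of the laws below. Integrands vanishing at 0, such as x/(zeta - x), do not see
    the atom, so its weight never enters their transforms. *)
Definition atom_density : {measure set R -> \bar R} :=
  measure_add (mscale (NngNum c0) \d_(0 : R)) (density leb k0 mk).

Lemma atom_densityE (B : set R) :
  (atom_density B = c%:E * \d_(0%R : R) B + \int[leb]_(x in B) (k x)%:E)%E.
Proof. exact: measure_addE. Qed.

Let ge0_integral_atom_density (f : R -> \bar R) : (forall x, (0 <= f x)%E) ->
  measurable_fun [set: R] f -> f 0 = 0%E ->
  (\int[atom_density]_x f x = \int[density leb k0 mk]_x f x)%E.
Proof.
move=> f0 mf f00; rewrite ge0_integral_measure_add//.
by rewrite ge0_integral_mscale// integral_dirac// diracT mul1e f00 mule0 add0e.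
Qed.

Let integral_atom_density (f : R -> \bar R) : measurable_fun [set: R] f ->
  f 0 = 0%E -> (\int[atom_density]_x f x = \int[density leb k0 mk]_x f x)%E.
Proof.
move=> mf f0; rewrite [LHS]integralE [RHS]integralE !ge0_integral_atom_density//.
- exact: measurable_funeneg.
- by rewrite funenegE f0 oppe0 maxxx.
- exact: measurable_funepos.
- by rewrite funeposE f0 maxxx.
Qed.

Lemma rint_atom_density f : measurable_fun [set: R] f -> f 0 = 0 ->
  rintegrable leb (fun x => f x * k x) ->
  rint atom_density f = rint leb (fun x => f x * k x).
Proof.
move=> mf f0 ifk; rewrite -(rint_density k0 mk mf ifk) /rint; congr fine.
by apply: integral_atom_density; [exact/measurable_EFinP|rewrite f0].
Qed.

Lemma rintegrable_atom_density f : measurable_fun [set: R] f -> f 0 = 0 ->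
  rintegrable leb (fun x => f x * k x) -> rintegrable atom_density f.
Proof.
move=> mf f0 ifk; have /integrableP[mf' fi] := rintegrable_density k0 mk mf ifk.
apply/integrableP; split => //.
rewrite ge0_integral_atom_density//; first exact: measurableT_comp.
by rewrite /= f0 normr0.
Qed.

Lemma cint_atom_density (f : R -> R[i]) : cmeasurable f -> f 0 = 0 ->
  cintegrable leb (fun x => f x * (k x)%:C) ->
  cint atom_density f = cint leb (fun x => f x * (k x)%:C).
Proof.
move=> mf f0 ifk; rewrite -(cint_density k0 mk mf ifk) /cint /rint.
case: mf => mf1 mf2; rewrite !integral_atom_density//.
- exact/measurable_EFinP.
- by rewrite f0.
- exact/measurable_EFinP.
- by rewrite f0.
Qed.

End atom_density.
End set_functions.

Section mass.
Context (R : realType).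
Variable k : R -> R.
Hypotheses (k0 : forall x, 0 <= k x) (mk : measurable_fun [set: R] k).
Hypothesis kneg : forall x, x <= 0 -> k x = 0.
Local Notation leb := (@leb R).

Let g (zeta x : R) := x / (x - zeta) * k x.

Let g_ge0 zeta x : zeta < 0 -> 0 <= g zeta x.
Proof.
move=> z0; have [x0|x0] := ltP 0 x; last by rewrite /g kneg ?mulr0.
by rewrite mulr_ge0// divr_ge0; lra.
Qed.

Let g_mono z1 z2 x : z1 <= z2 -> z2 < 0 -> g z1 x <= g z2 x.
Proof.
move=> z12 z20; have [x0|x0] := ltP 0 x; last by rewrite /g kneg ?mulr0.
by rewrite ler_wpM2r// ler_wpM2l ?(ltW x0)// lef_pV2 ?posrE; lra.
Qed.

Let g_le zeta x : zeta < 0 -> g zeta x <= k x.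
Proof.
move=> z0; have [x0|x0] := ltP 0 x; last by rewrite /g kneg ?mulr0.
by rewrite ler_piMl// ler_pdivrMr; lra.
Qed.

Let mg zeta : measurable_fun [set: R] (g zeta).
Proof.
apply: measurable_funM => //; apply: measurable_funM => //.
by apply: measurable_funV; exact: measurable_funB.
Qed.

                                                                                 
(** For x > 0 the factor x/(x - zeta) increases to 1 as zeta increases to 0, so monotone convergence
    bounds the mass of k by transforms taken arbitrarily close to 0. *)
Lemma mass_le (M : R) :
  (forall e, 0 < e -> exists zeta, [/\ - e < zeta, zeta < 0,
     rintegrable leb (fun x => x / (x - zeta) * k x) &
     rint leb (fun x => x / (x - zeta) * k x) <= M]) ->
  (\int[leb]_x (k x)%:E <= M%:E)%E.
Proof.
move=> H.
have HM n : (\int[leb]_x (g (- n.+1%:R^-1) x)%:E <= M%:E)%E.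
  have e0 : 0 < (n.+1%:R : R)^-1 by rewrite invr_gt0.
  have [zeta [z1 z2 iz zM]] := H _ e0.
  apply: (@le_trans _ _ (\int[leb]_x (g zeta x)%:E)%E).
    apply: ge0_le_integral => //.
    - by move=> x _; rewrite lee_fin g_ge0// oppr_lt0.
    - exact/measurable_EFinP.
- exact/measurable_EFinP.
    - by move=> x _; rewrite lee_fin g_mono// ltW.
  rewrite -(fineK (integrable_fin_num measurableT iz)) lee_fin.
  exact: zM.
have lim x : limn (fun n => (g (- n.+1%:R^-1) x)%:E) = (k x)%:E.
  apply: cvg_lim => //; apply: cvg_EFin; first exact: nearW.
  have [x0|x0] := ltP 0 x; last first.
    rewrite kneg//; apply: cvg_near_cst; apply: nearW => n.
    by rewrite /= /g kneg// mulr0.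
  have -> : (fine \o (fun n => (g (- n.+1%:R^-1) x)%:E)) =
      (fun n => x / (x + harmonic n) * k x).
    by apply/funext => n /=; rewrite /g opprK.
  rewrite -[X in _ --> X]mul1r; apply: cvgMl.
  rewrite -[X in _ --> X](divff (lt0r_neq0 x0)); apply: cvgMr.
  apply: cvgV; first by rewrite gt_eqF.
  rewrite -[X in _ --> X]addr0; apply: cvgD; first exact: cvg_cst.
  exact: cvg_harmonic.
under eq_integral => x _ do rewrite -lim.
have nd n1 n2 x : (n1 <= n2)%N -> g (- n1.+1%:R^-1) x <= g (- n2.+1%:R^-1) x.
  move=> n12; rewrite g_mono ?oppr_lt0 ?invr_gt0// lerN2 lef_pV2 ?posrE//.
  by rewrite ler_nat.
have gn0 n x : 0 <= g (- n.+1%:R^-1) x by rewrite g_ge0// oppr_lt0 invr_gt0.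
rewrite monotone_convergence//.
- apply: lime_le; last by apply: nearW.
  apply: ereal_nondecreasing_is_cvgn => n1 n2 n12.
  apply: ge0_le_integral => //.
  + by move=> x _; rewrite lee_fin.
  + exact/measurable_EFinP.
  + exact/measurable_EFinP.
  + by move=> x _; rewrite lee_fin nd.
- by move=> n; exact/measurable_EFinP.
- by move=> n x _; rewrite lee_fin.
- by move=> x _ n1 n2 n12; rewrite lee_fin nd.
Qed.

Lemma mass_ge (M zeta : R) : zeta < 0 ->
  (\int[leb]_x (k x)%:E <= M%:E)%E ->
  rint leb (fun x => x / (x - zeta) * k x) <= rint leb k.
Proof.
move=> z0 kM.
have ik : rintegrable leb k.
  apply/integrableP; split; first exact/measurable_EFinP.
  under eq_integral do rewrite /= ger0_norm//.
  by apply: le_lt_trans kM _; rewrite ltry.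
apply: rint_le => //.
- by apply: (rintegrable_dom (b := k)) => // [|x]; [exact: mg|rewrite ger0_norm ?g_ge0// g_le].
- by move=> x; exact: g_le.
Qed.

End mass.

(** * Integrals against the Marchenko-Pastur density *)

Section marchenko_pastur.
Context (R : realType).
Variables (th la : R).
Hypotheses (th0 : 0 < th) (la0 : 0 < la).
Local Notation leb := (@leb R).
Let sl := Num.sqrt la.
Let m := th * (1 + la).
Let r := 2 * (th * sl).
Local Notation s := (semicircle m r).

Let sl2 : sl ^+ 2 = la. Proof. by rewrite sqr_sqrtr// ltW. Qed.
Let sl0 : 0 < sl. Proof. by rewrite sqrtr_gt0. Qed.
Let r0 : 0 < r. Proof. by rewrite !mulr_gt0. Qed.

Let thn : th != 0. Proof. by rewrite gt_eqF. Qed.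
Let pin : pi != 0 :> R. Proof. by rewrite gt_eqF ?pi_gt0. Qed.
Let sln : sl != 0. Proof. by rewrite gt_eqF. Qed.

Let amE : am th la = m - r.
Proof. by rewrite /am /m /r -/sl; have := sl2; move: sl => z zz; rewrite -zz; ring. Qed.

Let apE : ap th la = m + r.
Proof. by rewrite /ap /m /r -/sl; have := sl2; move: sl => z zz; rewrite -zz; ring. Qed.

Let am0 : 0 <= am th la.
Proof. by rewrite mulr_ge0 ?sqr_ge0// ltW. Qed.

Lemma kMPE x : kMP th la x = s x / (2 * pi * th * x).
Proof.
rewrite /kMP; case: ifPn => [_|h].
  rewrite apE amE /semicircle; congr (Num.sqrt _ / _); ring.
have sx : s x = 0.
  apply/eqP; rewrite sqrtr_eq0.
  have -> : r ^+ 2 - (x - m) ^+ 2 = (ap th la - x) * (x - am th la) by rewrite apE amE; ring.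
  move: h; rewrite negb_and -!leNgt => /orP[h|h].
    have : am th la <= ap th la by rewrite apE amE; move: r0; lra.
    by move=> h'; apply: mulr_ge0_le0; lra.
  have : am th la <= ap th la by rewrite apE amE; move: r0; lra.
  by move=> h'; apply: mulr_le0_ge0; lra.
by rewrite sx mul0r.
Qed.

Lemma kMP_neg x : x <= 0 -> kMP th la x = 0.
Proof. by move=> x0; rewrite /kMP ltNge (le_trans x0 am0). Qed.

Lemma kMP_ge0 x : 0 <= kMP th la x.
Proof.
have [x0|x0] := ltP 0 x; last by rewrite kMP_neg.
by rewrite kMPE divr_ge0 ?semicircle_ge0// !mulr_ge0 ?pi_ge0// ltW.
Qed.

Lemma measurable_kMP : measurable_fun [set: R] (kMP th la).
Proof.
rewrite (_ : kMP th la = fun x => s x * (2 * pi * th * x)^-1); last first.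
  by apply/funext => x; rewrite kMPE.
apply: measurable_funM; first exact: measurable_semicircle.
by apply: measurable_funV; exact: measurable_funM.
Qed.

Let s0 : s 0 = 0.
Proof.
apply/eqP; rewrite sqrtr_eq0 /r /m.
have -> : (2 * (th * sl)) ^+ 2 - (0 - th * (1 + la)) ^+ 2 = - (th ^+ 2 * (1 - la) ^+ 2).
  by have := sl2; move: sl => z zz; rewrite -zz; ring.
by rewrite oppr_le0 mulr_ge0 ?sqr_ge0.
Qed.

(** Valid at x = 0 too: the semicircle vanishes there because m^2 - r^2 = th^2 (1 - la)^2 >= 0. *)
Lemma mul_kMP x : x * kMP th la x = (2 * pi * th)^-1 * s x.
Proof.
have [->|x0] := eqVneq x 0; first by rewrite mul0r s0 mulr0.
by rewrite kMPE; move: pin; move: (@pi R) => P pn; field; do ?(apply/andP; split).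
Qed.

(** With v = y / sqrt la the point zeta is m + (r/2)(v + 1/v), and by [mul_kMP] the integral is that
    of the semicircle. The two bounds on y give y^2 < la, that is |v| < 1. *)
Lemma MP_transform_real y (zeta := th * (la + y) * (1 + y) / y) :
  -1 < y < 0 -> - la < y ->
  [/\ zeta < 0, rintegrable leb (fun x => x / (zeta - x) * kMP th la x) &
      rint leb (fun x => x / (zeta - x) * kMP th la x) = y].
Proof.
move=> /andP[y1 y0] yla.
have w1 : -1 < y / sl < 0.
  rewrite ltr_pdivlMr// pmulr_llt0 ?invr_gt0// y0 andbT mulN1r ltrNl.
  rewrite -[- y]gtr0_norm ?oppr_gt0// -sqrtr_sqr ltr_sqrt// sqrrN.
  by nra.
have zE : zeta = m + r / 2 * (y / sl + (y / sl)^-1).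
  have yn : y != 0 by rewrite lt_eqF.
  rewrite /zeta /m /r; have := sl2; have := sln; move: sl => z z0 <-.
  by field; do ?(apply/andP; split).
have [_ i e] := rint_semicircle r0 w1 zE.
have E : (fun x => x / (zeta - x) * kMP th la x) =
    (fun x => (2 * pi * th)^-1 * (s x / (zeta - x))).
  by apply/funext => x; rewrite mulrAC mul_kMP mulrA.
split.
- rewrite /zeta pmulr_rlt0 ?invr_lt0// !mulr_gt0//; lra.
- by rewrite E; exact: rintegrableZ.
- rewrite E rintZ// e /r; have := sln; have := pin; move: sl (@pi R) => z P pn z0.
  by field; do ?(apply/andP; split).
Qed.

Lemma MP_transform_imag (d : R) (Y : R[i] := - d *i)
    (zeta := th%:C * (la%:C + Y) * (1 + Y) / Y) : 0 < d < Num.sqrt la ->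
  [/\ forall x, kMP th la x != 0 -> zeta - x%:C != 0,
      cintegrable leb (fun x => x%:C / (zeta - x%:C) * (kMP th la x)%:C) &
      cint leb (fun x => x%:C / (zeta - x%:C) * (kMP th la x)%:C) = Y].
Proof.
move=> /andP[d0 dsl].
have w1 : 0 < d / sl < 1 by rewrite divr_gt0//= ltr_pdivrMr// mul1r.
have slC : sl%:C != 0 :> R[i] by rewrite eq_complex /= gt_eqF.
have YC : Y != 0 by rewrite /Y oppr_eq0 eq_complex /= (gt_eqF d0) andbF.
have zE : zeta = m%:C + (r / 2)%:C * (Y / sl%:C + (Y / sl%:C)^-1).
  rewrite /zeta /m (_ : r / 2 = th * sl); last by rewrite /r; field.
  rewrite -sl2 !(rmorphM, rmorphD, rmorphXn) rmorph1.
  by field; do ?(apply/andP; split).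
have Yd : Y / sl%:C = - (d / sl) *i.
  by rewrite -fmorphV /Y; apply: complex_eqP => /=; ring.
have [h i e] := cint_semicircle_imag r0 w1 Yd zE.
have E : (fun x => x%:C / (zeta - x%:C) * (kMP th la x)%:C) =
    (fun x => ((2 * pi * th)^-1)%:C * ((s x)%:C / (zeta - x%:C))).
  by apply/funext => x; rewrite mulrAC -rmorphM mul_kMP rmorphM mulrA.
split.
- move=> x kx; apply: h; apply: contraNneq kx.
  by rewrite kMPE => ->; rewrite mul0r.
- by rewrite E; exact: cintegrableZ.
- rewrite E cintZ// e mulrA -rmorphM (_ : (2 * pi * th)^-1 * (pi * r) = sl).
    by rewrite mulrC divfK.
  by rewrite /r; move: pin; move: (@pi R) => P pn; field; do ?(apply/andP; split).
Qed.

End marchenko_pastur.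

(** * Injectivity of psi and uniqueness of S-transform values *)

Section S_transform_uniqueness.
Context (R : realType).

(** Lets the injectivity argument apply to plain set functions such as [MP] and [minv] of it,
    through a genuine measure with the same integrals. *)
Definition psi_regular (mu : set R -> \bar R) := exists m : {measure set R -> \bar R},
  [/\ forall f : R -> R, rint mu f = rint m f, m [set x | x < 0] = 0%E &
      forall z, z < 0 -> rintegrable m (fun x => z * x / (1 - z * x))].

Lemma measurable_lt0 : measurable [set x : R | x < 0].
Proof.
rewrite (_ : [set _ | _] = `]-oo, 0[%classic); first exact: measurable_itv.
by apply/seteqP; split => x /=; rewrite in_itv.
Qed.

Lemma measurable_psi_kernel (z : R) :
  measurable_fun [set: R] (fun x => z * x / (1 - z * x)).
Proof.
apply: measurable_funM; first exact: measurable_funM.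
by apply/measurable_funV/measurable_funB => //; exact: measurable_funM.
Qed.

(** For z1 < z2 < 0 and x >= 0 the kernel at z2 dominates the one at z1, strictly unless x = 0.
    Equal integrals thus force all mass to sit at 0, where the kernel vanishes. *)
Let psi_lt_neq0 mu (z1 z2 : R) : psi_regular mu -> z1 < z2 -> z2 < 0 ->
  psi mu z1 = psi mu z2 -> psi mu z1 = 0.
Proof.
move=> [m [mE m0 im]] z12 z20; have z10 := lt_trans z12 z20.
rewrite /psi !mE => e12.
pose f z (x : R) := z * x / (1 - z * x).
have ae0 : {ae m, forall x, 0 <= x}.
  exists [set x | x < 0]; split => //; first exact: measurable_lt0.
  by move=> x /= /negP; rewrite -ltNge.
have d0 : (\int[m]_x (f z2 x - f z1 x)%:E = 0)%E.
  rewrite -(fineK (integrable_fin_num measurableT (rintegrableB (im _ z20) (im _ z10)))).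
  by congr EFin; have := rintB (im _ z20) (im _ z10); rewrite e12 subrr.
have fE x : 0 <= x -> f z2 x - f z1 x = (z2 - z1) * x / ((1 - z1 * x) * (1 - z2 * x)).
  move=> x0; have : 0 < 1 - z1 * x by nra.
  have : 0 < 1 - z2 * x by nra.
  by rewrite /f => /lt0r_neq0 h1 /lt0r_neq0 h2; field; do ?(apply/andP; split).
have f0 x : 0 <= x -> 0 <= f z2 x - f z1 x.
  by move=> x0; rewrite fE//; apply: divr_ge0; [|apply: mulr_ge0]; nra.
have mf z : measurable_fun [set: R] (f z) by exact: measurable_psi_kernel.
have mD : measurable_fun [set: R] (EFin \o (fun x => f z2 x - f z1 x)).
  by apply/measurable_EFinP; exact: measurable_funB.
have /ae_eq_integral_abs D0 : (\int[m]_x `| (f z2 x - f z1 x)%:E | = 0)%E.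
  rewrite -d0; apply: ae_eq_integral => //; first exact: measurableT_comp.
  by apply: filterS ae0 => x x0 _ /=; rewrite ger0_norm// f0.
have {}D0 := D0 measurableT mD.
suff -> : rint m (f z1) = rint m (fun=> 0) by rewrite /rint integral0.
rewrite /rint; congr fine; apply: ae_eq_integral => //.
- exact/measurable_EFinP.
- apply: filterS2 ae0 D0 => x x0 + _ => /(_ I) [] /=; rewrite fE//.
  have h1 : 0 < 1 - z1 * x by nra.
  have h2 : 0 < 1 - z2 * x by nra.
  move=> /eqP; rewrite mulf_eq0 invr_eq0 !mulf_eq0 (gt_eqF h1) (gt_eqF h2) !orbF.
  rewrite subr_eq0 (gt_eqF z12)/= => /eqP ->.
  by rewrite /f mulr0 mul0r.
Qed.

Lemma psi_inj mu (z1 z2 : R) : psi_regular mu -> z1 < 0 -> z2 < 0 ->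
  psi mu z1 = psi mu z2 -> psi mu z1 != 0 -> z1 = z2.
Proof.
move=> rmu z10 z20 e n0; have [z12|z21|//] := ltgtP z1 z2.
- by rewrite (psi_lt_neq0 rmu z12 z20 e) eqxx in n0.
- by rewrite e (psi_lt_neq0 rmu z21 z10 (esym e)) eqxx in n0.
Qed.

Lemma S_at_unique mu (y s1 s2 : R) : psi_regular mu -> y != 0 ->
  S_at mu y s1 -> S_at mu y s2 -> s1 = s2.
Proof.
move=> rmu y0 [z1 [z10 [e1 ->]]] [z2 [z20 [e2 ->]]].
by rewrite (psi_inj rmu z10 z20) ?e1 ?e2.
Qed.

Lemma psi_kernel_le1 (z x : R) : z < 0 -> 0 <= x -> `|z * x / (1 - z * x)| <= 1.
Proof.
move=> z0 x0; have h : 0 < 1 - z * x by nra.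
by rewrite normrM normfV (gtr0_norm h) ler_pdivrMr// mul1r ler0_norm; nra.
Qed.

Lemma rintegrable_psi_kernel (mu : {measure set R -> \bar R}) (z : R) :
  mu [set: R] = 1%E -> mu [set x | x < 0] = 0%E -> z < 0 ->
  rintegrable mu (fun x => z * x / (1 - z * x)).
Proof.
move=> mu1 mun z0.
pose f (x : R) := z * x / (1 - z * x).
pose g (x : R) := z * Num.max x 0 / (1 - z * Num.max x 0).
have mm : measurable_fun [set: R] (fun x : R => Num.max x 0) by exact: measurable_maxr.
have mg : measurable_fun [set: R] g.
  apply: measurable_funM; first exact: measurable_funM.
  by apply/measurable_funV/measurable_funB => //; exact: measurable_funM.
have ig : rintegrable mu g.
  apply: (rintegrable_dom (b := fun=> 1)) => //; first exact: rintegrable_cst.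
  by move=> x; apply: psi_kernel_le1 => //; rewrite le_max lexx orbT.
have mf : measurable_fun [set: R] f by exact: measurable_psi_kernel.
apply/integrableP; split; first exact/measurable_EFinP.
have /integrableP[mg' +] := ig.
rewrite (_ : (\int[mu]_x `|(EFin \o g) x| = \int[mu]_x `|(EFin \o f) x|)%E)//.
apply: ae_eq_integral => //; try by apply: measurableT_comp => //; exact/measurable_EFinP.
exists [set x | x < 0]; split => //; first exact: measurable_lt0.
move=> x /= /not_implyP[_] H; rewrite ltNge; apply/negP => x0; apply: H.
by rewrite /g max_l.
Qed.

Lemma psi_regular_probability (mu : {measure set R -> \bar R}) :
  mu [set: R] = 1%E -> mu [set x | x < 0] = 0%E -> psi_regular mu.
Proof.
by move=> mu1 mun; exists mu; split => // z z0; exact: rintegrable_psi_kernel.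
Qed.

Lemma S_at_psi (mu : set R -> \bar R) (y zeta : R) : zeta < 0 ->
  rint mu (fun x => x / (zeta - x)) = y -> S_at mu y (zeta^-1 * (1 + y) / y).
Proof.
move=> z0 e; exists zeta^-1; rewrite invr_lt0; split => //; split => //.
by rewrite psi_inv// lt_eqF.
Qed.

End S_transform_uniqueness.

(** * Marchenko-Pastur laws and their images under inversion *)

Section MP_transforms.
Context (R : realType).
Variables (th la : R).
Hypotheses (th0 : 0 < th) (la0 : 0 < la).
Local Notation leb := (@leb R).
Local Notation k := (kMP th la).

Let k0 := kMP_ge0 th0 la0.
Let mk := measurable_kMP th0 la0.

Let atom0_ge0 : 0 <= atom0 la.
Proof. by rewrite le_max lexx. Qed.

Definition MP_measure : {measure set R -> \bar R} := atom_density atom0_ge0 k0 mk.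

Lemma MP_meq : meq (MP th la) MP_measure.
Proof.
move=> B mB; rewrite /MP_measure atom_densityE /MP integral_lebE//.
by apply: measurable_funTS; exact/measurable_EFinP.
Qed.

Lemma MP_ge0 B : (0 <= MP th la B)%E.
Proof.
rewrite adde_ge0 ?mule_ge0 ?lee_fin//.
by apply: integral_ge0 => x _; rewrite lee_fin k0.
Qed.

Lemma rint_MP f : rint (MP th la) f = rint MP_measure f.
Proof. by apply: rint_meq; [exact: MP_ge0|exact: MP_meq]. Qed.

Let mx (zeta : R) : measurable_fun [set: R] (fun x => x / (zeta - x)).
Proof. by apply: measurable_funM => //; apply: measurable_funV; exact: measurable_funB. Qed.

Lemma MP_psi y (zeta := th * (la + y) * (1 + y) / y) : -1 < y < 0 -> - la < y ->
  rint (MP th la) (fun x => x / (zeta - x)) = y.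
Proof.
move=> y1 y2; have [z0 i e] := MP_transform_real th0 la0 y1 y2.
by rewrite rint_MP rint_atom_density// mul0r.
Qed.

Lemma MP_measure_neg : MP_measure [set x | x < 0] = 0%E.
Proof.
rewrite atom_densityE integral0_eq ?adde0.
  by rewrite diracE memNset ?mule0//= ltxx.
by move=> x /= x0; rewrite kMP_neg// ltW.
Qed.

(** As y decreases to -1, zeta tends to 0 and the integral of x/(x - zeta) k(x) is -y, which tends
    to 1; [mass_le] and [mass_ge] give the two inequalities. The value y may approach -1 because la
    >= 1. *)
Lemma rint_kMP : 1 <= la -> rintegrable leb k /\ rint leb k = 1.
Proof.
move=> la1.
have E z : (fun x => x / (x - z) * k x) = (fun x => -1 * (x / (z - x) * k x)).
  by apply/funext => x; rewrite -[x - z]opprB invrN; ring.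
have kneg x : x <= 0 -> k x = 0 by move=> x0; rewrite kMP_neg.
have T (y : R) (z := th * (la + y) * (1 + y) / y) : -1 < y < 0 ->
    [/\ z < 0, rintegrable leb (fun x => x / (x - z) * k x) &
        rint leb (fun x => x / (x - z) * k x) = - y].
  move=> y1; have [|h1 h2 h3] := MP_transform_real th0 la0 y1.
    by case/andP: y1; lra.
  split => //; first by rewrite E; exact: rintegrableZ.
  by rewrite E rintZ// h3 mulN1r.
have M1 : (\int[leb]_x (k x)%:E <= 1%:E)%E.
  apply: mass_le => // e e0.
  (* At y = -1 + d, |zeta| is at most th la d / (1 - d), hence at most e/2. *)
  pose d := Num.min 2^-1 (e / (4 * (th * la))).
  have tl : 0 < 4 * (th * la) by rewrite !mulr_gt0.
  have d0 : 0 < d by rewrite lt_min invr_gt0 ltr0n divr_gt0.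
  have d2 : d <= 2^-1 by rewrite ge_min lexx.
  have de : d * (4 * (th * la)) <= e by rewrite -ler_pdivlMr// ge_min lexx orbT.
  have y1 : -1 < -1 + d < 0 by lra.
  have [z0 i r] := T _ y1.
  exists (th * (la + (-1 + d)) * (1 + (-1 + d)) / (-1 + d)); split => //; last first.
    by rewrite r; lra.
  rewrite ltrNl -mulrN -invrN ltr_pdivrMr; last by lra.
  apply: (@le_lt_trans _ _ (th * la * d)).
    rewrite (_ : 1 + (-1 + d) = d); last by ring.
    by rewrite ler_wpM2r ?ler_wpM2l ?(ltW d0) ?(ltW th0)//; lra.
  have : e / 2 <= e * - (-1 + d) by rewrite ler_wpM2l ?(ltW e0)//; lra.
  by apply: lt_le_trans; move: de; rewrite (_ : d * _ = 4 * (th * la * d)); [lra|ring].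
have ik : rintegrable leb k.
  apply/integrableP; split; first exact/measurable_EFinP.
  under eq_integral do rewrite /= ger0_norm ?k0//.
  by apply: le_lt_trans M1 _; rewrite ltry.
split=> //; apply/eqP; rewrite eq_le; apply/andP; split.
  by rewrite -lee_fin /rint fineK ?(integrable_fin_num measurableT ik).
apply/ler_addgt0Pr => e e0.
pose d := Num.min 2^-1 e.
have d0 : 0 < d by rewrite lt_min invr_gt0 ltr0n.
have d2 : d <= 2^-1 by rewrite ge_min lexx.
have de : d <= e by rewrite ge_min lexx orbT.
have y1 : -1 < -1 + d < 0 by lra.
have [z0 i r] := T _ y1.
by have := mass_ge k0 mk kneg z0 M1; rewrite r; lra.
Qed.

(** The psi kernel times k is dominated by -z x k(x), a multiple of the semicircle; this also covers
    la < 1, where the mass of k has not been computed. *)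
Lemma psi_regular_MP : psi_regular (MP th la).
Proof.
exists MP_measure; split; [exact: rint_MP|exact: MP_measure_neg|] => z z0.
apply: rintegrable_atom_density; first exact: measurable_psi_kernel.
  by rewrite mulr0 mul0r.
pose m := th * (1 + la); pose r := 2 * (th * Num.sqrt la).
have r0 : 0 < r by rewrite !mulr_gt0// sqrtr_gt0.
have is_ : rintegrable leb (semicircle m r).
  have [|[+ _] _] := @semicircle_dominated R m r r0 (fun=> 1) r (cmeasurable_cst _ _).
    move=> x ux; rewrite Normc.normc1 mulr1 /semicircle -[leRHS]gtr0_norm//.
    by rewrite -sqrtr_sqr ler_wsqrtr// gerBl sqr_ge0.
  by congr (rintegrable leb _); apply/funext => x /=; rewrite mulr1 mulr0 subr0.
apply: (rintegrable_dom (b := fun x => - z * ((2 * pi * th)^-1 * semicircle m r x))).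
- by apply: measurable_funM => //; exact: measurable_psi_kernel.
- by do 2 apply: rintegrableZ.
move=> x; rewrite -(mul_kMP th0 la0) mulrA.
have [x0|x0] := ltP 0 x; last by rewrite kMP_neg// !mulr0 normr0.
rewrite normrM (ger0_norm (k0 x)) ler_wpM2r//.
have h : 1 <= 1 - z * x by nra.
have h' : 0 < 1 - z * x by lra.
rewrite normrM normfV (gtr0_norm h') ler_pdivrMr// ler0_norm; nra.
Qed.

End MP_transforms.

Section pushforwards.
Context (R : realType).

(** [dil] and [minv] are defined by direct images; for a bijection these are preimages under the
    inverse, so both are push-forwards. *)
Lemma image_meq_pushforward (mu : set R -> \bar R) (m : {measure set R -> \bar R})
    (f g : R -> R) : cancel f g -> cancel g f -> measurable_fun [set: R] g ->
  meq mu m -> exists M : {measure set R -> \bar R},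
  [/\ meq (fun B => mu (f @` B)) M,
      M [set: R] = m [set: R], M [set x | x < 0] = m [set x | g x < 0],
      forall h, measurable_fun [set: R] h -> rintegrable m (fun x => h (g x)) ->
        rintegrable M h &
      forall h, measurable_fun [set: R] h -> rintegrable m (fun x => h (g x)) ->
        rint M h = rint m (fun x => h (g x))].
Proof.
move=> fK gK mg mum.
exists (measure_function_pushforward__canonical__measure_function_Measure m mg).
have imE B : f @` B = g @^-1` B.
  apply/seteqP; split => x /=; first by move=> [y By <-]; rewrite fK.
  by move=> Bx; exists (g x) => //; rewrite gK.
split => //.
- move=> B mB; rewrite imE mum//.
  by rewrite -[X in measurable X]setTI; exact: mg.
- move=> h mh ih.
  have mEh : measurable_fun [set: R] (EFin \o h) by exact/measurable_EFinP.
  exact: (@integrable_pushforward _ _ _ _ _ _ mg m setT _ mEh ih).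
- move=> h mh ih; rewrite /rint integral_pushforward//.
    exact/measurable_EFinP.
Qed.

Variables (th la : R).
Hypotheses (th0 : 0 < th) (la1 : 1 < la).
Let la0 : 0 < la. Proof. exact: lt_trans la1. Qed.
Local Notation leb := (@leb R).
Local Notation k := (kMP th la).
Local Notation m := (MP_measure th0 la0).

Lemma measurable_invr : measurable_fun [set: R] (@GRing.inv R).
Proof. exact: (@measurable_funV _ _ R id). Qed.

Let ik : rintegrable leb k. Proof. by have [] := rint_kMP th0 la0 (ltW la1). Qed.

(** Inversion of x and z sends the kernel x/(z - x) to -1 minus itself; this is why y becomes -1 - y
    under [minv]. *)
Let inv_kernelE (z x : R) : z < 0 ->
  x^-1 / (z^-1 - x^-1) * k x = - k x - x / (z - x) * k x.
Proof.
move=> z0; have [x0|x0] := ltP 0 x; last by rewrite kMP_neg// !(mulr0, oppr0, addr0).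
have zn : z != 0 by rewrite lt_eqF.
have xn : x != 0 by rewrite gt_eqF.
have zx : z - x != 0 by rewrite lt_eqF//; lra.
have -> : z^-1 - x^-1 = (x - z) / (z * x) by field; do ?(apply/andP; split).
have xz : x - z != 0 by rewrite gt_eqF//; lra.
by field; do ?(apply/andP; split).
Qed.

Let inv_kernel_le (z x : R) : z < 0 -> `|x^-1 / (z^-1 - x^-1) * k x| <= k x.
Proof.
move=> z0; have [x0|x0] := ltP 0 x; last by rewrite kMP_neg// mulr0 normr0.
have xn : x != 0 by rewrite gt_eqF.
have zi : z^-1 < 0 by rewrite invr_lt0.
have xi : 0 < x^-1 by rewrite invr_gt0.
rewrite normrM (ger0_norm (kMP_ge0 th0 la0 _)) ler_piMl ?kMP_ge0//.
rewrite normrM (gtr0_norm xi) normfV ltr0_norm; last by lra.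
by rewrite ler_pdivrMr; lra.
Qed.

Let mz (z : R) : measurable_fun [set: R] (fun x => x / (z - x)).
Proof. by apply: measurable_funM => //; apply: measurable_funV; exact: measurable_funB. Qed.

Let mzi (z : R) : measurable_fun [set: R] (fun x => x^-1 / (z - x^-1)).
Proof. by apply: (measurableT_comp (mz z)); exact: measurable_invr. Qed.

Let ikz (z : R) : z < 0 -> rintegrable leb (fun x => x^-1 / (z^-1 - x^-1) * k x).
Proof.
move=> z0; apply: (rintegrable_dom (b := k)) => //; last by move=> x; exact: inv_kernel_le.
by apply: measurable_funM; [exact: mzi|exact: measurable_kMP].
Qed.

Lemma minv_MP : exists M : {measure set R -> \bar R},
  [/\ forall f : R -> R, rint (minv (MP th la)) f = rint M f,
      M [set x | x < 0] = 0%E,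
      (forall z, z < 0 -> rintegrable M (fun x => x / (z - x))) &
      forall z, z < 0 -> rint M (fun x => x / (z - x)) =
        rint leb (fun x => x^-1 / (z - x^-1) * k x)].
Proof.
have [M [ME _ Mneg Mi Mr]] := image_meq_pushforward (@invrK R) (@invrK R)
  measurable_invr (MP_meq th0 la0).
have i z : z < 0 -> rintegrable leb (fun x => x^-1 / (z - x^-1) * k x).
  by move=> z0; rewrite -[z]invrK; apply: ikz; rewrite invr_lt0.
exists M; split.
- by move=> f; apply: rint_meq => // B; exact: MP_ge0.
- rewrite Mneg -(MP_measure_neg th0 la0); congr (m _).
  by apply/seteqP; split => x /=; rewrite invr_lt0.
- move=> z z0; apply: Mi => //; apply: rintegrable_atom_density => //.
  + by rewrite invr0 mul0r.
  + exact: i.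
- move=> z z0; rewrite Mr//.
  + rewrite rint_atom_density//; [by rewrite invr0 mul0r|exact: i].
  + apply: rintegrable_atom_density => //; [by rewrite invr0 mul0r|exact: i].
Qed.

(** The Marchenko-Pastur transform taken at -1 - y, combined with the total mass 1 of k for la >
    1. *)
Lemma minv_MP_psi y (z := th * y * (la - 1 - y) / (1 + y)) :
  -1 < y < 0 -> z < 0 /\ rint (minv (MP th la)) (fun x => x / (z^-1 - x)) = y.
Proof.
move=> /andP[y1 y0].
have z0 : z < 0.
  have : 0 < th * - y * (la - 1 - y) / (1 + y).
    by rewrite divr_gt0 ?mulr_gt0 ?oppr_gt0//; move: la1; lra.
  by rewrite /z mulrN !mulNr oppr_gt0.
split=> //.
have [M [ME _ _ Mr]] := minv_MP.
rewrite ME Mr ?invr_lt0//.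
have y1' : -1 < -1 - y < 0 by lra.
have [|_ i e] := MP_transform_real th0 la0 y1'; first by move: la1; lra.
have zE : th * (la + (-1 - y)) * (1 + (-1 - y)) / (-1 - y) = z.
  have yn : 1 + y != 0 by rewrite gt_eqF//; lra.
  have yn' : -1 - y != 0 by rewrite lt_eqF//; lra.
  by rewrite /z; field; do ?(apply/andP; split).
rewrite zE in i e.
rewrite (_ : (fun x => _) = fun x => -1 * k x - x / (z - x) * k x); last first.
  by apply/funext => x; rewrite inv_kernelE// mulN1r.
rewrite rintB//; last exact: rintegrableZ.
by rewrite rintZ// (rint_kMP th0 la0 (ltW la1)).2 e; ring.
Qed.

Lemma psi_regular_minv_MP : psi_regular (minv (MP th la)).
Proof.
have [M [ME M0 Mi _]] := minv_MP; exists M; split => // z z0.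
have zi : z^-1 < 0 by rewrite invr_lt0.
have := Mi _ zi; congr (rintegrable M _); apply/funext => x.
have zn : z != 0 by rewrite lt_eqF.
have -> : 1 - z * x = z * (z^-1 - x) by field.
by rewrite [in RHS]invfM mulrA (mulrAC z) mulfV ?mul1r.
Qed.

Lemma S_at_minv_MP y : -1 < y < 0 -> S_at (minv (MP th la)) y (th * (la - 1 - y)).
Proof.
move=> y1; have [z0 e] := minv_MP_psi y1.
have zi : (th * y * (la - 1 - y) / (1 + y))^-1 < 0 by rewrite invr_lt0.
have := S_at_psi zi e; rewrite invrK; case/andP: y1 => y1 y0.
have yn : 1 + y != 0 by rewrite gt_eqF//; lra.
have yn' : y != 0 by rewrite lt_eqF.
by congr S_at; field; do ?(apply/andP; split).
Qed.

End pushforwards.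

Lemma S_at_MP (R : realType) (th la y : R) : 0 < th -> 0 < la ->
  -1 < y < 0 -> - la < y -> S_at (MP th la) y (th * (la + y))^-1.
Proof.
move=> th0 la0 y1 y2.
have [z0 _ _] := MP_transform_real th0 la0 y1 y2.
have := S_at_psi z0 (MP_psi th0 la0 y1 y2).
case/andP: y1 => y1 y0.
have h1 : 1 + y != 0 by rewrite gt_eqF//; lra.
have h2 : y != 0 by rewrite lt_eqF.
have h3 : la + y != 0 by rewrite gt_eqF//; lra.
have h4 : th != 0 by rewrite gt_eqF.
by congr S_at; field; do ?(apply/andP; split).
Qed.

                                     

(** * An explicit density for mu_{t,th,la} *)

Section free_beta_prime.
Context (R : realType).
Variables (t th la : R).
Hypotheses (t0 : 0 < t) (th0 : 0 < th) (la1 : 1 <= la).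
Local Notation leb := (@leb R).

Let la0 : 0 < la. Proof. exact: lt_le_trans la1. Qed.
Let m := th + t + th * la.
Let rho := Num.sqrt (th * la * (th + t)).
Let r := 2 * rho.
Let p := (la - 1) * t.
Local Notation s := (semicircle m r).

Let p0 : 0 <= p. Proof. by rewrite mulr_ge0 ?subr_ge0// ltW. Qed.
Let rho2 : rho ^+ 2 = th * la * (th + t).
Proof. by rewrite sqr_sqrtr// !mulr_ge0 ?addr_ge0 ?(ltW th0) ?(ltW la0) ?(ltW t0). Qed.
Let rho0 : 0 < rho. Proof. by rewrite sqrtr_gt0 !mulr_gt0// addr_gt0. Qed.
Let r0 : 0 < r. Proof. exact: mulr_gt0. Qed.
Let m0 : 0 < m. Proof. by rewrite !addr_gt0// mulr_gt0. Qed.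

Let s_neg x : x <= 0 -> s x = 0.
Proof.
move=> x0; apply/eqP; rewrite sqrtr_eq0.
have -> : r ^+ 2 - (x - m) ^+ 2 = - (th + t - th * la) ^+ 2 - x * (x - 2 * m).
  by rewrite /r exprMn rho2 /m; ring.
have : 0 <= x * (x - 2 * m) by rewrite mulr_le0//; move: m0; lra.
have := sqr_ge0 (th + t - th * la); lra.
Qed.

Let s_pos x : s x != 0 -> 0 < x.
Proof. by move=> sx; rewrite ltNge; apply: contra sx => x0; rewrite s_neg. Qed.

(** The density of a free beta prime law, up to scaling and shift of parameters; the semicircle is
    supported in [0, +oo) since m^2 - r^2 = (th + t - th la)^2. *)
Definition beta_prime_density x : R := t * s x / (2 * pi * th * x * (x + p)).
Local Notation k := beta_prime_density.

Lemma beta_prime_density_neg x : x <= 0 -> k x = 0.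
Proof. by move=> x0; rewrite /k s_neg// mulr0 mul0r. Qed.

Lemma beta_prime_density_ge0 x : 0 <= k x.
Proof.
have [x0|x0] := ltP 0 x; last by rewrite beta_prime_density_neg.
rewrite divr_ge0 ?mulr_ge0 ?semicircle_ge0 ?(ltW t0) ?(ltW th0) ?(ltW x0) ?pi_ge0//.
by rewrite addr_ge0 ?(ltW x0).
Qed.

Lemma measurable_beta_prime_density : measurable_fun [set: R] k.
Proof.
rewrite (_ : k = fun x => t * s x * (2 * pi * th * x * (x + p))^-1)//.
apply: measurable_funM; first by apply: measurable_funM => //; exact: measurable_semicircle.
by apply: measurable_funV; apply: measurable_funM; [exact: measurable_funM|exact: measurable_funD].
Qed.

(** The pole -p of the density is the Joukowski image of v = - th / rho, so the semicircle transform
    is explicit there too. This includes la = 1, where p = 0. *)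
Let pole : [/\ forall x, s x != 0 -> - p - x != 0,
  rintegrable leb (fun x => s x / (- p - x)) &
  rint leb (fun x => s x / (- p - x)) = - (2 * pi * th)].
Proof.
have v1 : -1 < - th / rho < 0.
  rewrite mulNr ltrN2 oppr_lt0 divr_gt0// andbT ltr_pdivrMr// mul1r.
  rewrite -[th]gtr0_norm// -sqrtr_sqr ltr_sqrt; last by rewrite !mulr_gt0 ?addr_gt0.
  rewrite expr2 -mulrA ltr_pM2l//.
  by have := t0; have := la1; have := th0; nra.
have zE : - p = m + r / 2 * (- th / rho + (- th / rho)^-1).
  rewrite /p /m /r; have := rho2; have := rho0; move: rho => z z0 zz.
  have zn : z != 0 by rewrite gt_eqF.
  have thn : th != 0 by rewrite gt_eqF.
  have -> : 2 * z / 2 * (- th / z + (- th / z)^-1) = - th - z ^+ 2 / th.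
    by field; do ?(apply/andP; split).
  by rewrite zz; field.
have [h i e] := rint_semicircle r0 v1 zE.
split=> //; rewrite e /r; have := rho0; move: rho (@pi R) => z P z0.
by field; rewrite gt_eqF.
Qed.

(** Partial fractions in x with poles zeta and -p. *)
Let kernelE (zeta : R[i]) x : (s x != 0 -> zeta - x%:C != 0) -> zeta + p%:C != 0 ->
  x%:C / (zeta - x%:C) * (k x)%:C =
  (t / (2 * pi * th))%:C / (zeta + p%:C) * ((s x)%:C / (zeta - x%:C) - (s x / (- p - x))%:C).
Proof.
move=> zx zp; have [sx|sx] := eqVneq (s x) 0.
  by rewrite /k sx !(mulr0, mul0r, subr0).
have x0 := s_pos sx; have {}zx := zx sx.
have xp : - p - x != 0 by rewrite lt_eqF//; move: p0; lra.
have px : x%:C + p%:C != 0 :> R[i].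
  by rewrite -rmorphD eq_complex /= eqxx andbT gt_eqF//; move: p0; lra.
have xn : x%:C != 0 :> R[i] by rewrite eq_complex /= eqxx andbT gt_eqF.
have thn : th%:C != 0 :> R[i] by rewrite eq_complex /= eqxx andbT gt_eqF.
have pin : (@pi R)%:C != 0 :> R[i] by rewrite eq_complex /= eqxx andbT gt_eqF// pi_gt0.
have xp' : - p%:C - x%:C != 0 :> R[i] by rewrite -opprD oppr_eq0 addrC.
have e1 : (x + p)%:C = x%:C + p%:C :> R[i] by rewrite rmorphD.
have e2 : (- p - x)%:C = - p%:C - x%:C :> R[i] by rewrite rmorphB rmorphN.
have two := rmorph_nat (real_complex R) 2.
have -> : (k x)%:C = t%:C * (s x)%:C / (2 * pi%:C * th%:C * x%:C * (x%:C + p%:C)).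
  by rewrite -two -rmorphD -!rmorphM -fmorphV -rmorphM.
have -> : (t / (2 * pi * th))%:C = t%:C / (2 * pi%:C * th%:C) :> R[i].
  by rewrite -two -!rmorphM -fmorphV -rmorphM.
have -> : (s x / (- p - x))%:C = (s x)%:C / (- p%:C - x%:C).
  by rewrite -rmorphN -rmorphB -fmorphV -rmorphM.
move: (s x) (@pi R) pin => S P pin; move: (x%:C) px xn xp' zx => X px xn xp' zx.
by field; do ?(apply/andP; split).
Qed.

(** Written over the complex numbers with the semicircle transform at zeta as a hypothesis, to serve
    both imaginary and real Y. The nonvanishing conditions say zeta <> -p, since zeta + p = (Y +
    la)((th+t) Y + th)/Y. *)
Let beta_prime_transform (Y V : R[i])
    (zeta := (th%:C * la%:C + (th%:C + t%:C) * Y) * (1 + Y) / Y) :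
  Y != 0 -> la%:C + Y != 0 -> (th%:C + t%:C) * Y + th%:C != 0 ->
  V = (rho / (th * la))%:C * Y ->
  (zeta = m%:C + (r / 2)%:C * (V + V^-1) ->
  [/\ forall x, s x != 0 -> zeta - x%:C != 0,
      cintegrable leb (fun x => (s x)%:C / (zeta - x%:C)) &
      cint leb (fun x => (s x)%:C / (zeta - x%:C)) = (pi * r)%:C * V]) ->
  cintegrable leb (fun x => x%:C / (zeta - x%:C) * (k x)%:C) /\
  cint leb (fun x => x%:C / (zeta - x%:C) * (k x)%:C) =
    t%:C * Y / (th%:C * (la%:C + Y)).
Proof.
move=> Y0 laY thY VE H.
have thn : th%:C != 0 :> R[i] by rewrite eq_complex /= eqxx andbT gt_eqF.
have tn : t%:C != 0 :> R[i] by rewrite eq_complex /= eqxx andbT gt_eqF.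
have lan : la%:C != 0 :> R[i] by rewrite eq_complex /= eqxx andbT gt_eqF.
have rhon : rho%:C != 0 :> R[i] by rewrite eq_complex /= eqxx andbT gt_eqF.
have pin : (@pi R)%:C != 0 :> R[i] by rewrite eq_complex /= eqxx andbT gt_eqF// pi_gt0.
have rho2C : rho%:C ^+ 2 = th%:C * la%:C * (th%:C + t%:C) :> R[i].
  by rewrite -rmorphXn rho2 !(rmorphM, rmorphD).
have r2 : r / 2 = rho by rewrite /r; field.
have zE : zeta = m%:C + (r / 2)%:C * (V + V^-1).
  have -> : (r / 2)%:C * (V + V^-1) = rho%:C ^+ 2 / (th%:C * la%:C) * Y + th%:C * la%:C / Y.
    by rewrite r2 VE !(rmorphM, fmorphV); field; do ?(apply/andP; split).
  by rewrite rho2C /zeta /m !(rmorphD, rmorphM); field; do ?(apply/andP; split).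
have [zx i e] := H zE.
have zpE : zeta + p%:C = (Y + la%:C) * ((th%:C + t%:C) * Y + th%:C) / Y.
  by rewrite /zeta /p rmorphM rmorphB rmorph1; field.
have zp : zeta + p%:C != 0.
  by rewrite zpE mulf_neq0 ?invr_neq0// mulf_neq0// addrC.
have [_ i' e'] := pole.
have E : (fun x => x%:C / (zeta - x%:C) * (k x)%:C) = (fun x =>
  (t / (2 * pi * th))%:C / (zeta + p%:C) * ((s x)%:C / (zeta - x%:C) - (s x / (- p - x))%:C)).
  by apply/funext => x; apply: kernelE => //; exact: zx.
have iC := cintegrable_real i'.
rewrite E; split; first by apply: cintegrableZ; exact: cintegrableB.
rewrite cintZ ?cintB//; last exact: cintegrableB.
rewrite e cint_real e' zpE VE /r.
have -> : (t / (2 * pi * th))%:C = t%:C / (2 * pi%:C * th%:C) :> R[i].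
  by rewrite !(rmorphM, fmorphV) (rmorph_nat (real_complex R) 2).
have -> : (- (2 * pi * th))%:C = - (2 * pi%:C * th%:C) :> R[i].
  by rewrite rmorphN !rmorphM (rmorph_nat (real_complex R) 2).
have -> : (pi * (2 * rho))%:C * ((rho / (th * la))%:C * Y) =
    2 * pi%:C * (rho%:C ^+ 2 / (th%:C * la%:C)) * Y.
  by rewrite !(rmorphM, fmorphV) (rmorph_nat (real_complex R) 2) /=; ring.
rewrite rho2C; move: (@pi R)%:C pin => P pin.
field; do ?(apply/andP; split) => //.
Qed.

                                                                             
                                                                       
                                                                              
Lemma beta_prime_transform_imag (d : R) (Y : R[i] := - d *i)
    (zeta := (th%:C * la%:C + (th%:C + t%:C) * Y) * (1 + Y) / Y) :
  0 < d < th * la / rho ->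
  cintegrable leb (fun x => x%:C / (zeta - x%:C) * (k x)%:C) /\
  cint leb (fun x => x%:C / (zeta - x%:C) * (k x)%:C) = t%:C * Y / (th%:C * (la%:C + Y)).
Proof.
move=> /andP[d0 d1]; have tl : 0 < th * la by exact: mulr_gt0.
apply: (@beta_prime_transform Y (- (rho / (th * la) * d) *i)).
- by rewrite /Y oppr_eq0 eq_complex /= (gt_eqF d0) andbF.
- by rewrite /Y eq_complex /= oppr0 addr0 (gt_eqF la0).
- rewrite /Y -rmorphD eq_complex /= negb_and; apply/orP; left.
  by rewrite !(mul0r, oppr0, mulr0, addr0, subr0, add0r) (gt_eqF th0).
- by rewrite /Y; apply: complex_eqP => /=; ring.
- apply: cint_semicircle_imag => //.
  by rewrite !mulr_gt0 ?invr_gt0//= mulrAC ltr_pdivrMr// mul1r mulrC -ltr_pdivlMr.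
Qed.

(** Solving y = t Y/(th (la + Y)) gives Y = th la y/(t - th y). The last hypothesis excludes the y
    for which zeta = -p, where the partial fractions degenerate. *)
Lemma beta_prime_transform_real y
    (zeta := (1 + y) * t * (t + th * (la - 1) * y) / (y * (t - th * y))) :
  -1 < y < 0 -> 0 < t + th * (la - 1) * y ->
  t + y * (la * (th + t) - th) != 0 ->
  [/\ zeta < 0, rintegrable leb (fun x => x / (zeta - x) * k x) &
      rint leb (fun x => x / (zeta - x) * k x) = y].
Proof.
move=> /andP[y1 y0] ty yexc.
have tl : 0 < th * la by exact: mulr_gt0.
have tty : 0 < t - th * y by have := t0; have := th0; nra.
pose Y := th * la * y / (t - th * y).
have Yn0 : Y < 0 by rewrite /Y pmulr_llt0 ?invr_gt0// pmulr_rlt0.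
have ttyn : t - th * y != 0 by rewrite gt_eqF.
have yn : y != 0 by rewrite lt_eqF.
have thn : th != 0 by rewrite gt_eqF.
have lan : la != 0 by rewrite gt_eqF.
have Yn : Y != 0 by rewrite lt_eqF.
have z0 : zeta < 0.
  rewrite /zeta pmulr_rlt0 ?invr_lt0 ?pmulr_llt0// mulr_gt0// mulr_gt0//; lra.
have laYE : la + Y = la * t / (t - th * y) by rewrite /Y; field.
have laY : la + Y != 0.
  by rewrite laYE gt_eqF// divr_gt0// mulr_gt0.
have thY : (th + t) * Y + th != 0.
  have -> : (th + t) * Y + th = th * (t + y * (la * (th + t) - th)) / (t - th * y).
    by rewrite /Y; field.
  by rewrite !mulf_neq0// invr_neq0.
have zetaE : zeta = (th * la + (th + t) * Y) * (1 + Y) / Y.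
  by rewrite /zeta /Y; field; do ?(apply/andP; split).
pose V := rho / (th * la) * Y.
have V1 : -1 < V < 0.
  rewrite /V pmulr_rlt0 ?divr_gt0// Yn0 andbT.
  have -> : rho / (th * la) * Y = rho * y / (t - th * y).
    by rewrite /Y; field; do ?(apply/andP; split).
  rewrite ltr_pdivlMr// mulN1r ltrNl -mulrN.
  rewrite -[ltRHS]gtr0_norm// -[ltLHS]gtr0_norm ?mulr_gt0 ?oppr_gt0//.
  rewrite -!sqrtr_sqr ltr_sqrt ?exprn_gt0// exprMn rho2 sqrrN.
  (* rho^2 y^2 factors as (th la (-y)) ((th+t)(-y)); positivity of t + th (la-1) y bounds the first
     factor and y > -1 the second. *)
  have h1 : th * la * - y < t - th * y by lra.
  have h2 : (th + t) * - y < t - th * y by have := t0; nra.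
  have -> : th * la * (th + t) * y ^+ 2 = (th * la * - y) * ((th + t) * - y) by ring.
  by rewrite expr2 ltr_pM// mulr_ge0 ?oppr_ge0 ?(ltW y0) ?addr_ge0 ?(ltW th0) ?(ltW t0) ?(ltW tl).
have zetaC : zeta%:C = (th%:C * la%:C + (th%:C + t%:C) * Y%:C) * (1 + Y%:C) / Y%:C.
  by rewrite zetaE !(rmorphM, fmorphV, rmorphD, rmorph1).
have := @beta_prime_transform Y%:C V%:C.
rewrite -zetaC => -[].
- by rewrite eq_complex /= eqxx andbT.
- by rewrite -rmorphD eq_complex /= eqxx andbT.
- by rewrite -!(rmorphD, rmorphM) eq_complex /= eqxx andbT.
- by rewrite /V rmorphM.
- rewrite -fmorphV -rmorphD -rmorphM -rmorphD => /complexI zE.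
  have [h i e] := rint_semicircle r0 V1 zE.
  have E : (fun x => (s x)%:C / (zeta%:C - x%:C)) = (fun x => (s x / (zeta - x))%:C).
  by apply/funext => x; rewrite -rmorphB -fmorphV -!rmorphM.
  rewrite E; split.
  + by move=> x sx; rewrite -rmorphB eq_complex /= eqxx andbT h.
  + exact: cintegrable_real.
  + by rewrite cint_real e rmorphM.
have E : (fun x => x%:C / (zeta%:C - x%:C) * (k x)%:C) = (fun x => (x / (zeta - x) * k x)%:C).
  by apply/funext => x; rewrite -rmorphB -fmorphV -!rmorphM.
rewrite E => -[[i _]]; rewrite cint_real => e; split => //.
apply: complexI; rewrite e -rmorphD -!rmorphM -fmorphV -rmorphM; congr (_%:C).
by rewrite laYE /Y; have tn : t != 0; [rewrite gt_eqF|field; do ?(apply/andP; split)].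
Qed.

End free_beta_prime.

(** * The probability measure [beta_prime] and its transforms *)

Section free_beta_prime_law.
Context (R : realType).
Variables (t th la : R).
Hypotheses (t0 : 0 < t) (th0 : 0 < th) (la1 : 1 <= la).
Local Notation leb := (@leb R).
Local Notation k := (beta_prime_density t th la).

Let la0 : 0 < la. Proof. exact: lt_le_trans la1. Qed.
Let k0 := beta_prime_density_ge0 t0 th0 la1.
Let mk := measurable_beta_prime_density t th la.
Let kneg x : x <= 0 -> k x = 0. Proof. exact: beta_prime_density_neg. Qed.

(** zeta vanishes as y decreases to -c with c = min(1, t/A), A = th (la-1): one of the factors 1 + y
    and t + A y tends to 0 and the denominator stays bounded away from 0. *)
Let near_zero (e : R) : 0 < e -> exists y : R,
  let zeta := (1 + y) * t * (t + th * (la - 1) * y) / (y * (t - th * y)) in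
  [/\ -1 < y < 0, 0 < t + th * (la - 1) * y,
      t + y * (la * (th + t) - th) != 0 & - e < zeta].
Proof.
move=> e0; pose A := th * (la - 1).
have A0 : 0 <= A by rewrite mulr_ge0 ?subr_ge0 ?(ltW th0).
have [c [c0 c1 Ac cA]] : exists c, [/\ 0 < c, c <= 1, A * c <= t &
    c = 1 \/ A * c = t].
  have [At|At] := leP A t; first by exists 1; split; rewrite ?mulr1//; left.
  have A0' : 0 < A by exact: lt_trans At.
  exists (t / A); split.
  - exact: divr_gt0.
  - by rewrite ler_pdivrMr// mul1r ltW.
  - by rewrite mulrC divfK// gt_eqF.
  - by right; rewrite mulrC divfK// gt_eqF.
have tA : 0 < t + A by rewrite ltr_wpDr.
pose d := Num.min (c / 2) (e * c / (4 * (t + A))).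
have d0 : 0 < d by rewrite lt_min !divr_gt0 ?mulr_gt0.
have dc : d <= c / 2 by rewrite ge_min lexx.
have de : d * (4 * (t + A)) <= e * c.
  by rewrite -ler_pdivlMr ?mulr_gt0// ge_min lexx orbT.
have {}T d' : 0 < d' -> d' <= d ->
    let y := - c + d' in
    let zeta := (1 + y) * t * (t + A * y) / (y * (t - th * y)) in
    [/\ -1 < y < 0, 0 < t + A * y & - e < zeta].
  move=> d'0 d'd /=; set y := - c + d'.
  have y1 : -1 < y < 0 by rewrite /y; lra.
  have ty : 0 < t + A * y.
    rewrite /y; have [A00|] := eqVneq A 0; first by rewrite A00 mul0r addr0.
    move=> An; have : 0 < A * d' by rewrite mulr_gt0// lt0r An.
    by lra.
  split => //; case/andP: y1 => y1 y0.
  have f1 : (1 + y) * (t + A * y) <= d' * (t + A).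
    rewrite /y; case: cA => cA.
      have : 0 <= d' * (A * (2 - d')) by rewrite mulr_ge0 ?(ltW d'0)// mulr_ge0//; lra.
      by rewrite cA; lra.
    have -> : t + A * (- c + d') = A * d' by rewrite mulrDr mulrN cA; ring.
    rewrite mulrC -mulrA mulrCA ler_wpM2l ?(ltW d'0)//.
    have : A * (1 + (- c + d')) <= A * 1 by apply: ler_wpM2l => //; lra.
    by rewrite mulr1; have := t0; lra.
  have tty : t <= t - th * y by rewrite lerDl -mulrN mulr_ge0 ?(ltW th0)//; lra.
  have Y0 : 0 < - y * (t - th * y) by rewrite mulr_gt0 ?oppr_gt0//; exact: lt_le_trans tty.
  rewrite ltrNl -mulrN -invrN -mulNr ltr_pdivrMr//.
  apply: (@le_lt_trans _ _ (d' * (t + A) * t)).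
    by rewrite mulrAC ler_wpM2r ?(ltW t0).
  apply: (@lt_le_trans _ _ (e * (- y * t))); last first.
    by rewrite ler_wpM2l ?(ltW e0)// ler_wpM2l// oppr_ge0 ltW.
  rewrite mulrA ltr_pM2r//.
  have h1 : d' * (t + A) <= d * (t + A) by rewrite ler_wpM2r// ltW.
  have h2 : e * (c / 2) <= e * - y by rewrite ler_wpM2l ?(ltW e0)// /y; lra.
  have h3 : 0 < d * (t + A) by exact: mulr_gt0.
  by lra.
pose K := la * (th + t) - th.
have K0 : 0 < K.
  rewrite /K subr_gt0; apply: (@lt_le_trans _ _ (1 * (th + t))).
    by rewrite mul1r ltrDl.
  by rewrite ler_wpM2r// addr_ge0 ?(ltW th0) ?(ltW t0).
(* The excluded condition is affine in y with slope K > 0, so it fails for at most one y: if d is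
   unlucky, d/2 works. *)
have [E|E] := eqVneq (t + (- c + d) * K) 0; last first.
  have [h1 h2 h3] := T d d0 (lexx _).
  by exists (- c + d); split.
have d20 : 0 < d / 2 by rewrite divr_gt0.
have d2d : d / 2 <= d by lra.
have [h1 h2 h3] := T (d / 2) d20 d2d.
exists (- c + d / 2); split => //.
have -> : t + (- c + d / 2) * (la * (th + t) - th) = - (d / 2 * K).
  by rewrite -[RHS]addr0 -E /K; field.
by rewrite oppr_eq0 gt_eqF// mulr_gt0.
Qed.

Let mass1 : (\int[leb]_x (k x)%:E <= 1%:E)%E.
Proof.
apply: mass_le => // e e0.
have [y [y1 y2 y3 y4]] := near_zero e0.
have [z0 i r] := beta_prime_transform_real t0 th0 la1 y1 y2 y3.
exists ((1 + y) * t * (t + th * (la - 1) * y) / (y * (t - th * y))).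
have E z : (fun x => x / (x - z) * k x) = (fun x => -1 * (x / (z - x) * k x)).
  by apply/funext => x; rewrite -[x - z]opprB invrN; ring.
split => //; rewrite E; first exact: rintegrableZ.
by rewrite rintZ// r; case/andP: y1; lra.
Qed.

Let ik : rintegrable leb k.
Proof.
apply/integrableP; split; first exact/measurable_EFinP.
under eq_integral do rewrite /= ger0_norm ?k0//.
by apply: le_lt_trans mass1 _; rewrite ltry.
Qed.

Let kE : (\int[leb]_x (k x)%:E = (rint leb k)%:E)%E.
Proof. by rewrite /rint fineK// (integrable_fin_num measurableT ik). Qed.

Let atom_ge0 : 0 <= 1 - rint leb k.
Proof. by rewrite subr_ge0 -lee_fin -kE. Qed.

                                                                            
                                   
(** The density is only shown to have mass at most 1; whatever is missing is placed at 0. *)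
Definition beta_prime : {measure set R -> \bar R} := atom_density atom_ge0 k0 mk.

Lemma beta_prime_setT : beta_prime [set: R] = 1%E.
Proof. by rewrite atom_densityE diracT mule1 kE -EFinD subrK. Qed.

Lemma beta_prime_neg : beta_prime [set x | x < 0] = 0%E.
Proof.
rewrite atom_densityE integral0_eq ?adde0.
  by rewrite diracE memNset ?mule0//= ltxx.
by move=> x /= x0; rewrite kneg// ltW.
Qed.

Lemma rint_beta_prime y (zeta := (1 + y) * t * (t + th * (la - 1) * y) / (y * (t - th * y))) :
  -1 < y < 0 -> 0 < t + th * (la - 1) * y ->
  t + y * (la * (th + t) - th) != 0 ->
  zeta < 0 /\ rint beta_prime (fun x => x / (zeta - x)) = y.
Proof.
move=> y1 y2 y3; have [z0 i e] := beta_prime_transform_real t0 th0 la1 y1 y2 y3.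
split=> //; rewrite rint_atom_density ?mul0r//.
by apply: measurable_funM => //; apply: measurable_funV; exact: measurable_funB.
Qed.

(** zeta G(zeta) - 1 is the integral of x/(zeta - x), to which the atom does not contribute. *)
Lemma Gtr_beta_prime (d : R) (Y : R[i] := - d *i)
    (zeta := (th%:C * la%:C + (th%:C + t%:C) * Y) * (1 + Y) / Y) :
  0 < d < th * la / Num.sqrt (th * la * (th + t)) -> 0 < Im zeta ->
  Gtr beta_prime zeta = (1 + t%:C * Y / (th%:C * (la%:C + Y))) / zeta.
Proof.
move=> d01 z0; have [i e] := beta_prime_transform_imag t0 th0 la1 d01.
have zn : zeta != 0 by apply: contraTneq z0 => ->; rewrite ltxx.
have zx x : zeta - x%:C != 0.
  by rewrite subr_eq0; apply: contraTneq z0 => ->; rewrite ltxx.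
have imx x : Im (zeta - x%:C) = Im zeta by rewrite ImD ImN oppr0 addr0.
have mc : cmeasurable (fun x : R => (zeta - x%:C)^-1).
  by apply/cmeasurableV/cmeasurableB; [exact: cmeasurable_cst|exact: cmeasurable_real].
have ic : cintegrable beta_prime (fun x : R => (zeta - x%:C)^-1).
  apply: (cintegrable_bounded beta_prime_setT (M := (Im zeta)^-1)) => // x.
  rewrite Normc.normcV lef_pV2 ?posrE ?normc_gt0 ?zx//.
  by apply: le_trans (Im_le_normc _); rewrite imx ler_norm.
have E : cint beta_prime (fun x => x%:C / (zeta - x%:C)) = zeta * Gtr beta_prime zeta - 1.
  rewrite -[X in _ - X](cint_cst beta_prime_setT) /Gtr -cintZ// -cintB.
  - congr cint; apply/funext => x; have := zx x => h.
    by rewrite -complexr0; field.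
  - exact: cintegrableZ.
  - by apply: (cintegrable_bounded beta_prime_setT (M := normc 1)) => //; exact: cmeasurable_cst.
have mq : cmeasurable (fun x : R => x%:C / (zeta - x%:C)).
  by apply: cmeasurableM => //; exact: cmeasurable_real.
have := cint_atom_density atom_ge0 k0 mk mq _ i; rewrite mul0r -/beta_prime E e => /(_ erefl) <-.
by field.
Qed.

(** w is the inverse of the Marchenko-Pastur point zeta, and (1/(1 - w x) - 1) t/x = (t/zeta)(1 +
    x/(zeta - x)); mass 1 and [MP_transform_imag] give (t/zeta)(1 + Y). *)
Lemma Rmu_param (d : R) (Y : R[i] := - d *i) (w := Y / (th%:C * (la%:C + Y) * (1 + Y))) :
  0 < d < Num.sqrt la -> Rmu t th la w = t%:C * Y / (th%:C * (la%:C + Y)).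
Proof.
move=> d01; have [h i e] := MP_transform_imag th0 la0 d01.
set zeta := th%:C * (la%:C + Y) * (1 + Y) / Y in h i e.
have [ikm km1] := rint_kMP th0 la0 la1.
have d0 : 0 < d by case/andP: d01.
have Yn : Y != 0 by rewrite /Y oppr_eq0 eq_complex /= (gt_eqF d0) andbF.
have laY : la%:C + Y != 0 by rewrite /Y eq_complex /= oppr0 addr0 (gt_eqF la0).
have Y1 : 1 + Y != 0 by rewrite /Y eq_complex /= oppr0 addr0 oner_eq0.
have thn : th%:C != 0 :> R[i] by rewrite eq_complex /= eqxx andbT gt_eqF.
have wE : w = zeta^-1 by rewrite /w /zeta invf_div.
have zn : zeta != 0 by rewrite /zeta !mulf_neq0 ?invr_neq0.
rewrite /Rmu -/(cint leb _).
transitivity (cint leb (fun x => (t%:C / zeta) *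
   ((kMP th la x)%:C + x%:C / (zeta - x%:C) * (kMP th la x)%:C))).
  congr cint; apply/funext => x.
  have [kx|kx] := eqVneq (kMP th la x) 0.
    by rewrite kx mulr0 mul0r complexr0 !mulr0 addr0 mulr0.
  have xn : x != 0.
    by apply: contraNneq kx => ->; rewrite kMP_neg.
  have xC : x%:C != 0 :> R[i] by rewrite eq_complex /= eqxx andbT.
  have zx := h x kx.
  rewrite !complexr0 wE !(rmorphM, fmorphV) /=.
  have -> : 1 - zeta^-1 * x%:C = (zeta - x%:C) / zeta by field.
  by field; do ?(apply/andP; split).
have ikC := cintegrable_real ikm.
rewrite cintZ ?cintD//; last exact: cintegrableD.
rewrite cint_real km1 rmorph1 e /zeta -/Y; field; do ?(apply/andP; split) => //.
Qed.

End free_beta_prime_law.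

                                   

(** * Identification of mu_{t,th,la} with [beta_prime] *)

Section identification.
Context (R : realType).
Variables (t th la : R).
Hypotheses (t0 : 0 < t) (th0 : 0 < th) (la1 : 1 <= la).
Let la0 : 0 < la. Proof. exact: lt_le_trans la1. Qed.
Variable mu : probability R R.
Hypothesis mu_is : is_mu t th la mu.

Let zeta (d : R) : R[i] :=
  (th%:C * la%:C + (th%:C + t%:C) * - d *i) * (1 + - d *i) / - d *i.
Let f (d : R) := th * la / d - (th + t) * d.

Let zetaE d : 0 < d -> zeta d = (th + t + th * la) +i* f d.
Proof.
move=> d0; have dn : d != 0 by rewrite gt_eqF.
have Yn : - d *i != 0 by rewrite oppr_eq0 eq_complex /= (gt_eqF d0) andbF.
apply: (mulIf Yn); rewrite /zeta divfK//.
by apply: complex_eqP; rewrite /f /=; field.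
Qed.

(** For small d the point w lies in the lower half-plane with |w| <= d/(th la) < eps, so the
    R-transform hypothesis gives G(zeta d) = w, which is also the value for [beta_prime]. *)
Let Gtr_eq : exists2 D : R, 0 < D & forall d, 0 < d < D ->
  0 < Im (zeta d) /\ Gtr mu (zeta d) = Gtr (beta_prime t0 th0 la1) (zeta d).
Proof.
have [eps eps0 H] := mu_is.
pose rho := Num.sqrt (th * la * (th + t)).
have rho0 : 0 < rho by rewrite sqrtr_gt0 !mulr_gt0// addr_gt0.
have tl0 : 0 < th * la by exact: mulr_gt0.
exists (Num.min (Num.sqrt la) (Num.min (th * la / rho) (eps * (th * la)))).
  by rewrite !lt_min sqrtr_gt0 la0 divr_gt0//= mulr_gt0.
move=> d /andP[d0]; rewrite !lt_min => /and3P[dla drho deps].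
pose Y : R[i] := - d *i; pose w := Y / (th%:C * (la%:C + Y) * (1 + Y)).
have thn : th%:C != 0 :> R[i] by rewrite eq_complex /= eqxx andbT gt_eqF.
have Yn : Y != 0 by rewrite /Y oppr_eq0 eq_complex /= (gt_eqF d0) andbF.
have laY : la%:C + Y != 0 by rewrite /Y eq_complex /= oppr0 addr0 (gt_eqF la0).
have Y1 : 1 + Y != 0 by rewrite /Y eq_complex /= oppr0 addr0 oner_eq0.
have d2 : d ^+ 2 < la.
  by rewrite -(sqr_sqrtr (ltW la0)) ltrXn2r ?nnegrE ?sqrtr_ge0 ?(ltW d0).
set u1 := th%:C * (la%:C + Y) * (1 + Y) in w *.
have u1n : u1 != 0 by rewrite /u1 !mulf_neq0.
have Ru1 : Re u1 = th * (la - d ^+ 2) by rewrite /u1 /Y /=; ring.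
have wl : lower w.
  rewrite /lower /w ImM.
  have -> : Re Y = 0 by rewrite /Y /= oppr0.
  have -> : Im Y = - d by rewrite /Y.
  have R1 : 0 < Re u1 by rewrite Ru1 mulr_gt0// subr_gt0.
  rewrite mul0r add0r mulNr oppr_lt0; apply: mulr_gt0 => //; rewrite ReV.
  by apply: divr_gt0 => //; rewrite ltr_wpDr ?sqr_ge0// exprn_gt0.
have wn : normc w < eps.
  rewrite /w Normc.normcM Normc.normcV.
  have -> : normc Y = d by rewrite /Y /= oppr0 expr0n add0r sqrrN sqrtr_sqr gtr0_norm.
  rewrite ltr_pdivrMr ?normc_gt0//; apply: lt_le_trans deps _.
  rewrite ler_wpM2l ?(ltW eps0)// /u1 !Normc.normcM normc_real gtr0_norm//.
  have h1 : la <= normc (la%:C + Y).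
    apply: le_trans (Re_le_normc _); rewrite /Y /= oppr0 addr0; exact: ler_norm.
  have h2 : 1 <= normc (1 + Y).
    apply: le_trans (Re_le_normc _); rewrite /Y /= oppr0 addr0; exact: ler_norm.
  rewrite -[leLHS]mulr1 ler_pM ?mulr_ge0 ?(ltW th0) ?(ltW la0)//.
  by rewrite ler_wpM2l ?(ltW th0).
have w2 : Re w ^+ 2 + Im w ^+ 2 < eps ^+ 2.
  have -> : Re w ^+ 2 + Im w ^+ 2 = normc w ^+ 2.
    by case: w {wl wn} => a b /=; rewrite sqr_sqrtr// addr_ge0 ?sqr_ge0.
  by rewrite ltrXn2r ?nnegrE ?normc_ge0 ?(ltW eps0).
have [up G] := H w wl w2.
have dla' : 0 < d < Num.sqrt la by rewrite d0.
have RE := Rmu_param t th0 la1 dla'.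
rewrite -/Y -/u1 -/w in RE; rewrite RE in up G.
have zE : (1 + t%:C * Y / (th%:C * (la%:C + Y))) / w = zeta d.
  rewrite /zeta -/Y /w invf_div /u1.
  by field; do ?(apply/andP; split).
rewrite zE in up G; split=> //.
have dr : 0 < d < th * la / Num.sqrt (th * la * (th + t)) by rewrite d0.
rewrite G (Gtr_beta_prime t0 th0 la1 dr) -/Y; last exact: up.
rewrite -/(zeta d); set c := 1 + _ in zE *.
have cn : c != 0.
  have : zeta d != 0 by apply: contraTneq up => ->; rewrite /upper ltxx.
  by apply: contraNneq => c0; rewrite -zE c0 mul0r.
have wn0 : w != 0 by rewrite /w mulf_neq0 ?invr_neq0.
by rewrite -zE invf_div mulrCA mulfV ?mulr1.
Qed.

Lemma is_mu_beta_prime B : measurable B -> mu B = beta_prime t0 th0 la1 B.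
Proof.
have [D D0 HD] := Gtr_eq.
have d00 : 0 < D / 2 by rewrite divr_gt0.
pose d0 := D / 2.
have [z00 G0] : 0 < Im (zeta d0) /\ Gtr mu (zeta d0) = Gtr (beta_prime t0 th0 la1) (zeta d0).
  by apply: HD; rewrite d00 /d0; lra.
apply: (@Gtr_determines R mu (beta_prime t0 th0 la1) _ _ (Im (zeta d0) / 2) (zeta d0)) => //.
- exact: probability_setT.
- exact: beta_prime_setT.
- by rewrite divr_gt0.
- by lra.
(* The points [zeta d] lie on a vertical line at height f d, with f decreasing; C bounds the
   difference quotients of f at d0 for d in [d0/2, d0]. *)
move=> e e0; pose C := 2 * (th * la) / d0 ^+ 2 + (th + t).
have C0 : 0 < C by rewrite addr_gt0 ?divr_gt0 ?mulr_gt0 ?exprn_gt0 ?addr_gt0.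
pose dl := Num.min (d0 / 2) (e / (2 * C)).
have dl0 : 0 < dl by rewrite lt_min !divr_gt0 ?mulr_gt0.
have dl1 : dl <= d0 / 2 by rewrite ge_min lexx.
have dl2 : dl * (2 * C) <= e by rewrite -ler_pdivlMr ?mulr_gt0// ge_min lexx orbT.
pose d := d0 - dl.
have dp : 0 < d by rewrite /d /d0 in dl1 *; lra.
have dD : 0 < d < D by rewrite dp /d /d0 in dl1 *; lra.
have [zd Gd] := HD _ dD.
have fd : f d - f d0 = (th * la / (d * d0) + (th + t)) * dl.
  have dn : d != 0 by rewrite gt_eqF.
  have dn0 : d0 != 0 by rewrite gt_eqF.
  have -> : dl = d0 - d by rewrite /d; ring.
  by rewrite /f; field; do ?(apply/andP; split).
have fd0 : 0 < f d - f d0.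
  rewrite fd; apply: mulr_gt0 => //; apply: addr_gt0; last exact: addr_gt0.
  by apply: divr_gt0; exact: mulr_gt0.
have fdC : f d - f d0 <= C * dl.
  rewrite fd ler_wpM2r ?(ltW dl0)// lerD2r ler_pdivrMr ?mulr_gt0//.
  have -> : 2 * (th * la) / d0 ^+ 2 * (d * d0) = th * la * (2 * d / d0).
    by have dn0 : d0 != 0; [rewrite gt_eqF|field].
  rewrite ler_peMr ?mulr_ge0 ?(ltW th0) ?(ltW la0)// ler_pdivlMr// mul1r.
  by rewrite /d; lra.
exists (zeta d); split => //.
- move: z00; rewrite !zetaE//= => z00; lra.
- rewrite !zetaE// eq_complex /= eqxx /=; rewrite -subr_eq0 gt_eqF//.
- rewrite !zetaE//= subrr expr0n add0r sqrtr_sqr gtr0_norm//.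
  apply: le_lt_trans fdC _; have := dl2; have : 0 < C * dl by rewrite mulr_gt0.
  lra.
Qed.

End identification.

(** * Existence and uniqueness of the multiplicative convolution *)

Section boxtimes.
Context (R : realType).

Lemma probability_of_mass1 (m : {measure set R -> \bar R}) : m [set: R] = 1%E ->
  exists P : probability R R, forall B, P B = m B.
Proof.
move=> m1; exists (mnormalize m \d_(0 : R)) => B.
rewrite /= /mnormalize m1 (_ : (1%E == 0%E :> \bar R) = false)/=; last by rewrite eqe oner_eq0.
by rewrite invr1 mule1.
Qed.

Lemma S_at_meq (mu nu : {measure set R -> \bar R}) (y s : R) :
  (forall B, measurable B -> mu B = nu B) -> S_at nu y s -> S_at mu y s.
Proof.
move=> e [z [z0 [ez es]]]; exists z; split => //; split => //.
rewrite -ez /psi; apply: rint_meq => // B mB; exact: e.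
Qed.

Variables (A B : set R -> \bar R) (sA sB : R -> R) (a : R).
Hypotheses (rA : psi_regular A) (rB : psi_regular B).
Hypotheses (a1 : -1 <= a) (a0 : a < 0).
Hypothesis (SA : forall y, a < y < 0 -> S_at A y (sA y)).
Hypothesis (SB : forall y, a < y < 0 -> S_at B y (sB y)).
Variable N : {measure set R -> \bar R}.
Hypotheses (N1 : N [set: R] = 1%E) (Nneg : N [set x | x < 0] = 0%E).
Hypothesis (SN : forall y, a < y < 0 -> S_at N y (sA y * sB y)).

Lemma is_boxtimes_intro (rho : probability R R) :
  (forall C, measurable C -> rho C = N C) -> is_boxtimes A B rho.
Proof.
move=> rhoN; split; first by rewrite rhoN//; exact: measurable_lt0.
exists a => // y ay; exists (sA y), (sB y), (sA y * sB y); split => //.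
- exact: SA.
- exact: SB.
- by apply: S_at_meq rhoN _; exact: SN.
Qed.

Lemma is_boxtimes_exists : exists rho : probability R R, is_boxtimes A B rho.
Proof.
have [rho rhoN] := probability_of_mass1 N1.
by exists rho; apply: is_boxtimes_intro => C _; exact: rhoN.
Qed.

Hypothesis sAB0 : forall y, a < y < 0 -> sA y * sB y != 0.
Hypothesis sABc : forall y, a < y < 0 -> {for y, continuous (fun y => sA y * sB y)}.

(** Near 0 the S-transform of rho is forced, by uniqueness of S-values, to be that of N. So psi of
    both laws equals y at 1/Z(y); continuity of Z makes these points accumulate and [psi_determines]
    applies. *)
Lemma is_boxtimes_unique (rho : probability R R) : is_boxtimes A B rho ->
  forall C, measurable C -> rho C = N C.
Proof.
move=> [rhoneg [b b0 H]].
(* The reciprocal of chi(y) = y S(y)/(1 + y), the variable zeta of [psi_determines]. *)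
pose Z y := (1 + y) / (y * (sA y * sB y)).
have psiZ (mu : set R -> \bar R) y : a < y < 0 -> S_at mu y (sA y * sB y) ->
    Z y < 0 /\ psi mu (Z y)^-1 = y.
  move=> /andP[ay y0] [z [z0 [ez es]]].
  have yn : y != 0 by rewrite lt_eqF.
  have y1 : 1 + y != 0 by rewrite gt_eqF//; move: a1; lra.
  have zn : z != 0 by rewrite lt_eqF.
  have -> : Z y = z^-1.
    by rewrite /Z es; field; do ?(apply/andP; split).
  by rewrite invrK invr_lt0.
pose c := Num.max a b.
have c0 : c < 0 by rewrite gt_max a0.
have ac y : c < y -> a < y by rewrite gt_max => /andP[].
have bc y : c < y -> b < y by rewrite gt_max => /andP[].
have Srho y : c < y < 0 -> S_at rho y (sA y * sB y).
  move=> /andP[cy y0]; have ay : a < y < 0 by rewrite ac.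
  have [|s1 [s2 [s3 [h1 h2 h3 e]]]] := H y; first by rewrite bc.
  have yn : y != 0 by rewrite lt_eqF.
  rewrite -(S_at_unique rA yn h1 (SA ay)) -(S_at_unique rB yn h2 (SB ay)).
  by rewrite -e.
pose y0 := c / 2.
have cy0 : c < y0 < 0 by rewrite /y0; lra.
have ay0 : a < y0 < 0 by case/andP: cy0 => /ac -> ->.
have [Z0 psi0] := psiZ N y0 ay0 (SN ay0).
have [_ psi0'] := psiZ rho y0 ay0 (Srho _ cy0).
apply: (@psi_determines R rho N _ N1 (Z y0)) => //.
- exact: probability_setT.
- by rewrite psi0 psi0'.
move=> e e0.
have cZ : {for y0, continuous Z}.
  apply: cvgM; first by apply: cvgD; [exact: cvg_cst|exact: cvg_id].
  apply: cvgV; first by rewrite mulf_neq0 ?sAB0//; case/andP: cy0 => _ /lt_eqF ->.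
  by apply: cvgM; [exact: cvg_id|exact: sABc].
have /cvgrPdist_lt/(_ e e0)/nbhs_ballP[d /= d0 Hd] := cZ.
pose h := Num.min (d / 2) (- c / 4).
have h0 : 0 < h by rewrite lt_min divr_gt0//= divr_gt0// oppr_gt0.
have h1 : h <= d / 2 by rewrite ge_min lexx.
have h2 : h <= - c / 4 by rewrite ge_min lexx orbT.
have cy : c < y0 + h < 0 by rewrite /y0; lra.
have ay : a < y0 + h < 0 by case/andP: cy => /ac -> ->.
have [Z1 psi1] := psiZ N _ ay (SN ay).
have [_ psi1'] := psiZ rho _ ay (Srho _ cy).
exists (Z (y0 + h)); split => //.
(* Z is injective here, since psi recovers y from Z y. *)
- apply/eqP => E; have : y0 + h = y0 by rewrite -psi1 E psi0.
  by move: h0; lra.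
- rewrite distrC; apply: Hd; rewrite /ball/= opprD addNKr normrN gtr0_norm//; lra.
- by rewrite psi1 psi1'.
Qed.

End boxtimes.

(** * The S-transform of mu_{t,th,la} and the two factorisations *)

Section laws.
Context (R : realType).
Variables (t th la : R).
Hypotheses (t0 : 0 < t) (th0 : 0 < th) (la1 : 1 <= la).
Variable mu : probability R R.
Hypothesis mu_is : is_mu t th la mu.

Lemma is_mu_neg : mu [set x | x < 0] = 0%E.
Proof.
by rewrite (is_mu_beta_prime t0 th0 la1 mu_is) ?beta_prime_neg//; exact: measurable_lt0.
Qed.

Lemma psi_regular_is_mu : psi_regular mu.
Proof. exact: psi_regular_probability (probability_setT mu) is_mu_neg. Qed.

(** The single linear bound on y implies all three hypotheses of [rint_beta_prime]; in particular it
    stays clear of the excluded value. *)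
Lemma S_at_is_mu y : y < 0 -> 0 < t + y * (la * (th + t)) ->
  S_at mu y ((t - th * y) / (t * (t + th * (la - 1) * y))).
Proof.
move=> y0 ty; have la0 : 0 < la by exact: lt_le_trans la1.
apply: S_at_meq (is_mu_beta_prime t0 th0 la1 mu_is) _.
have h1 : y * (la * (th + t)) <= y * t.
  rewrite ler_nM2l//; apply: (@le_trans _ _ (1 * (th + t))).
    by rewrite mul1r lerDr ltW.
  by rewrite ler_wpM2r// addr_ge0 ?(ltW th0) ?(ltW t0).
have h2 : y * (la * (th + t)) <= y * (th * (la - 1)).
  rewrite ler_nM2l//; have : 0 < la * t by exact: mulr_gt0.
  by move: th0; lra.
have h3 : y * (la * (th + t)) <= y * (la * (th + t) - th).
  by rewrite ler_nM2l// gerBl ltW.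
have y1 : -1 < y < 0.
  rewrite y0 andbT -(@ltr_pM2r _ t)// mulN1r; lra.
have y2 : 0 < t + th * (la - 1) * y by lra.
have y3 : t + y * (la * (th + t) - th) != 0 by rewrite gt_eqF//; lra.
have [z0 e] := rint_beta_prime t0 th0 la1 y1 y2 y3.
have := S_at_psi z0 e.
have n1 : y != 0 by rewrite lt_eqF.
have n2 : 1 + y != 0 by rewrite gt_eqF//; case/andP: y1; lra.
have n3 : t + th * (la - 1) * y != 0 by rewrite gt_eqF.
have n4 : t - th * y != 0.
  by rewrite gt_eqF// subr_gt0 (lt_trans _ t0)// pmulr_rlt0.
have n5 : t != 0 by rewrite gt_eqF.
by congr S_at; field; do ?(apply/andP; split).
Qed.

End laws.

Section boxtimes_identities.
Context (R : realType).
Variables (t th la : R).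
Hypotheses (t0 : 0 < t) (th0 : 0 < th) (la1 : 1 < la).
Variable mu : probability R R.
Hypothesis mu_is : is_mu t th la mu.
Let q := t / (th * (la - 1)).
(** The left end of a common interval (a,0) on which every S-transform involved is available: a >=
    -1, a >= -q, and the bound of [S_at_is_mu] holds for la and for 1. *)
Let a := - t / (la * (th + t)).

Let la0 : 0 < la. Proof. exact: lt_trans la1. Qed.
Let lam1 : 0 < la - 1. Proof. by rewrite subr_gt0. Qed.
Let q0 : 0 < q. Proof. by rewrite divr_gt0// mulr_gt0. Qed.
Let tht : 0 < la * (th + t). Proof. by rewrite mulr_gt0// addr_gt0. Qed.
Let a0 : a < 0. Proof. by rewrite /a mulNr oppr_lt0 divr_gt0. Qed.
Let a1 : -1 <= a.
Proof.
rewrite /a mulNr lerN2 ler_pdivrMr// mul1r.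
apply: (@le_trans _ _ (1 * (th + t))); first by rewrite mul1r lerDr ltW.
by rewrite ler_wpM2r ?(ltW la1)// addr_ge0 ?(ltW th0) ?(ltW t0).
Qed.

Let ay_pos y : a < y -> 0 < t + y * (la * (th + t)).
Proof. by rewrite /a ltr_pdivrMr// => h; lra. Qed.

Let aq y : a < y < 0 -> - q < y.
Proof.
move=> /andP[ay y0]; apply: le_lt_trans ay; rewrite /a /q mulNr lerN2.
rewrite ler_wpM2l ?(ltW t0)// lef_pV2 ?posrE// ?mulr_gt0//.
have : 0 < la * t by exact: mulr_gt0.
by move: th0; lra.
Qed.

Let a1y y : a < y < 0 -> -1 < y < 0.
Proof. by move=> /andP[ay ->]; rewrite andbT (le_lt_trans a1). Qed.

Let qyE y : a < y < 0 -> q + y = (t + th * (la - 1) * y) / (th * (la - 1)).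
Proof.
move=> _; have n1 : th != 0 by rewrite gt_eqF.
have n2 : la - 1 != 0 by rewrite gt_eqF.
by rewrite /q; field; do ?(apply/andP; split).
Qed.

Let qy0 y : a < y < 0 -> q + y != 0.
Proof. by move=> /aq h; rewrite gt_eqF//; lra. Qed.

Let tq0 y : a < y < 0 -> t + th * (la - 1) * y != 0.
Proof.
move=> h; have := qy0 h; rewrite qyE//; apply: contraNneq => ->.
by rewrite mul0r.
Qed.

Let ty0 y : a < y < 0 -> 0 < t - th * y.
Proof. by move=> /andP[_ y0]; rewrite subr_gt0 (lt_trans _ t0)// pmulr_rlt0. Qed.

(** At la = 1 the S-transform is (t - th y)/t^2, and that of [MP q^-1 q] is t/(t + th (la-1) y); the
    convolution is witnessed by [mu] itself. *)
Lemma boxtimes_mu1_MP (mu1 : probability R R) : is_mu t th 1 mu1 ->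
  (exists rho, is_boxtimes mu1 (MP q^-1 q) rho) /\
  (forall rho, is_boxtimes mu1 (MP q^-1 q) rho -> meq mu rho).
Proof.
move=> mu1_is.
pose sA y : R := (t - th * y) / (t * (t + th * (1 - 1) * y)).
pose sB y : R := (q^-1 * (q + y))^-1.
have rA : psi_regular mu1 by exact: psi_regular_is_mu mu1_is.
have rB : psi_regular (MP q^-1 q) by apply: psi_regular_MP; rewrite ?invr_gt0.
have SA y : a < y < 0 -> S_at mu1 y (sA y).
  move=> /andP[ay y0]; apply: S_at_is_mu => //.
  rewrite mul1r; apply: lt_le_trans (ay_pos ay) _.
  rewrite lerD2l ler_nM2l// ler_peMl ?(ltW la1)//.
  by rewrite addr_ge0 ?(ltW th0) ?(ltW t0).
have SB y : a < y < 0 -> S_at (MP q^-1 q) y (sB y).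
  by move=> ay; apply: S_at_MP; rewrite ?invr_gt0//; [exact: a1y|exact: aq].
have tn : t != 0 by rewrite gt_eqF.
have sE y : a < y < 0 -> sA y * sB y = (t - th * y) / (t * (t + th * (la - 1) * y)).
  move=> ay; have n1 : th != 0 by rewrite gt_eqF.
  have n2 : la - 1 != 0 by rewrite gt_eqF.
  have n3 := tq0 ay.
  rewrite /sA /sB qyE// /q subrr mulr0 mul0r addr0.
  by field; do ?(apply/andP; split).
have SN y : a < y < 0 -> S_at mu y (sA y * sB y).
  move=> ay; rewrite sE//; apply: S_at_is_mu => //; first exact: ltW.
    by case/andP: ay.
  by apply: ay_pos; case/andP: ay.
have s0 y : a < y < 0 -> sA y * sB y != 0.
  move=> ay; rewrite sE// mulf_neq0 ?invr_neq0//; first by rewrite gt_eqF// ty0.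
  by rewrite mulf_neq0// tq0.
have sc y : a < y < 0 -> {for y, continuous (fun y => sA y * sB y)}.
  move=> ay; apply: cvgM.
    apply: cvgM.
      by apply: cvgB; [exact: cvg_cst|apply: cvgMr; exact: cvg_id].
    apply: cvgV; first by rewrite subrr mulr0 mul0r addr0 mulf_neq0.
    apply: cvgMr; apply: cvgD; first exact: cvg_cst.
    by apply: cvgMr; exact: cvg_id.
  apply: cvgV; first by rewrite mulf_neq0 ?qy0// invr_neq0// gt_eqF.
  by apply: cvgMr; apply: cvgD; [exact: cvg_cst|exact: cvg_id].
have N1 := probability_setT mu; have Nneg := is_mu_neg t0 th0 (ltW la1) mu_is.
split; first exact: (is_boxtimes_exists a0 SA SB N1 Nneg SN).
move=> rho Hrho B mB; apply/esym.
exact: (is_boxtimes_unique rA rB a1 a0 SA SB N1 Nneg SN s0 sc Hrho).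
Qed.

Let c := t * (la - 1).
Let c0 : 0 < c. Proof. exact: mulr_gt0. Qed.

Lemma boxtimes_MP_minv_MP :
  (exists rho, is_boxtimes (MP 1 q) (minv (MP 1 (1 + t / th))) rho) /\
  (forall rho, is_boxtimes (MP 1 q) (minv (MP 1 (1 + t / th))) rho ->
     meq mu (dil c rho)).
Proof.
pose sA y : R := (1 * (q + y))^-1.
pose sB y : R := 1 * (1 + t / th - 1 - y).
have la'1 : 1 < 1 + t / th by rewrite ltrDl divr_gt0.
have rA : psi_regular (MP 1 q) by exact: psi_regular_MP.
have rB : psi_regular (minv (MP 1 (1 + t / th))) by exact: psi_regular_minv_MP.
have SA y : a < y < 0 -> S_at (MP 1 q) y (sA y).
  by move=> ay; apply: S_at_MP => //; [exact: a1y|exact: aq].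
have SB y : a < y < 0 -> S_at (minv (MP 1 (1 + t / th))) y (sB y).
  by move=> ay; apply: S_at_minv_MP => //; exact: a1y.
have cn : c != 0 by rewrite gt_eqF.
have tn : t != 0 by rewrite gt_eqF.
have thn : th != 0 by rewrite gt_eqF.
have lan : la - 1 != 0 by rewrite gt_eqF.
have sE y : a < y < 0 ->
    sA y * sB y = c * ((t - th * y) / (t * (t + th * (la - 1) * y))).
  move=> ay; have n3 := tq0 ay; rewrite /sA /sB qyE// /c.
  by field; do ?(apply/andP; split).
have fK : cancel (fun x => x * c) (fun x => x / c) by move=> x; rewrite mulfK.
have gK : cancel (fun x => x / c) (fun x => x * c) by move=> x; rewrite divfK.
have mg : measurable_fun [set: R] (fun x : R => x / c) by exact: measurable_funM.
(* N is [mu] dilated by 1/c: psi of N at z c is psi of [mu] at z, so its S-transform is c times that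
   of [mu], which is the product required. *)
have [N [NE NT Nn Ni Nr]] := image_meq_pushforward fK gK mg
  (fun B _ => erefl (mu B)).
have muT := probability_setT mu.
have mun := is_mu_neg t0 th0 (ltW la1) mu_is.
have N1 : N [set: R] = 1%E by rewrite NT.
have Nneg : N [set x | x < 0] = 0%E.
  rewrite Nn -mun; congr (mu _); apply/seteqP; split => x /=;
  by rewrite pmulr_llt0 ?invr_gt0.
have SN y : a < y < 0 -> S_at N y (sA y * sB y).
  move=> ay; rewrite sE//.
  have /andP[ay1 ay2] := ay.
  have [z [z0 [ez ->]]] := S_at_is_mu t0 th0 (ltW la1) mu_is ay2 (ay_pos ay1).
  have hE : (fun x => z * c * (x / c) / (1 - z * c * (x / c))) =
            (fun x => z * x / (1 - z * x)).
    apply/funext => x; have -> : z * c * (x / c) = z * x; last by [].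
    by move: (c) cn => e en; field.
  exists (z * c); rewrite pmulr_llt0//; split => //; split; last by ring.
  rewrite /psi Nr ?hE//; first exact: measurable_psi_kernel.
  exact: rintegrable_psi_kernel.
have s0 y : a < y < 0 -> sA y * sB y != 0.
  move=> ay; rewrite sE// !mulf_neq0 ?invr_neq0//; first by rewrite gt_eqF// ty0.
  by rewrite mulf_neq0// tq0.
have sc y : a < y < 0 -> {for y, continuous (fun y => sA y * sB y)}.
  move=> ay; apply: cvgM.
    apply: cvgV; first by rewrite mul1r qy0.
    by apply: cvgMr; apply: cvgD; [exact: cvg_cst|exact: cvg_id].
  by apply: cvgMr; apply: cvgB; [exact: cvg_cst|exact: cvg_id].
split; first exact: (is_boxtimes_exists a0 SA SB N1 Nneg SN).
move=> rho Hrho B mB.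
have imE (f g : R -> R) C : cancel f g -> cancel g f -> f @` C = g @^-1` C.
  move=> fgK gfK; apply/seteqP; split => x /=; first by move=> [y Cy <-]; rewrite fgK.
  by move=> Cx; exists (g x) => //; rewrite gfK.
have mC : measurable [set x / c | x in B].
  rewrite (imE _ _ _ gK fK) -[X in measurable X]setTI.
  have mf : measurable_fun [set: R] (fun x : R => x * c) by exact: measurable_funM.
  exact: mf.
rewrite /dil (is_boxtimes_unique rA rB a1 a0 SA SB N1 Nneg SN s0 sc Hrho mC).
rewrite -NE// image_comp; congr (mu _).
rewrite (_ : _ \o _ = id) ?image_id//.
by apply/funext => x /=; rewrite divfK.
Qed.

End boxtimes_identities.

(** * The free compound Poisson representation *)

Section compound_poisson.
Context (R : realType).
Variables (t th la : R).
Hypotheses (t0 : 0 < t) (th0 : 0 < th) (la1 : 1 < la).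
Local Notation leb := (@leb R).
Let la0 : 0 < la. Proof. exact: lt_trans la1. Qed.
Local Notation k := (kMP th la).

Let am0 : 0 < am th la.
Proof.
rewrite mulr_gt0// exprn_gt0// subr_gt0 -sqrtr1 ltr_sqrt.
  exact: la1.
exact: la0.
Qed.

Let ap0 : 0 < ap th la.
Proof. by rewrite mulr_gt0// exprn_gt0// ltr_wpDl ?sqrtr_ge0. Qed.

Let h x := t * k x / x.

Let h0 x : 0 <= h x.
Proof.
have [x0|x0] := ltP 0 x; last by rewrite /h kMP_neg// mulr0 mul0r.
by rewrite divr_ge0 ?mulr_ge0 ?(ltW t0) ?(ltW x0) ?kMP_ge0.
Qed.

Let mh : measurable_fun [set: R] h.
Proof.
apply: measurable_funM; last exact: measurable_invr.
by apply: measurable_funM => //; exact: measurable_kMP.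
Qed.

(** On the support x lies between a^- and a^+, with a^- > 0 because la > 1. The upper bound makes
    the Levy density integrable, the lower one makes its mass r positive. *)
Let h_bounds x : t / ap th la * k x <= h x <= t / am th la * k x.
Proof.
have [k0|kn] := eqVneq (k x) 0; first by rewrite /h k0 !mulr0 mul0r lexx.
have [xa xb] : am th la < x /\ x < ap th la.
  by move: kn; rewrite /kMP; case: ifP => [/andP[]|]; rewrite ?eqxx.
have x0 : 0 < x by exact: lt_trans xa.
have kx := kMP_ge0 th0 la0 x.
rewrite /h (mulrAC t (k x)); apply/andP; split; rewrite ler_wpM2r// ler_wpM2l ?(ltW t0)//.
  by rewrite lef_pV2 ?posrE// ltW.
by rewrite lef_pV2 ?posrE// ltW.
Qed.

Let ik : rintegrable leb k. Proof. by have [] := rint_kMP th0 la0 (ltW la1). Qed.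

Let ih : rintegrable leb h.
Proof.
apply: (rintegrable_dom (b := fun x => t / am th la * k x)) => //.
  exact: rintegrableZ.
by move=> x; rewrite ger0_norm//; case/andP: (h_bounds x).
Qed.

Let r := rint leb h.

Let r0 : 0 < r.
Proof.
apply: (@lt_le_trans _ _ (t / ap th la)); first exact: divr_gt0.
rewrite -[leLHS]mulr1 -(rint_kMP th0 la0 (ltW la1)).2 -rintZ//.
apply: rint_le => //; first exact: rintegrableZ.
by move=> x; case/andP: (h_bounds x).
Qed.

Lemma free_compound_poisson_is_mu (mu : probability R R) :
  is_mu t th la mu -> free_compound_poisson mu.
Proof.
move=> [eps eps0 H].
pose g x := r^-1 * h x.
have g0 x : 0 <= g x by rewrite mulr_ge0// invr_ge0 ltW.
have mg : measurable_fun [set: R] g by exact: measurable_funM.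
have ig : rintegrable leb g by exact: rintegrableZ.
have gT : density leb g0 mg [set: R] = 1%E.
  have := rintZ r^-1 ih; rewrite mulVf ?gt_eqF// => E.
  rewrite /density -(fineK (integrable_fin_num measurableT ig)); congr EFin.
  exact: E.
have [P PE] := probability_of_mass1 gT.
exists r; split => //; exists P; exists eps => // w wl weps.
rewrite (_ : Complex r 0 * _ = Rmu t th la w); first exact: H.
have wn : w != 0.
  by apply: contraTneq wl => ->; rewrite /lower ltxx.
have iw : 0 < Im w^-1.
  have n0 : 0 < Re w ^+ 2 + Im w ^+ 2.
    by rewrite ltr_wpDl ?sqr_ge0// -[Im w]opprK sqrrN exprn_gt0// oppr_gt0.
  by rewrite ImV divr_gt0// oppr_gt0.
(* 1 - w x = w (1/w - x) and |1/w - x| >= Im (1/w) > 0, so the integrand F is bounded by M + 1 and r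
   can be moved inside the integral. *)
pose M := normc w^-1 / Im w^-1.
have wx (x : R) : w^-1 - x%:C != 0.
  by rewrite subr_eq0; apply: contraTneq iw => ->; rewrite ltxx.
have FE (x : R) : 1 - w * x%:C = w * (w^-1 - x%:C) by field.
pose F (x : R) : R[i] := (1 - w * x%:C)^-1 - 1.
have mF : cmeasurable F.
  apply: cmeasurableB; last exact: cmeasurable_cst.
  apply/cmeasurableV/cmeasurableB; first exact: cmeasurable_cst.
  by apply: cmeasurableM; [exact: cmeasurable_cst|exact: cmeasurable_real].
have FM x : normc (F x) <= M + 1.
  apply: le_trans (normcB _ _) _; rewrite Normc.normc1 lerD2r FE invfM Normc.normcM.
  rewrite ler_wpM2l ?normc_ge0// Normc.normcV lef_pV2 ?posrE ?normc_gt0//.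
  have <- : Im (w^-1 - x%:C) = Im w^-1 by rewrite ImD ImN oppr0 addr0.
  exact: le_trans (ler_norm _) (Im_le_normc _).
have iF (f : R -> R) : (forall x, 0 <= f x) -> measurable_fun [set: R] f ->
    rintegrable leb f -> cintegrable leb (fun x => F x * (f x)%:C).
  move=> f0 mf if_; apply: (cintegrable_dom (b := fun x => (M + 1) * f x)).
  - by apply: cmeasurableM => //; exact: cmeasurable_real.
  - exact: rintegrableZ.
  - move=> x; rewrite Normc.normcM normc_real (ger0_norm (f0 x)) ler_wpM2r//.
have cP : cint P F = cint leb (fun x => F x * (g x)%:C).
  rewrite -(cint_density g0 mg mF (iF _ g0 mg ig)) /cint.
  by congr (Complex _ _); apply: rint_meq => // B mB; exact: PE.
rewrite complexr0 -/F cP -cintZ; last exact: iF.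
rewrite /Rmu -/(cint leb _); congr cint; apply/funext => x.
rewrite mulrCA -rmorphM /g mulrA mulfV ?mul1r//; last by rewrite gt_eqF.
Qed.

End compound_poisson.

Theorem theorem4p3 (R : realType) (t th la : R)
  (mu_la mu_1 mu_s : probability R R) :
  0 < t -> 0 < th -> 1 < la ->
  is_mu t th la mu_la -> is_mu t th 1 mu_1 -> is_mu t th (1 + t / th) mu_s ->
  let q := t / (th * (la - 1)) in
                                                                        
  ((exists rho, is_boxtimes (MP 1 q) (minv (MP 1 (1 + t / th))) rho) /\
   (forall rho, is_boxtimes (MP 1 q) (minv (MP 1 (1 + t / th))) rho ->
      meq mu_la (dil (t * (la - 1)) rho))) /\
                                                  
  ((exists rho, is_boxtimes mu_1 (MP q^-1 q) rho) /\
   (forall rho, is_boxtimes mu_1 (MP q^-1 q) rho -> meq mu_la rho)) /\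
                                                                          
  ((exists rho, is_boxtimes mu_1 (MP 1 1) rho) /\
   (forall rho, is_boxtimes mu_1 (MP 1 1) rho -> meq mu_s rho)) /\
  free_compound_poisson mu_s.
Proof.
move=> t0 th0 la1 mu_la_is mu_1_is mu_s_is q.
have las1 : 1 < 1 + t / th by rewrite ltrDl divr_gt0.
have qs1 : t / (th * (1 + t / th - 1)) = 1.
  have tn : t != 0 by rewrite gt_eqF.
  have thn : th != 0 by rewrite gt_eqF.
by have -> : th * (1 + t / th - 1) = t by [field]; exact: divff.
split; first exact: boxtimes_MP_minv_MP.
split; first exact: boxtimes_mu1_MP.
split; last exact: free_compound_poisson_is_mu mu_s_is.
by have := boxtimes_mu1_MP t0 th0 las1 mu_s_is mu_1_is; rewrite qs1 invr1.
Qed.
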